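(* Let $s,d$ be positive integers with $d\ge2$, $\ell=\mathrm{lcm}(1,\dots,d)$, $\ell_r=\ell/r$, and let $\mathbf{M}=\bigoplus_{r=1}^d M_r^{(\ell_r)}$, a pre-$t$-motive over $\mathbb{F}_{p^\ell}$ with rigid analytic trivialization $\Psi=\bigoplus_{r=1}^d\Psi_r$ (so $\Psi^{(-\ell)}=\Phi'\Psi$ where $\Phi'=\bigoplus_r\Phi_r^{(-(\ell_r-1)r)}\cdots\Phi_r^{(-r)}\Phi_r$). Then the Galois group $\Gamma_\Psi$ of $\mathbf{M}$ over $\mathbb{F}_{p^\ell}(t)$ is full, i.e. $$\dim\Gamma_\Psi=d+\sum_{r=1}^d\sum_{n\in U_r(s)}(m_{rn}+1).$$
   Context: Let $p$ be a prime, $k=\mathbb{F}_p(\theta)$, $\bar k$ the algebraic closure of $k$ in a fixed algebraic closure $\overline{k_\infty}$ of $k_\infty=\mathbb{F}_p((1/\theta))$, $\mathbb{C}_\infty$ its completion, $\mathbb{L}$ the fraction field of the Tate algebra of series in $t$ over $\mathbb{C}_\infty$ converging on $|t|_\infty\le1$; $f^{(-n)}=\sum a_i^{p^{-n}}t^i$ for $f=\sum a_it^i$, entrywise on matrices. Zeta values: $\zeta_r(n)=\sum_{a\in\mathbb{F}_{p^r}[\theta]\text{ monic}}a^{-n}$. Let $\tilde\pi_r=\theta(-\theta)^{\frac1{p^r-1}}\prod_{i\ge1}(1-\theta^{1-p^{ri}})^{-1}$ and $\Omega_r(t)=(-\theta)^{\frac{-p^r}{p^r-1}}\prod_{i\ge1}(1-t/\theta^{p^{ri}})$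 (fixed compatible roots). Let $L_{ri}=\prod_{j=1}^i(\theta-\theta^{p^{rj}})$, $\mathrm{Plog}_{rn}(z)=\sum_{i\ge0}z^{p^{ri}}/L_{ri}^n$ for $|z|_\infty<|\theta|_\infty^{np^r/(p^r-1)}$, and for such $\alpha\in\bar k^\times$, $L_{\alpha,rn}(t)=\alpha+\sum_{i\ge1}\alpha^{p^{ri}}/\bigl((t-\theta^{p^r})^n\cdots(t-\theta^{p^{ri}})^n\bigr)$, so $L_{\alpha,rn}(\theta)=\mathrm{Plog}_{rn}(\alpha)$. By Anderson–Thakur, for all $r,n$ there exist $l_{rn}<np^r/(p^r-1)$ and $h_{rn,i}\in\mathbb{F}_{p^r}(\theta)$ with $\zeta_r(n)=\sum_{i=0}^{l_{rn}}h_{rn,i}\mathrm{Plog}_{rn}(\theta^i)$; fix these. For $(p^r-1)\nmid n$ let $N_{rn}$ be the $\mathbb{F}_{p^r}(\theta)$-span of $\tilde\pi_r^n$ and $\mathrm{Plog}_{rn}(\theta^i)$, $0\le i\le l_{rn}$, of dimension $m_{rn}+2$, and fix $\alpha_{0,rn},\dots,\alpha_{m_{rn},rn}\in\{1,\theta,\dots,\theta^{l_{rn}}\}$ such that both $\{\tilde\pi_r^n,\mathrm{Plog}_{rn}(\alpha_{0,rn}),\dots,\mathrm{Plog}_{rn}(\alpha_{m_{rn},rn})\}$ and $\{\tilde\pi_r^n,\zeta_r(n),\mathrm{Plog}_{rn}(\alpha_{1,rn}),\dots,\mathrm{Plog}_{rn}(\alpha_{m_{rn},rn})\}$ are bases of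 $N_{rn}$. Let $U_r(s)=\{1\}$ if $p=2,r=1$, and otherwise $U_r(s)=\{1\le n\le s: p\nmid n,\ (p^r-1)\nmid n\}$. For $p=2,r=1$ put $\Phi_{11}=(t-\theta)$, $\Psi_{11}=\Omega_1$ ($1\times1$) and $m_{11}+1:=0$. Otherwise for $n\in U_r(s)$, with $m=m_{rn}$, $\alpha_j=\alpha_{j,rn}$: $\Phi_{rn}\in\mathrm{GL}_{m+2}(\bar k(t))$ is the identity except its first column is $((t-\theta)^n,\alpha_0^{(-r)}(t-\theta)^n,\dots,\alpha_m^{(-r)}(t-\theta)^n)^T$, and $\Psi_{rn}\in\mathrm{GL}_{m+2}(\mathbb{L})$ is the identity except its first column is $(\Omega_r^n,\Omega_r^nL_{\alpha_0,rn},\dots,\Omega_r^nL_{\alpha_m,rn})^T$; then $\Psi_{rn}^{(-r)}=\Phi_{rn}\Psi_{rn}$. Put $\Phi_r=\bigoplus_{n\in U_r(s)}\Phi_{rn}$, $\Psi_r=\bigoplus_{n\in U_r(s)}\Psi_{rn}$ (block diagonal); $M_r$ is the pre-$t$-motive over $\mathbb{F}_{p^r}$ (left $\bar k(t)[\sigma^r,\sigma^{-r}]$-module, $\sigma^rf=f^{(-r)}\sigma^r$) with $\sigma^r\mathbf{m}=\Phi_r\mathbf{m}$, and $M_r^{(\ell_r)}$ is the same space as a $\bar k(t)[\sigma^\ell,\sigma^{-\ell}]$-module. Galois group: for $\Psi\in\mathrm{GL}_N(\mathbb{L})$, with $\Psi_1,\Psi_2$ having entries $\Psi_{ij}\otimes1$,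 $1\otimes\Psi_{ij}$ in $\mathbb{L}\otimes_{\bar k(t)}\mathbb{L}$, $\widetilde\Psi=\Psi_1^{-1}\Psi_2$, and $\mu:\mathbb{F}_{p^\ell}(t)[X,1/\det X]\to\mathbb{L}\otimes_{\bar k(t)}\mathbb{L}$, $X_{ij}\mapsto\widetilde\Psi_{ij}$, set $\Gamma_\Psi=\mathrm{Spec}(\mathrm{im}\,\mu)\subseteq\mathrm{GL}_N/\mathbb{F}_{p^\ell}(t)$. *)

(* Defs.v *)
From HB Require Import structures.
From mathcomp Require Import all_boot all_order all_algebra.
From mathcomp Require Import boolp classical_sets functions cardinality.
From mathcomp Require Import fsbigop reals.
From mathcomp Require mpoly.

Set Implicit Arguments.
Unset Strict Implicit.
Unset Printing Implicit Defensive.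

Import Order.TTheory GRing.Theory Num.Theory.
Local Open Scope classical_set_scope.
Local Open Scope ring_scope.

Section Subfields.
Variable C : fieldType.
Implicit Types (F : set C) (x : C) (v : seq C).

Definition coefs_in F (a : {poly C}) := forall i, F a`_i.

Definition algebraic_over F : set C :=
  [set x | exists2 a : {poly C}, a != 0 /\ coefs_in F a & root a x].

Definition adjoin F x : set C :=
  [set y | exists a b : {poly C},
     [/\ coefs_in F a, coefs_in F b, b.[x] != 0 & y = a.[x] / b.[x]]].

Definition span_over F v : set C :=
  [set x | exists2 c : nat -> C, forall i, F (c i)
         & x = \sum_(i < size v) c i * v`_i].

Definition free_over F v :=
  forall c : nat -> C, (forall i, F (c i)) ->
    \sum_(i < size v) c i * v`_i = 0 -> forall i, (i < size v)%N -> c i = 0.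

Definition basis_over F (N : set C) v := free_over F v /\ span_over F v = N.

End Subfields.

Section AbsoluteValue.
Variables (R : realType) (C : fieldType) (abs : C -> R).

Definition tends_to (u : nat -> C) (l : C) :=
  forall e : R, 0 < e -> exists N : nat, forall n, (N <= n)%N -> abs (u n - l) < e.

Definition cauchy (u : nat -> C) :=
  forall e : R, 0 < e ->
    exists N : nat, forall m n, (N <= m)%N -> (N <= n)%N -> abs (u m - u n) < e.

(* F_p((1/theta)): the elements  sum_{i >= 0} a_i theta^(n - i), a_i in F_p. *)
Definition laurent (theta : C) : set C :=
  [set x | exists (n : nat) (a : nat -> nat),
     tends_to (fun N => theta ^+ n * \sum_(0 <= i < N) (a i)%:R / theta ^+ i) x].

End AbsoluteValue.

(* C_oo is characterised, uniquely up to an isometric isomorphism, as a complete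
   algebraically closed nonarchimedean valued field of characteristic p in which
   the algebraic closure of k_oo = F_p((1/theta)) is dense. As Cfield is
   algebraically closed, the set of elements algebraic over k_oo is an algebraic
   closure of k_oo. *)
Record Cinfty (R : realType) (p : nat) := MkCinfty {
  Cfield :> closedFieldType;
  Cabs : Cfield -> R;
  theta : Cfield;
  Cinfty_pchar : p \in [pchar Cfield];
  Cabs_ge0 : forall x, 0 <= Cabs x;
  Cabs_eq0 : forall x, (Cabs x == 0) = (x == 0);
  CabsM : forall x y, Cabs (x * y) = Cabs x * Cabs y;
  CabsD_max : forall x y, Cabs (x + y) <= Num.max (Cabs x) (Cabs y);
  Cabs_theta : Cabs theta = p%:R;
  Cinfty_complete : forall u : nat -> Cfield,
    cauchy Cabs u -> exists l, tends_to Cabs u l;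
  Cinfty_dense : forall (x : Cfield) (e : R), 0 < e ->
    exists2 y, algebraic_over (laurent Cabs theta) y & Cabs (x - y) < e
}.

Arguments theta {R p c}.

Section CinftyTheory.
Variables (R : realType) (p : nat) (X : Cinfty R p).
Local Notation C := (Cfield X).
Local Notation abs := (@Cabs R p X).

Definition Clim (u : nat -> C) : C := xget 0 [set l | tends_to abs u l].

(* Unconditional sum of a family indexed by a set, as the limit of the net of
   its finite partial sums. *)
Definition has_usum (A : set C) (f : C -> C) (s : C) :=
  forall e : R, 0 < e -> exists B0 : set C,
    [/\ finite_set B0, B0 `<=` A
      & forall B : set C, finite_set B -> B0 `<=` B -> B `<=` A ->
          abs (\sum_(a \in B) f a - s) < e].

Definition usum (A : set C) (f : C -> C) : C := xget 0 [set s | has_usum A f s].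

(* The field with p^r elements inside C_oo. *)
Definition Fq (r : nat) : set C := [set x | x ^+ (p ^ r) = x].

Definition Fq_theta (r : nat) : set C := adjoin (Fq r) theta.

Definition kbar : set C := algebraic_over (Fq_theta 1).

(* x^(p^-n): the p^n-th root is unique in characteristic p. *)
Definition Croot (n : nat) (x : C) : C := xget 0 [set y | y ^+ (p ^ n) = x].

Lemma Cinfty_p_gt0 : (0 < p)%N.
Proof. by apply: prime_gt0; apply: (pcharf_prime (Cinfty_pchar X)). Qed.

Lemma abs0 : abs 0 = 0.
Proof. by apply/eqP; rewrite Cabs_eq0. Qed.

Lemma abs1 : abs 1 = 1.
Proof.
have : abs 1 * abs 1 = abs 1 by rewrite -CabsM mulr1.
have n0 : abs 1 != 0 by rewrite Cabs_eq0 oner_eq0.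
by move/(canRL (mulfK n0)); rewrite divff.
Qed.

Lemma absX n x : abs (x ^+ n) = abs x ^+ n.
Proof. by elim: n => [|n IH]; rewrite ?expr0 ?abs1 // !exprS CabsM IH. Qed.

Lemma absN x : abs (- x) = abs x.
Proof.
have : abs (- x) ^+ 2 = abs x ^+ 2 by rewrite -!absX sqrrN.
by move/eqP; rewrite eqrXn2 ?Cabs_ge0 // => /eqP.
Qed.

Lemma abs_add_lt x y (e : R) : abs x < e -> abs y < e -> abs (x + y) < e.
Proof. by move=> hx hy; apply: le_lt_trans (CabsD_max x y) _; rewrite gt_max hx. Qed.

Lemma abs_sum_lt n (f : nat -> C) (e : R) : 0 < e ->
  (forall i, (i < n)%N -> abs (f i) < e) -> abs (\sum_(i < n) f i) < e.
Proof.
move=> e0; elim: n => [|n IH] h; first by rewrite big_ord0 abs0.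
rewrite big_ord_recr /=; apply: abs_add_lt; last exact: h.
by apply: IH => i hi; apply: h; apply: ltnW.
Qed.

(* A power series converges on |t| <= 1 iff its coefficients tend to 0. *)
Record tate := Tate { tcoef : nat -> C; tcoefP : tends_to abs tcoef 0 }.

HB.instance Definition _ := gen_eqMixin tate.
HB.instance Definition _ := gen_choiceMixin tate.

Implicit Types f g h : tate.

Lemma tate_ext f g : tcoef f =1 tcoef g -> f = g.
Proof.
case: f g => [f fP] [g gP] /= /funext fg; case: _ / fg gP => gP.
by congr Tate; apply: Prop_irrelevance.
Qed.

Lemma tate0P : tends_to abs (fun=> 0) 0.
Proof. by move=> e e0; exists 0%N => n _; rewrite subr0 abs0. Qed.
Definition tate0 := Tate tate0P.

Lemma tateNP f : tends_to abs (fun i => - tcoef f i) 0.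
Proof.
move=> e /(tcoefP f)[N hN]; exists N => n /hN; rewrite !subr0.
by rewrite absN.
Qed.
Definition tateN f := Tate (tateNP f).

Lemma tateDP f g : tends_to abs (fun i => tcoef f i + tcoef g i) 0.
Proof.
move=> e e0; have [N hN] := tcoefP f e0; have [M hM] := tcoefP g e0.
exists (maxn N M) => n; rewrite geq_max => /andP[/hN hf /hM hg].
by rewrite subr0; apply: abs_add_lt; [move: hf|move: hg]; rewrite subr0.
Qed.
Definition tateD f g := Tate (tateDP f g).

Lemma tateDA : associative tateD.
Proof. by move=> f g h; apply: tate_ext => i /=; rewrite addrA. Qed.
Lemma tateDC : commutative tateD.
Proof. by move=> f g; apply: tate_ext => i /=; rewrite addrC. Qed.
Lemma tate0D : left_id tate0 tateD.
Proof. by move=> f; apply: tate_ext => i /=; rewrite add0r. Qed.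
Lemma tateND : left_inverse tate0 tateN tateD.
Proof. by move=> f; apply: tate_ext => i /=; rewrite addNr. Qed.

HB.instance Definition _ := GRing.isZmodule.Build tate tateDA tateDC tate0D tateND.

Lemma tate_bounded f : exists2 B : R, 0 < B & forall i, abs (tcoef f i) < B.
Proof.
have [N hN] := tcoefP f ltr01.
have [B B0 hB] : exists2 B : R, 0 < B & forall i, (i < N)%N -> abs (tcoef f i) < B.
  elim: {hN}N => [|N [B B0 hB]]; first by exists 1.
  exists (Num.max B (abs (tcoef f N) + 1)); first by rewrite lt_max B0.
  move=> i; rewrite ltnS leq_eqVlt => /orP[/eqP->|/hB h]; rewrite lt_max ?h //.
  by rewrite ltrDl ltr01 orbT.
exists (Num.max B 1); first by rewrite lt_max B0.
move=> i; rewrite lt_max; case: (ltnP i N) => [/hB->//|/hN].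
by rewrite subr0 => ->; rewrite orbT.
Qed.

Definition cauchy_prod (a b : nat -> C) n := \sum_(i < n.+1) a i * b (n - i)%N.

Lemma tateMP f g : tends_to abs (cauchy_prod (tcoef f) (tcoef g)) 0.
Proof.
move=> e e0; have [A A0 hA] := tate_bounded f; have [B B0 hB] := tate_bounded g.
have [N hN] := tcoefP f (divr_gt0 e0 B0); have [M hM] := tcoefP g (divr_gt0 e0 A0).
exists (N + M)%N => n hn; rewrite subr0 /cauchy_prod.
apply: (abs_sum_lt (f := fun i => tcoef f i * tcoef g (n - i)%N)) => // i hi.
rewrite CabsM; case: (leqP N i) => hNi.
  have := hN _ hNi; rewrite subr0 ltr_pdivlMr // => h.
  by apply: le_lt_trans h; rewrite ler_wpM2l ?Cabs_ge0 // ltW.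
have /hM : (M <= n - i)%N.
  by rewrite leq_subRL -1?ltnS //; apply: leq_trans hn; rewrite leq_add2r ltnW.
rewrite subr0 ltr_pdivlMr // => h; apply: le_lt_trans h.
by rewrite mulrC ler_wpM2l ?Cabs_ge0 // ltW.
Qed.
Definition tateM f g := Tate (tateMP f g).

Lemma tate_of_polyP (a : {poly C}) : tends_to abs (fun i => a`_i) 0.
Proof.
move=> e e0; exists (size a) => n hn.
by rewrite subr0 nth_default // abs0.
Qed.
Definition tate_of_poly (a : {poly C}) : tate := Tate (tate_of_polyP a).

Let trunc m f : {poly C} := \poly_(i < m.+1) tcoef f i.

Let truncM m n f g : (n <= m)%N ->
  tcoef (tateM f g) n = (trunc m f * trunc m g)`_n.
Proof.
move=> hnm; rewrite coefM /= /cauchy_prod; apply: eq_bigr => i _.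
rewrite !coef_poly !ltnS (leq_trans (leq_subr _ _) hnm).
by rewrite (leq_trans _ hnm) // -ltnS.
Qed.

Lemma tateMC : commutative tateM.
Proof. by move=> f g; apply: tate_ext => n; rewrite !(truncM _ _ (leqnn n)) mulrC. Qed.

Lemma tateMA : associative tateM.
Proof.
move=> f g h; apply: tate_ext => n; rewrite !(truncM _ _ (leqnn n)).
have E a b c : (trunc n a * trunc n (tateM b c))`_n
    = (trunc n a * (trunc n b * trunc n c))`_n.
  rewrite !coefM; apply: eq_bigr => i _; congr (_ * _).
  by rewrite /trunc coef_poly ltnS leq_subr (truncM _ _ (leq_subr i n)).
by rewrite E [RHS](congr1 (fun a : {poly C} => a`_n) (mulrC _ _)) E mulrA (mulrC (trunc n h)).
Qed.

Definition tate1 : tate := tate_of_poly 1.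

Lemma tate1M : left_id tate1 tateM.
Proof.
move=> f; apply: tate_ext => n; rewrite (truncM _ _ (leqnn n)).
have -> : trunc n tate1 = 1.
  apply/polyP => i; rewrite coef_poly /=; case: ltnP => // hi.
  by rewrite coef1; case: i hi.
by rewrite mul1r coef_poly ltnSn.
Qed.

Lemma tateMDl : left_distributive tateM tateD.
Proof.
move=> f g h; apply: tate_ext => n /=; rewrite /cauchy_prod -big_split /=.
by apply: eq_bigr => i _; rewrite mulrDl.
Qed.

Lemma tate1_neq0 : tate1 != 0 :> tate.
Proof.
apply/eqP => /(congr1 (fun f => tcoef f 0)) /=; rewrite coef1 /= => /eqP.
by rewrite oner_eq0.
Qed.

HB.instance Definition _ :=
  GRing.Zmodule_isComNzRing.Build tate tateMA tateMC tate1M tateMDl tate1_neq0.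

Definition tate_unit : {pred tate} := [pred f | `[< exists g, g * f = 1 >]].
Definition tate_inv f : tate := xget f [set g | g * f = 1].

Lemma tate_mulVx : {in tate_unit, left_inverse 1 tate_inv *%R}.
Proof.
move=> f; rewrite inE /= => exg.
by have /= := @xgetPex _ f [set g | g * f = 1] exg.
Qed.

Lemma tate_unitPl f g : g * f = 1 -> f \in tate_unit.
Proof. by move=> gf; rewrite inE /=; exists g. Qed.

Lemma tate_invx_out : {in [predC tate_unit], tate_inv =1 id}.
Proof.
move=> f; rewrite inE /= => nf; rewrite /tate_inv; case: xgetP => // y _ /= yf.
by rewrite (tate_unitPl yf) in nf.
Qed.

HB.instance Definition _ :=
  GRing.ComNzRing_hasMulInverse.Build tate tate_mulVx tate_unitPl tate_invx_out.

Lemma tate_lead f : f != 0 ->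
  exists2 i, tcoef f i != 0 & forall j, (j < i)%N -> tcoef f j = 0.
Proof.
move=> f0; have ex : exists i, tcoef f i != 0.
  apply: contrapT => /forallNP h; case/eqP: f0; apply: tate_ext => i /=.
  by apply/eqP/negPn/negP; exact: h.
case: (ex_minnP ex) => i hi mi; exists i => // j hj.
by apply/eqP; apply: contraTT hj => /mi; rewrite -leqNgt.
Qed.

Lemma tate_integral f g : f * g = 0 -> (f == 0) || (g == 0).
Proof.
move=> fg; apply: contraPT fg; rewrite negb_or => /andP[/tate_lead[i fi mi]].
move=> /tate_lead[j gj mj] /(congr1 (fun h => tcoef h (i + j))) /=.
rewrite /cauchy_prod (bigD1 (inord i)) //= inordK ?ltnS ?leq_addr // addKn.
rewrite big1 ?addr0 => [/eqP|k hk]; first by rewrite mulf_eq0 (negPf fi) (negPf gj).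
case: (ltngtP k i) => [/mi->|hik|/esym ik]; first by rewrite mul0r.
  have hk' : (k <= i + j)%N by rewrite -ltnS ltn_ord.
  by rewrite mj ?mulr0 // -(ltn_add2l k) subnKC // ltn_add2r.
by case/eqP: hk; apply: val_inj; rewrite /= inordK ?ik // ltnS leq_addr.
Qed.

HB.instance Definition _ := GRing.ComUnitRing_isIntegral.Build tate tate_integral.

(* Limits in the Tate algebra, for the Gauss norm. *)
Definition tate_lim (u : nat -> tate) : tate :=
  xget 0 [set f | forall e : R, 0 < e -> exists N : nat, forall n, (N <= n)%N ->
                  forall i, abs (tcoef (u n - f) i) < e].

Lemma tate_twistP n f : tends_to abs (fun i => Croot n (tcoef f i)) 0.
Proof.
move=> e e0; have pn0 : (0 < p ^ n)%N by rewrite expn_gt0 Cinfty_p_gt0.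
have [N hN] := tcoefP f (exprn_gt0 (p ^ n) e0).
exists N => i /hN; rewrite !subr0 /Croot; case: xgetP => [y _ /= <-|_ _].
  by rewrite absX ltr_pXn2r // nnegrE ?Cabs_ge0 // ltW.
by rewrite abs0.
Qed.
Definition tate_twist n f : tate := Tate (tate_twistP n f).

Definition LL : fieldType := {fraction tate}.

Definition toLL : tate -> LL := @FracField.tofrac tate.

Definition poly_toLL (a : {poly C}) : LL := toLL (tate_of_poly a).

Definition ratfun (F : set C) : set LL :=
  [set x | exists a b : {poly C},
     [/\ coefs_in F a, coefs_in F b, b != 0 & x = poly_toLL a / poly_toLL b]].

Definition kbar_t : set LL := ratfun kbar.
Definition Fq_t (r : nat) : set LL := ratfun (Fq r).

(* f^(-n): as the n-fold inverse Frobenius twist is a ring automorphism of the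
   Tate algebra, this does not depend on the fraction representing x. *)
Definition twist (n : nat) (x : LL) : LL :=
  toLL (tate_twist n \n_(repr x)) / toLL (tate_twist n \d_(repr x)).

Definition twist_mx m1 m2 (n : nat) (A : 'M[LL]_(m1, m2)) := map_mx (twist n) A.

End CinftyTheory.

Arguments Fq {R p X}.
Arguments Fq_theta {R p X}.
Arguments kbar {R p X}.
Arguments kbar_t {R p X}.
Arguments Fq_t {R p X}.
Arguments twist_mx {R p X m1 m2}.

Section Tensor.
Variables (L : fieldType) (K : set L).

Definition balanced (G : zmodType) (B : L -> L -> G) :=
  [/\ forall a a' b, B (a + a') b = B a b + B a' b,
      forall a b b', B a (b + b') = B a b + B a b'
    & forall c a b, K c -> B (c * a) b = B a (c * b)].

(* The list [:: (a_1, b_1); ...; (a_n, b_n)] stands for sum_i a_i (x) b_i; two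
   such sums are identified when every K-balanced biadditive map gives them the
   same value. *)
Definition bsum (G : zmodType) (B : L -> L -> G) (s : seq (L * L)) : G :=
  \sum_(x <- s) B x.1 x.2.

Definition tens_eq (s s' : seq (L * L)) : bool :=
  `[< forall (G : zmodType) (B : L -> L -> G), balanced B -> bsum B s = bsum B s' >].

Lemma tens_eq_refl : reflexive tens_eq.
Proof. by move=> s; apply/asboolP. Qed.
Lemma tens_eq_sym : symmetric tens_eq.
Proof.
by move=> s s'; apply/asboolP/asboolP => h G B bB; rewrite h.
Qed.
Lemma tens_eq_trans : transitive tens_eq.
Proof.
by move=> s s' s'' /asboolP h /asboolP h'; apply/asboolP => G B bB; rewrite h ?h'.
Qed.

Canonical tens_equiv := EquivRel tens_eq tens_eq_refl tens_eq_sym tens_eq_trans.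

Definition tens := {eq_quot tens_equiv}%qT.
HB.instance Definition _ := Choice.on tens.
HB.instance Definition _ := EqQuotient.on tens.

Local Open Scope quotient_scope.
Let cls (s : seq (L * L)) : tens := \pi_tens s.

Let clsP s s' : cls s = cls s' <->
  (forall (G : zmodType) (B : L -> L -> G), balanced B -> bsum B s = bsum B s').
Proof. by split=> [/eqmodP/asboolP //|h]; apply/eqmodP/asboolP. Qed.

Let bsum_repr (G : zmodType) (B : L -> L -> G) s : balanced B ->
  bsum B (repr (cls s)) = bsum B s.
Proof. by move=> bB; move/clsP: (reprK (cls s)); apply. Qed.

Let bsum_cat (G : zmodType) (B : L -> L -> G) s s' :
  bsum B (s ++ s') = bsum B s + bsum B s'.
Proof. exact: big_cat. Qed.

Definition opp_seq (s : seq (L * L)) := [seq (- x.1, x.2) | x <- s].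
Definition mul_seq (s s' : seq (L * L)) :=
  [seq (x.1 * y.1, x.2 * y.2) | x <- s, y <- s'].

Let bsum_opp (G : zmodType) (B : L -> L -> G) s : balanced B ->
  bsum B (opp_seq s) = - bsum B s.
Proof.
move=> [BDl _ _]; rewrite /bsum /opp_seq big_map /= -sumrN; apply: eq_bigr => x _ /=.
have B0 b : B 0 b = 0 by apply: (addIr (B 0 b)); rewrite -BDl !add0r.
by apply/eqP; rewrite -addr_eq0 -BDl addNr B0.
Qed.

Let bmul (G : zmodType) (B : L -> L -> G) s a b :=
  \sum_(y <- s) B (a * y.1) (b * y.2).

Let bmul_balanced (G : zmodType) (B : L -> L -> G) s :
  balanced B -> balanced (bmul B s).
Proof.
move=> [BDl BDr BK]; split=> [a a' b|a b b'|c a b Kc]; rewrite /bmul -?big_split;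
  apply: eq_bigr => y _ /=; first by rewrite mulrDl BDl.
  by rewrite mulrDl BDr.
by rewrite -!mulrA BK.
Qed.

Let bsum_mul (G : zmodType) (B : L -> L -> G) s s' :
  bsum B (mul_seq s s') = bsum (bmul B s') s.
Proof. by rewrite /bsum /mul_seq big_allpairs_dep. Qed.

Let bsum_mulC (G : zmodType) (B : L -> L -> G) s s' :
  bsum B (mul_seq s s') = bsum B (mul_seq s' s).
Proof.
rewrite !bsum_mul /bsum /bmul exchange_big /=; apply: eq_bigr => x _.
by apply: eq_bigr => y _; rewrite (mulrC x.1) (mulrC x.2).
Qed.

Definition tens0 : tens := cls [::].
Definition tens1 : tens := cls [:: (1, 1)].
Definition tensN (x : tens) : tens := cls (opp_seq (repr x)).
Definition tensD (x y : tens) : tens := cls (repr x ++ repr y).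
Definition tensM (x y : tens) : tens := cls (mul_seq (repr x) (repr y)).

Let clsE (x : tens) : exists s, x = cls s.
Proof. by exists (repr x); rewrite /cls reprK. Qed.

Let clsN s : tensN (cls s) = cls (opp_seq s).
Proof. by apply/clsP => G B bB; rewrite !bsum_opp // bsum_repr. Qed.
Let clsD s s' : tensD (cls s) (cls s') = cls (s ++ s').
Proof. by apply/clsP => G B bB; rewrite !bsum_cat !bsum_repr. Qed.
Let clsM s s' : tensM (cls s) (cls s') = cls (mul_seq s s').
Proof.
apply/clsP => G B bB; rewrite bsum_mul bsum_repr; last exact: bmul_balanced.
by rewrite -bsum_mul bsum_mulC bsum_mul bsum_repr ?bsum_mul -?bsum_mul 1?bsum_mulC //;
  exact: bmul_balanced.
Qed.

Let tensDA : associative tensD.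
Proof.
move=> x y z; have [s ->] := clsE x; have [s' ->] := clsE y; have [s'' ->] := clsE z.
by rewrite !clsD catA.
Qed.
Let tensDC : commutative tensD.
Proof.
move=> x y; have [s ->] := clsE x; have [s' ->] := clsE y.
by rewrite !clsD; apply/clsP => G B bB; rewrite !bsum_cat addrC.
Qed.
Let tens0D : left_id tens0 tensD.
Proof. by move=> x; have [s ->] := clsE x; rewrite clsD. Qed.
Let tensND : left_inverse tens0 tensN tensD.
Proof.
move=> x; have [s ->] := clsE x; rewrite clsN clsD; apply/clsP => G B bB.
by rewrite bsum_cat bsum_opp // addNr /bsum big_nil.
Qed.

HB.instance Definition _ := GRing.isZmodule.Build tens tensDA tensDC tens0D tensND.

Let tensMC : commutative tensM.
Proof.
move=> x y; have [s ->] := clsE x; have [s' ->] := clsE y.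
by rewrite !clsM; apply/clsP => G B bB; rewrite bsum_mulC.
Qed.
Let tensMA : associative tensM.
Proof.
move=> x y z; have [s ->] := clsE x; have [s' ->] := clsE y; have [s'' ->] := clsE z.
rewrite !clsM; apply/clsP => G B bB; rewrite !bsum_mul.
apply: eq_bigr => a _; rewrite /bmul /mul_seq big_allpairs_dep /=.
by apply: eq_bigr => b _; apply: eq_bigr => c _; rewrite !mulrA.
Qed.
Let tens1M : left_id tens1 tensM.
Proof.
move=> x; have [s ->] := clsE x; rewrite clsM; apply/clsP => G B bB.
rewrite bsum_mul /bsum /bmul big_seq1 /=; apply: eq_bigr => y _.
by rewrite !mul1r.
Qed.
Let tensMDl : left_distributive tensM tensD.
Proof.
move=> x y z; have [s ->] := clsE x; have [s' ->] := clsE y; have [s'' ->] := clsE z.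
by rewrite !(clsM, clsD); apply/clsP => G B bB; rewrite bsum_cat !bsum_mul bsum_cat.
Qed.
Let tens1_neq0 : tens1 != 0 :> tens.
Proof.
apply/eqP => /clsP /(_ L *%R); rewrite /bsum big_seq1 big_nil /= mulr1 => h.
suff /h/eqP : balanced (@GRing.mul L) by rewrite oner_eq0.
by split=> [a a' b|a b b'|c a b _]; rewrite ?mulrDl ?mulrDr // mulrCA mulrA.
Qed.

HB.instance Definition _ :=
  GRing.Zmodule_isComNzRing.Build tens tensMA tensMC tens1M tensMDl tens1_neq0.

Definition tensor (a b : L) : tens := \pi_tens [:: (a, b)].

End Tensor.

Section Spectrum.
Variable T : comNzRingType.
Implicit Types A P : set T.

Definition prime_ideal A P :=
  [/\ P `<=` A, P 0, forall x y, P x -> P y -> P (x + y),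
      forall a x, A a -> P x -> P (a * x)
    & ~ P 1 /\ forall a b, A a -> A b -> P (a * b) -> P a \/ P b].

Definition Spec A : set (set T) := [set P | prime_ideal A P].

(* A chain P_0 < ... < P_n in a set Z of prime ideals. *)
Definition prime_chain (Z : set (set T)) (n : nat) :=
  exists c : nat -> set T, (forall i, (i <= n)%N -> Z (c i)) /\
    (forall i, (i < n)%N -> c i `<` c i.+1).

Definition Krull_dim (Z : set (set T)) (n : nat) :=
  prime_chain Z n /\ forall m, prime_chain Z m -> (m <= n)%N.

End Spectrum.

Section Series.
Variables (R : realType) (p : nat) (X : Cinfty R p).
Local Notation C := (Cfield X).
Local Notation th := (@theta R p X).
Implicit Types (r n : nat) (al z : C).

Definition monics r : set C :=
  [set x | exists2 a : {poly C}, a \is monic /\ coefs_in (Fq r) a & x = a.[th]].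

Definition zeta r n : C := usum (monics r) (fun a => a ^- n).

Definition Lden r i : C := \prod_(1 <= j < i.+1) (th - th ^+ (p ^ (r * j))).

Definition Plog r n z : C :=
  Clim (fun N => \sum_(0 <= i < N) z ^+ (p ^ (r * i)) / Lden r i ^+ n).

(* eta r is the chosen (p^r - 1)-th root of -theta. *)
Variable eta : nat -> C.

(* theta^(1 - p^(ri)) is written theta / theta^(p^(ri)). *)
Definition pi_tilde r : C :=
  th * eta r *
  Clim (fun N => \prod_(1 <= i < N.+1) (1 - th / th ^+ (p ^ (r * i)))^-1).

Let cst (c : C) : tate X := tate_of_poly c%:P.
Let t : tate X := tate_of_poly 'X.

Definition Omega r : tate X :=
  cst (eta r ^- (p ^ r)) *
  tate_lim (fun N => \prod_(1 <= i < N.+1) (1 - cst (th ^- (p ^ (r * i))) * t)).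

(* t - c is a unit of the Tate algebra for |c| > 1. *)
Definition Lseries al r n : tate X :=
  cst al +
  tate_lim (fun N => \sum_(1 <= i < N.+1) cst (al ^+ (p ^ (r * i))) /
    \prod_(1 <= j < i.+1) (t - cst (th ^+ (p ^ (r * j)))) ^+ n).

Definition Nspan r n (l : nat) : set C :=
  span_over (Fq_theta r)
    (pi_tilde r ^+ n :: [seq Plog r n (th ^+ i) | i <- iota 0 l.+1]).

End Series.

Definition Uset (p r s : nat) : seq nat :=
  if (p == 2%N) && (r == 1%N) then [:: 1%N]
  else [seq n <- iota 1 s | ~~ (p %| n)%N && ~~ ((p ^ r).-1 %| n)%N].

Section Motives.
Variables (R : realType) (p : nat) (X : Cinfty R p).
Local Notation L := (LL X).

(* A pre-t-motive over F_{p^r}, given on a kbar(t)-basis m by sigma^r m = Phi m. *)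
Record pre_t_motive := PreTMotive { rank : nat; Phi_of : 'M[L]_rank }.

Definition in_GL_kbar_t N (A : 'M[L]_N) :=
  (forall i j, kbar_t (A i j)) /\ A \in unitmx.

(* Phi^(-(e-1)r) ... Phi^(-r) Phi, the matrix of (sigma^r)^e *)
Fixpoint iter_Phi N (r : nat) (Phi : 'M[L]_N) (e : nat) : 'M[L]_N :=
  if e is e'.+1 then twist_mx (e' * r) Phi *m iter_Phi r Phi e' else 1%:M.

(* M^(e): the pre-t-motive M over F_{p^r}, viewed over F_{p^(re)} *)
Definition derived (r e : nat) (M : pre_t_motive) : pre_t_motive :=
  PreTMotive (iter_Phi r (Phi_of M) e).

Definition direct_sum n (M : 'I_n -> pre_t_motive) : pre_t_motive :=
  PreTMotive (\mxdiag_(i < n) Phi_of (M i)).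

(* M is a pre-t-motive over F_{p^r} with rigid analytic trivialization Psi. *)
Definition rigid_analytic_trivialization (r : nat) (M : pre_t_motive)
    (Psi : 'M[L]_(rank M)) :=
  [/\ in_GL_kbar_t (Phi_of M), Psi \in unitmx
    & twist_mx r Psi = Phi_of M *m Psi].

Definition LtensL := tens (@kbar_t R p X).
Definition inL1 (x : L) : LtensL := tensor kbar_t x 1.
Definition inL2 (x : L) : LtensL := tensor kbar_t 1 x.

Section Galois.
Variables (r N : nat) (Psi : 'M[L]_N).

Definition Psi_tilde : 'M[LtensL]_N :=
  map_mx inL1 (invmx Psi) *m map_mx inL2 Psi.

(* mu : F_{p^r}(t)[X, 1/det X] -> L (x) L, X_ij |-> Psi_tilde_ij, maps
   P / (det X)^e to P(Psi_tilde) / (det Psi_tilde)^e. The N * N variables X_ij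
   are ordered as in mxvec, and F_{p^r}(t) maps to L (x) L by
   c |-> c (x) 1 = 1 (x) c. *)
Definition im_mu : set LtensL :=
  [set x | exists (P : mpoly.mpoly (N * N) L) (e : nat),
     (forall u, Fq_t r (mpoly.mcoeff u P)) /\
     x * (\det Psi_tilde) ^+ e =
       mpoly.mmap inL1 (fun k => mxvec Psi_tilde ord0 k) P].

Definition Galois_group : set (set LtensL) := Spec im_mu.

End Galois.

Section Mr.
Variables (eta : nat -> X) (m : nat -> nat -> nat) (alpha : nat -> nat -> nat -> X).

(* m_{rn} + 1, which is 0 by convention for p = 2 and r = 1 *)
Definition m1 (r n : nat) : nat :=
  if (p == 2%N) && (r == 1%N) then 0%N else (m r n).+1.

Definition Phi_rn (r n : nat) : 'M[L]_((m1 r n).+1) :=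
  \matrix_(i, j)
    if j == ord0 then
      poly_toLL ((if i == ord0 then 1 else Croot r (alpha r n i.-1))%:P
                 * ('X - theta%:P) ^+ n)
    else (i == j)%:R.

Definition Psi_rn (r n : nat) : 'M[L]_((m1 r n).+1) :=
  \matrix_(i, j)
    if j == ord0 then
      toLL (Omega eta r ^+ n
            * (if i == ord0 then 1 else Lseries (alpha r n i.-1) r n))
    else (i == j)%:R.

Variable s : nat.

Definition M_r (r : nat) : pre_t_motive :=
  direct_sum (fun i : 'I_(size (Uset p r s)) =>
    PreTMotive (Phi_rn r (nth 0%N (Uset p r s) i))).

Definition Psi_r (r : nat) : 'M[L]_(rank (M_r r)) :=
  \mxdiag_(i < size (Uset p r s)) Psi_rn r (nth 0%N (Uset p r s) i).

Variable d : nat.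

Definition ell : nat := \big[lcmn/1%N]_(1 <= r < d.+1) r.

(* The index i < d stands for r = i + 1. *)
Definition M_sum : pre_t_motive :=
  direct_sum (fun i : 'I_d => derived i.+1 (ell %/ i.+1) (M_r i.+1)).

Definition Psi_sum : 'M[L]_(rank M_sum) := \mxdiag_(i < d) Psi_r i.+1.

End Mr.
End Motives.

(* Main.v *)
(* The coordinate ring of Gamma_Psi is generated, up to inverting the W_r, by
   W_r = Omega_r^-1 (x) Omega_r and
   Y = (1 (x) Omega_r^n) (1 (x) L - L (x) 1), with L = L_{alpha_j,rn}, so the
   theorem amounts to the algebraic independence of the Omega_r and the
   L_{alpha_j,rn} over kbar(t).

   Let sigma be the twist by ell. Then sigma Omega_r = a_r Omega_r and
   sigma L = L / a_r^n + b with a_r, b in kbar(t). The a_r are multiplicatively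
   independent modulo {sigma y / y}, as one sees by counting zeros in the
   Frobenius orbits of theta. A polynomial relation with minimal leading
   monomial is semi-invariant under sigma. If it involves some L, comparing
   coefficients just below the top weight yields, for a single pair (r, n),
   because p does not divide n, an equation
     sigma y + sum_j c_j b_j^(p^k) = y / a_r^(p^k n)
   with c_j in F_{p^ell}(t) not all zero. One may take k = 0, i.e.
   y Omega_r^n + sum_j c_j Omega_r^n L_j is fixed by sigma. A relation with the
   fewest nonzero c_j is even fixed by the twist by r; evaluating it at t = theta
   gives a linear relation over F_{p^r}(theta) between pi_tilde_r^n and the
   Plog(alpha_j), contradicting the choice of the alpha_j. *)
From HB Require Import structures.
Require Import Defs.
From mathcomp Require Import all_boot all_order all_algebra.
From mathcomp Require Import generic_quotient.
From mathcomp Require Import boolp classical_sets functions cardinality.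
From mathcomp Require Import fsbigop reals.
From mathcomp Require Import mpoly.
From mathcomp Require Import zify ring lra.

Set Implicit Arguments.
Unset Strict Implicit.
Unset Printing Implicit Defensive.

Import Order.TTheory GRing.Theory Num.Theory.
Local Open Scope classical_set_scope.
Local Open Scope ring_scope.

(** * Algebraic independence of solutions of difference equations *)

(** The tensor square is used only as a commutative ring, so everything rests on an injection of a
    polynomial ring into it: given algebraic independence, the image of mu is a polynomial ring over
    F_{p^ell}(t) localised at one determinant. Its Krull dimension is bounded above by counting
    monomials against degrees, and below by setting the variables one after another to their values
    at the identity matrix, where the determinant is 1. Independence over kbar(t) becomes
    independence over L (x) 1 because linearly independent monomials stay so under base change.

    Two mismatches shape the rest. The difference equations have constants in F_{p^ell}(t) for all
    blocks, whereas the polylogarithms of a block are independent over F_{p^r}(theta); hence the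
    descent from the twist by ell to the twist by r. And elements of the Tate algebra converge on
    |t| <= 1 while |theta| = p > 1, so the value at theta is a relation defined by polynomial
    approximation on the disc |t| <= |theta|. That p does not divide n is what lets the p-adic
    valuation of n p^k determine k, and so isolates a single n below the top weight. *)

Lemma mcoeff_prod_univariate (K : comNzRingType) n N (c : 'I_n -> nat -> K)
    (m : 'X_{1..n}) :
  (\prod_v \sum_(i < N) c v i *: 'X_v ^+ i)@_m =
  \prod_v (if (m v < N)%N then c v (m v) else 0).
Proof.
have E (f : {ffun 'I_n -> 'I_N}) : \prod_v (c v (f v) *: 'X_v ^+ (f v))
    = (\prod_v c v (f v)) *: 'X_[[multinom (f i : nat) | i < n]] :> {mpoly K[n]}.
  rewrite scaler_prod mpolyXE_id; congr (_ *: _).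
  by apply: eq_bigr => i _; rewrite mnmE.
rewrite bigA_distr_bigA /= raddf_sum /=.
under eq_bigr => f _ do rewrite E mcoeffZ mcoeffX.
have [/forallP h|/forallPn[v hv]] := boolP [forall v, (m v < N)%N]; last first.
  rewrite [RHS](bigD1 v) //= (negPf hv) mul0r [LHS]big1 // => f _.
  have [fm|_] := eqVneq [multinom (f i : nat) | i < n] m; last by rewrite mulr0.
  by move: hv; rewrite -fm mnmE ltn_ord.
rewrite (bigD1 [ffun v => Ordinal (h v)]) //= [X in _ + X]big1 ?addr0 => [|f hf]; last first.
  have [fm|_] := eqVneq [multinom (f i : nat) | i < n] m; last by rewrite mulr0.
  case/eqP: hf; apply/ffunP => v; apply: val_inj.
  by rewrite ffunE /= -fm mnmE.
rewrite (_ : _ == m = true) ?mulr1; last first.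
  by apply/eqP/mnmP => v; rewrite mnmE ffunE.
by apply: eq_bigr => v _; rewrite ffunE h.
Qed.

(** Effect on one monomial of the substitution X_v -> u_v X_v + b_v that the twist induces. The
    binomials vanish unless m <= m' in every variable. *)
Lemma mcoeff_prod_affine (K : comNzRingType) n (u b : 'I_n -> K) (m' m : 'X_{1..n}) :
  (\prod_v (u v *: 'X_v + (b v)%:MP) ^+ m' v)@_m =
  \prod_v (u v ^+ m v * ('C(m' v, m v)%:R * b v ^+ (m' v - m v))).
Proof.
pose c v i := u v ^+ i * ('C(m' v, i)%:R * b v ^+ (m' v - i)).
transitivity ((\prod_v \sum_(i < (mdeg m').+1) c v i *: 'X_v ^+ i : {mpoly K[n]})@_m).
  congr (_@_m); apply: eq_bigr => v _.
  have hv : (m' v <= mdeg m')%N by rewrite mdegE (bigD1 v) //= leq_addr.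
  rewrite -(big_mkord xpredT (fun i => c v i *: 'X_v ^+ i)).
  rewrite [RHS](big_cat_nat (n := (m' v).+1)) //= [X in _ = _ + X]big1_seq ?addr0.
    rewrite addrC exprDn big_mkord; apply: eq_bigr => i _.
    rewrite exprZn -rmorphXn /= mul_mpolyC scalerA scalerMnl.
    by rewrite /c mulr_natl mulrnAr mulrC.
  move=> i; rewrite mem_index_iota => /andP[_ /andP[hi _]].
  by rewrite /c bin_small // mul0r mulr0 scale0r.
rewrite mcoeff_prod_univariate; apply: eq_bigr => v _; case: ifP => // h.
have {}h : (mdeg m' < m v)%N by rewrite leqNgt h.
rewrite /c bin_small ?mul0r ?mulr0 //; apply: leq_ltn_trans h.
by rewrite mdegE (bigD1 v) //= leq_addr.
Qed.
(** In i C(m,i) = m C(m-1,i-1) the p-part of m divides the left side, and C(m,i) is prime to p. So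
    an exponent m can only drop by multiples of its p-part in characteristic p. *)
Lemma bin_pdiv_dvd (p m i : nat) : prime p -> (0 < m)%N ->
  ~~ (p %| 'C(m, i))%N -> (p ^ logn p m %| i)%N.
Proof.
move=> pp m0 hC; case: i hC => // i hC.
have : (p ^ logn p m %| i.+1 * 'C(m, i.+1))%N.
  by rewrite -mul_bin_diag; apply: dvdn_mulr; exact: pfactor_dvdnn.
by rewrite Gauss_dvdl // coprimeXl // prime_coprime.
Qed.

(** Write m = q m' with q the p-part. Over F_p, (X+1)^m = (X^q+1)^m'; the coefficients of X^q give
    C(m,q) = m' mod p. The smallest drop allowed by [bin_pdiv_dvd] therefore does occur. *)
Lemma bin_plogn (p m : nat) : prime p -> (0 < m)%N ->
  ~~ (p %| 'C(m, p ^ logn p m))%N.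
Proof.
move=> pp m0; have [m' hm' mE] := pfactor_coprime pp m0.
set q := (p ^ logn p m)%N in mE *; have q0 : (0 < q)%N by rewrite expn_gt0 prime_gt0.
have chp : p \in [pchar {poly 'F_p}] by rewrite pchar_poly; exact: pchar_Fp.
have chq : [pchar {poly 'F_p}].-nat q.
  by rewrite pnatX pnatE // chp.
have := congr1 (fun P : {poly 'F_p} => P`_q)
  (erefl : ('X + 1 : {poly 'F_p}) ^+ m = ('X + 1) ^+ m).
rewrite {2}mE mulnC exprM (exprDn_pchar _ _ chq) expr1n !exprD1n !coef_sum.
have coefE k j (c : nat) : ('X^k *+ c : {poly 'F_p})`_j = (c * (j == k))%:R.
  by rewrite coefMn coefXn natrM; case: eqP; rewrite ?mulr1 ?mulr0 ?mul0rn.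
have pick (N k : nat) (F g : nat -> nat) : (k < N)%N -> injective g ->
    \sum_(i < N) (F i * (g k == g i))%:R = (F k)%:R :> 'F_p.
  move=> kN ginj; rewrite (bigD1 (Ordinal kN)) //= eqxx muln1 big1 ?addr0 // => i.
  by rewrite -val_eqE /= eq_sym => /negPf ik; rewrite (inj_eq ginj) ik muln0.
under eq_bigr do rewrite coefE. under [RHS]eq_bigr do rewrite -exprM coefE.
have m'0 : (0 < m')%N by move: m0; rewrite mE; case: m' {hm' mE}.
rewrite (pick _ q _ id) //; last by rewrite ltnS mE leq_pmull.
rewrite -{2}[q]muln1 (pick _ 1%N _ (muln q)) //; last first.
  by move=> i j /eqP; rewrite eqn_pmul2l // => /eqP.
rewrite bin1 => /eqP E; move: hm'; rewrite prime_coprime //.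
by rewrite !(dvdn_pcharf (pchar_Fp pp)) (eqP E).
Qed.

Lemma subn_gap_absurd (c d k : nat) :
  (d - c < k)%N -> (k < d)%N -> (c <= d - k)%N -> False.
Proof. lia. Qed.

Section AlgIndep.
Variables (K L : fieldType) (p : nat).
Hypotheses (pp : prime p) (chK : p \in [pchar K]).
Variables (iota : {rmorphism K -> L}) (s : {rmorphism K -> K}) (S : {rmorphism L -> L}).
Hypothesis Siota : forall y, S (iota y) = iota (s y).
Variables (D : finType) (a : D -> K).
Hypothesis a_neq0 : forall r, a r != 0.
Variables (n : nat) (isX : pred 'I_n) (rr : 'I_n -> D) (nn : 'I_n -> nat) (b : 'I_n -> K).
Hypothesis b0 : forall v, ~~ isX v -> b v = 0.
Hypothesis nnP : forall v, isX v -> ~~ (p %| nn v)%N.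
Hypothesis rrI : forall v w, ~~ isX v -> ~~ isX w -> rr v = rr w -> v = w.
Let u v := if isX v then (a (rr v) ^+ nn v)^-1 else a (rr v).
Variable x : 'I_n -> L.
Hypothesis Sx : forall v, S (x v) = iota (u v) * x v + iota (b v).
Hypothesis x0 : forall v, ~~ isX v -> x v != 0.
Hypothesis H1 : forall (e e' : D -> nat) y, y != 0 ->
  s y * \prod_r a r ^+ e r = y * \prod_r a r ^+ e' r -> e =1 e'.
Hypothesis H2 : forall r N k (c : 'I_n -> K) y, (forall v, s (c v) = c v) ->
  (forall v, c v != 0 -> [/\ isX v, rr v = r & nn v = N]) ->
  s y + \sum_v c v * b v ^+ (p ^ k) = y / a r ^+ (p ^ k * N) -> forall v, c v = 0.

Implicit Types (m : 'X_{1..n}) (P : {mpoly K[n]}).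

(** The twist multiplies the monomial m by [umon m], the product over r of a_r to the power wW m r -
    wX m r, the two parts being kept apart to stay in the naturals. [gco m' m] is, up to that
    factor, what m' contributes to m. The weight [nu] sees only the variables in isX. *)
Let wX m r := (\sum_(v | isX v && (rr v == r)) nn v * m v)%N.
Let wW m r := (\sum_(v | ~~ isX v && (rr v == r)) m v)%N.
Let nu m := (\sum_(v | isX v) nn v * m v)%N.
Let umon m := \prod_v u v ^+ m v.
Let gco m' m := \prod_v ('C(m' v, m v)%:R * b v ^+ (m' v - m v)).

Let nn_gt0 v : isX v -> (0 < nn v)%N.
Proof. by move/nnP; case: (nn v); rewrite ?dvdn0. Qed.

Let u_neq0 v : u v != 0.
Proof. by rewrite /u; case: ifP => _; rewrite ?invr_eq0 ?expf_neq0. Qed.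

Let umon_neq0 m : umon m != 0.
Proof. by apply/prodf_neq0 => v _; rewrite expf_neq0. Qed.

Let natK_neq0 k : ~~ (p %| k)%N -> k%:R != 0 :> K.
Proof. by rewrite (dvdn_pcharf chK). Qed.

Let umonE m : umon m * \prod_r a r ^+ wX m r = \prod_r a r ^+ wW m r.
Proof.
have E (Q : pred 'I_n) (F : 'I_n -> nat) :
    \prod_r a r ^+ (\sum_(v | Q v && (rr v == r)) F v)%N = \prod_(v | Q v) a (rr v) ^+ F v.
  rewrite [RHS](partition_big rr xpredT) //=; apply: eq_bigr => r _.
  by rewrite expr_sum; apply: eq_bigr => v /andP[_ /eqP->].
rewrite /wX /wW !E /umon (bigID isX) /= mulrAC -big_split /=.
rewrite big1 ?mul1r => [|v hv].
  by apply: eq_bigr => v hv; rewrite /u (negPf hv).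
by rewrite /u hv exprVn -exprM mulVf // expf_neq0.
Qed.

Let weight_eq m m' y : y != 0 -> s y * umon m = y * umon m' ->
  forall r, (wW m r + wX m' r = wW m' r + wX m r)%N.
Proof.
move=> y0 E; apply: (H1 y0).
have E2 (F G : D -> nat) : \prod_r a r ^+ (F r + G r)%N = (\prod_r a r ^+ F r) * \prod_r a r ^+ G r.
  by rewrite -big_split; apply: eq_bigr => r _; rewrite exprD.
rewrite !E2 -!umonE !mulrA E -!mulrA; congr (_ * (_ * _)).
exact: mulrC.
Qed.

(** As b vanishes outside isX, exponents there cannot change; the divisibility is [bin_pdiv_dvd]
    applied to C(m', m' - m). *)
Let gcoP m' m : gco m' m != 0 ->
  [/\ forall v, (m v <= m' v)%N, forall v, ~~ isX v -> m' v = m v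
    & forall v, (0 < m' v)%N -> (p ^ logn p (m' v) %| m' v - m v)%N].
Proof.
move=> /prodf_neq0 h; have {}h v := h v isT.
have hC v : ~~ (p %| 'C(m' v, m v))%N.
  by have := h v; rewrite mulf_eq0 negb_or (dvdn_pcharf chK) => /andP[].
have hle v : (m v <= m' v)%N.
  by rewrite leqNgt; apply/negP => hv; have := hC v; rewrite bin_small ?dvdn0.
split=> // [v hv|v hv].
  apply/eqP; rewrite eqn_leq hle andbT -subn_eq0.
  have := h v; rewrite b0 // expr0n mulf_eq0 negb_or => /andP[_].
  by case: (_ == 0)%N; rewrite ?eqxx.
by apply: bin_pdiv_dvd => //; rewrite bin_sub.
Qed.

Let gco_id m : gco m m = 1.
Proof. by rewrite /gco big1 // => v _; rewrite binn subnn mul1r. Qed.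

(** The lift of S to polynomials: s on coefficients, the affine substitution on variables.
    Evaluation at x carries it to S. *)
Let sg P := mmap (@mpolyC n K \o s) (fun v => u v *: 'X_v + (b v)%:MP) P.

Let sgE P m : (sg P)@_m = umon m * \sum_(m' <- msupp P) s P@_m' * gco m' m.
Proof.
rewrite /sg /mmap raddf_sum mulr_sumr /=; apply: eq_bigr => m' _.
rewrite mcoeffCM /mmap1 mcoeff_prod_affine big_split /=.
by rewrite mulrCA.
Qed.

Let mmap_sg P : mmap iota x (sg P) = S (mmap iota x P).
Proof.
rewrite /sg {2}/mmap [X in S X]/mmap (raddf_sum S) raddf_sum /=. apply: eq_bigr => m _.
rewrite !rmorphM /= mmapC Siota; congr (_ * _).
rewrite /mmap1 !rmorph_prod; apply: eq_bigr => v _.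
by rewrite !rmorphXn /= rmorphD /= mmapZ mmapC mmapX mmap1U Sx.
Qed.

(** Dividing by c0, later the coefficient of a chosen monomial, makes that coefficient 1 and lets
    the factor [kap] be computed. *)
Let semi_invE P m c0 kap : c0 != 0 -> sg P = kap *: P ->
  umon m * \sum_(m' <- msupp P) s (P@_m' / c0) * gco m' m
    = kap * c0 / s c0 * (P@_m / c0).
Proof.
move=> c0n0 /(congr1 (fun Q : {mpoly K[n]} => Q@_m)); rewrite sgE mcoeffZ => E.
rewrite [RHS](_ : _ = kap * P@_m / s c0); last by field; rewrite ?fmorph_eq0 ?c0n0.
rewrite -E -mulrA mulr_suml; congr (_ * _); apply: eq_bigr => m' _.
by rewrite rmorphM fmorphV mulrAC.
Qed.

Let big_supp P m (F : 'X_{1..n} -> K) : (P@_m = 0 -> F m = 0) ->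
  \sum_(m' <- msupp P) F m' = F m + \sum_(m' <- msupp P | m' != m) F m'.
Proof.
move=> F0; have [mP|mP] := boolP (m \in msupp P).
  by rewrite (bigD1_seq m) ?msupp_uniq.
rewrite F0 ?add0r; last exact: memN_msupp_eq0.
rewrite [LHS]big_seq_cond [RHS]big_seq_cond; apply: eq_bigl => m'.
rewrite andbT; case: (boolP (m' \in msupp P)) => //= m'P.
by apply/esym; apply: contraTneq m'P => ->.
Qed.

Let nuE m : nu m = (\sum_r wX m r)%N.
Proof. by rewrite /nu (partition_big rr xpredT). Qed.

Let nu_le m m' : (forall v, (m v <= m' v)%N) -> (nu m <= nu m')%N.
Proof. by move=> h; apply: leq_sum => v _; rewrite leq_mul2l h orbT. Qed.

Let nuB m m' : (forall v, (m v <= m' v)%N) ->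
  (nu m' - nu m = \sum_(v | isX v) nn v * (m' v - m v))%N.
Proof.
move=> h; rewrite /nu -sumnB => [|v _]; last by rewrite leq_mul2l h orbT.
by apply: eq_bigr => v _; rewrite mulnBr.
Qed.

(** A contribution from a different monomial lowers some variable of isX, by at least the p-part of
    its exponent; this bounds the loss of weight from below. *)
Let gap m m' : gco m' m != 0 -> m' != m ->
  exists2 v, isX v & [/\ (m v < m' v)%N, (p ^ logn p (m' v) <= m' v - m v)%N
    & (nn v * (m' v - m v) <= nu m' - nu m)%N].
Proof.
move=> /gcoP[hle hW hX] mm'.
have [v vmm'] : exists v, m' v != m v.
  by apply/existsP; apply: contraNT mm' => /existsPn h; apply/eqP/mnmP => v; apply/eqP/negPn/h.
have Xv : isX v by apply: contraNT vmm' => /hW->.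
exists v => //.
have lt : (m v < m' v)%N by rewrite ltn_neqAle eq_sym vmm' hle.
split=> //; last by rewrite nuB // (bigD1 v) //= leq_addr.
by apply: dvdn_leq; rewrite ?subn_gt0 // hX //; apply: leq_ltn_trans lt.
Qed.

(* At weight nu just below its top value d, the coefficients of sg P = kap *: P
   give an equation as in H2, supported on the variables attaining c below. *)
Let semi_inv_noX P kap : sg P = kap *: P ->
  forall m v, m \in msupp P -> isX v -> m v = 0%N.
Proof.
move=> inv m1 v1 m1P Xv1; apply/eqP; apply/negPn/negP; rewrite -lt0n => m1v1.
(* The substitution preserves the exponents of the variables outside isX, so the equations can be
   studied for one such set of exponents at a time. *)
pose sameW m := [forall v, ~~ isX v ==> (m v == m1 v)].
have sameWP m : reflect (forall v, ~~ isX v -> m v = m1 v) (sameW m).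
  apply: (iffP forallP) => h v; last by apply/implyP => /h->.
  by move=> hv; apply/eqP; exact: (implyP (h v)).
pose T := [seq m <- msupp P | sameW m].
have m1T : m1 \in T by rewrite mem_filter m1P andbT; apply/sameWP.
have [d [dT dM]] : exists d, has (fun m => nu m == d) T /\ {in T, forall m, (nu m <= d)%N}.
  have ex : exists d, has (fun m => nu m == d) T by exists (nu m1); apply/hasP; exists m1.
  have ub d : has (fun m => nu m == d) T -> (d <= \max_(m <- T) nu m)%N.
    by case/hasP => m mT /eqP<-; apply: leq_bigmax_seq.
  case: (ex_maxnP ex ub) => d dT dM; exists d; split=> // m mT.
  by apply: dM; apply/hasP; exists m.
pose top m := [&& m \in msupp P, sameW m & nu m == d].
have d0 : (0 < d)%N.
  apply: leq_trans (dM _ m1T); rewrite /nu (bigD1 v1) //= ltn_addr //.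
  by rewrite muln_gt0 nn_gt0.
(* c is the least n_v p^(v_p(m_v)) over the top monomials m and the variables v of m *)
have [c [[[ms vs] [topms Xvs msvs cE]] cmin]] : exists c,
    (exists mv : 'X_{1..n} * 'I_n,
       [/\ top mv.1, isX mv.2, (0 < mv.1 mv.2)%N
       & c = (nn mv.2 * p ^ logn p (mv.1 mv.2))%N]) /\
    forall m v, top m -> isX v -> (0 < m v)%N -> (c <= nn v * p ^ logn p (m v))%N.
  pose Q c := `[< exists mv : 'X_{1..n} * 'I_n,
     [/\ top mv.1, isX mv.2, (0 < mv.1 mv.2)%N
     & c = (nn mv.2 * p ^ logn p (mv.1 mv.2))%N] >].
  have ex : exists c, Q c.
    case/hasP: dT => m; rewrite mem_filter => /andP[mW mP] md.
    have [v Xv mv] : exists2 v, isX v & (0 < m v)%N.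
      apply: contraPP d0 => /forall2NP h; rewrite -(eqP md) /nu big1 // => v Xv.
      by case: (h v) => // /negP; rewrite -eqn0Ngt => /eqP->; rewrite muln0.
    exists (nn v * p ^ logn p (m v))%N; apply/asboolP; exists (m, v).
    by rewrite /top mP mW md.
  case: (ex_minnP ex) => c /asboolP cQ cM; exists c; split=> // m v tm Xv mv.
  by apply: cM; apply/asboolP; exists (m, v).
rewrite /= in topms Xvs msvs cE.
set k := logn p (ms vs) in cE; set N := nn vs in cE.
have [msP msW /eqP msd] := and3P topms.
pose c0 := P@_ms; have c0n0 : c0 != 0 by rewrite -mcoeff_msupp.
pose cf m := P@_m / c0.
have cf0 m : P@_m = 0 -> cf m = 0 by move=> h; rewrite /cf h mul0r.
have cfN0 m : cf m != 0 -> m \in msupp P.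
  by rewrite mcoeff_msupp; apply: contraNneq => /cf0->.
have cfP m : m \in msupp P -> cf m != 0.
  by rewrite mcoeff_msupp => h; rewrite mulf_neq0 ?invr_eq0.
have E0 m : umon m * (s (cf m) + \sum_(m' <- msupp P | m' != m) s (cf m') * gco m' m)
    = kap * c0 / s c0 * cf m.
  have <- := semi_invE m c0n0 inv.
  by rewrite (@big_supp P m (fun m' => s (cf m') * gco m' m)) ?gco_id ?mulr1 // => /cf0->; rewrite rmorph0 ?mul0r.
have sW m m' : gco m' m != 0 -> sameW m -> sameW m'.
  by case/gcoP => _ hW _ /sameWP mW; apply/sameWP => v nX; rewrite hW // mW.
have nugt m m' : gco m' m != 0 -> m' != m -> (nu m < nu m')%N.
  move=> g mm'; case: (gap g mm') => v Xv [lt _ le].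
  rewrite -subn_gt0; apply: leq_trans le; rewrite muln_gt0 nn_gt0 // subn_gt0.
  exact: lt.
have cM m m' : gco m' m != 0 -> m' != m -> top m' -> (c <= nu m' - nu m)%N.
  move=> g mm' tm'; case: (gap g mm') => v Xv [lt lp le].
  apply: leq_trans (cmin _ _ tm' Xv (leq_ltn_trans (leq0n _) lt)) _.
  by apply: leq_trans le; rewrite leq_mul2l lp orbT.
(* Other contributions come from strictly larger weight, and d is the largest. *)
have topE m : top m -> umon m * s (cf m) = kap * c0 / s c0 * cf m.
  move=> /and3P[mP mW /eqP md]; rewrite -E0 big1_seq ?addr0 // => m' /andP[mm' m'P].
  apply/eqP; rewrite mulf_eq0; apply/orP; right; apply/negPn/negP => g.
  have := nugt _ _ g mm'; rewrite md ltnNge dM // mem_filter m'P andbT.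
  exact: sW g mW.
have kapE : kap * c0 / s c0 = umon ms.
  by have := topE _ topms; rewrite /cf divff // rmorph1 !mulr1.
have wWE m : sameW m -> wW m =1 wW m1.
  by move=> /sameWP mW r; apply: eq_bigr => v /andP[/mW].
have wXE m : sameW m -> cf m != 0 -> umon m * s (cf m) = umon ms * cf m -> wX m =1 wX ms.
  move=> mW cm0; rewrite mulrC [RHS]mulrC => /(weight_eq cm0) h r.
  by have := h r; rewrite !wWE // => /eqP; rewrite eqn_add2l eq_sym => /eqP.
have umE m : sameW m -> wX m =1 wX ms -> umon m = umon ms.
  move=> mW hX; have E m' : umon m' = \prod_r a r ^+ wW m' r / \prod_r a r ^+ wX m' r.
    by rewrite -umonE mulfK //; apply/prodf_neq0 => r _; rewrite expf_neq0.
  rewrite !E; congr (_ / _); apply: eq_bigr => r _; rewrite ?hX //.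
  by rewrite !wWE.
have top_fix m : top m -> s (cf m) = cf m /\ wX m =1 wX ms.
  move=> tm; have /and3P[mP mW _] := tm.
  have hm : umon m * s (cf m) = umon ms * cf m by rewrite -kapE topE.
  have cm0 := cfP _ mP.
  have hX := wXE _ mW cm0 hm; split=> //.
  by move: hm; rewrite (umE _ mW hX) => /(mulfI (umon_neq0 _)).
(* By descending induction on nu: top monomials fall by at least c, hence miss m, and those in
   between vanish already. So the equation at m has the single term m, whose weights must agree with
   those of ms by H1; this would force nu m = d. *)
have low m : sameW m -> (d - c < nu m)%N -> (nu m < d)%N -> cf m = 0.
  have [e] := ubnP (d - nu m)%N; elim: e m => // e IH m; rewrite ltnS => he mW h1 h2.
  apply/eqP; apply/negPn/negP => cm0.
  have hm : umon m * s (cf m) = umon ms * cf m.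
    rewrite -kapE -E0 big1_seq ?addr0 // => m' /andP[mm' m'P].
    apply/eqP; rewrite mulf_eq0; apply/orP; right; apply/negPn/negP => g.
    have m'W := sW _ _ g mW; have lt := nugt _ _ g mm'.
    have : (nu m' <= d)%N by apply: dM; rewrite mem_filter m'W.
    rewrite leq_eqVlt => /orP[/eqP m'd|m'd].
      have := cM _ _ g mm'; rewrite /top m'P m'W m'd eqxx => /(_ isT) h3.
      case: (subn_gap_absurd h1 h2 h3).
    have := cfP _ m'P; rewrite IH ?eqxx //; last exact: ltn_trans lt.
    by apply: leq_trans he; apply: ltn_sub2l.
  have hX := wXE _ mW cm0 hm; move: h2.
  by rewrite nuE (eq_bigr _ (fun r _ => hX r)) -nuE msd ltnn.
pose r := rr vs.
have pk_gt0 : (0 < p ^ k)%N by rewrite expn_gt0 prime_gt0.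
have pk_le : (p ^ k <= ms vs)%N by apply: dvdn_leq => //; exact: pfactor_dvdnn.
pose sh v := (U_(v) *+ (p ^ k))%MM : 'X_{1..n}.
have shE v w : sh v w = ((v == w) * p ^ k)%N by rewrite /sh mulmnE mnm1E.
(* The monomial whose equation is used: ms with the exponent of vs lowered by its p-part, of weight
   exactly d - c. *)
pose md' := (ms - sh vs)%MM.
have msE : ms = (md' + sh vs)%MM.
  by rewrite submK //; apply/mnm_lepP => w; rewrite shE; case: eqP => [<-|_]; rewrite ?mul1n.
have nuD m m' : nu (m + m')%MM = (nu m + nu m')%N.
  by rewrite /nu -big_split; apply: eq_bigr => v _; rewrite mnmDE mulnDr.
have wXD m m' q : wX (m + m')%MM q = (wX m q + wX m' q)%N.
  by rewrite /wX -big_split; apply: eq_bigr => v _; rewrite mnmDE mulnDr.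
have nu_sh v : isX v -> nu (sh v) = (nn v * p ^ k)%N.
  move=> Xv; rewrite /nu (bigD1 v) //= big1 ?addn0 => [|w /andP[_ wv]].
    by rewrite shE eqxx mul1n.
  by rewrite shE eq_sym (negPf wv) muln0.
have wX_sh v q : isX v -> wX (sh v) q = ((rr v == q) * (nn v * p ^ k))%N.
  move=> Xv; rewrite /wX; case: eqP => [<-|vq].
    rewrite (bigD1 v) ?Xv ?eqxx //= big1 ?addn0 => [|w /andP[_ wv]].
      by rewrite shE eqxx !mul1n.
    by rewrite shE eq_sym (negPf wv) muln0.
  rewrite big1 // => w /andP[_ /eqP wq]; rewrite shE; case: eqP => [vw|]; last by rewrite muln0.
  by case: vq; rewrite vw.
have sW_sh m v : isX v -> sameW m -> sameW (m + sh v)%MM.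
  move=> Xv /sameWP mW; apply/sameWP => w nX; rewrite mnmDE shE mW //.
  by case: eqP nX => [<-|]; rewrite ?Xv ?addn0.
have md'W : sameW md'.
  apply/sameWP => w nX; rewrite -(sameWP _ msW w nX) msE mnmDE shE.
  by case: eqP nX => [<-|]; rewrite ?Xvs ?addn0.
have nu_md' : (nu md' + c = d)%N by rewrite -msd [in RHS]msE nuD nu_sh // -cE.
pose block v := [&& isX v, rr v == r & nn v == N].
(* Only top monomials reach md', and they fall by exactly c. As c is minimal, the inequalities of
   [gap] become equalities: a single exponent falls, by its p-part. Since p divides no nn, the
   valuations in nn v * p^j = N * p^k give j = k and then nn v = N; equality of the weights wX gives
   rr v = r. *)
have step m' : m' \in msupp P -> gco m' md' != 0 -> m' != md' ->
    exists2 v, block v & m' = (md' + sh v)%MM.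
  move=> m'P g mm'; have m'W := sW _ _ g md'W; have lt := nugt _ _ g mm'.
  have m'd : nu m' = d.
    have : (nu m' <= d)%N by apply: dM; rewrite mem_filter m'W.
    rewrite leq_eqVlt => /orP[/eqP//|m'd].
    by have := cfP _ m'P; rewrite low ?eqxx // -nu_md' addnK.
  have tm' : top m' by rewrite /top m'P m'W m'd eqxx.
  have [v Xv [ltv lpv lev]] := gap g mm'.
  have hc := cmin _ _ tm' Xv (leq_ltn_trans (leq0n _) ltv).
  have eq1 : (nn v * (m' v - md' v) = c)%N.
    apply/eqP; rewrite eqn_leq (leq_trans lev) ?m'd -?nu_md' ?addKn //=.
    by apply: leq_trans hc _; rewrite leq_mul2l lpv orbT.
  have eq2 : (m' v - md' v = p ^ logn p (m' v))%N.
    apply/eqP; rewrite eqn_leq lpv andbT -(leq_pmul2l (nn_gt0 Xv)) eq1.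
    exact: hc.
  have eq3 : logn p (m' v) = k.
    have : logn p (nn v * p ^ logn p (m' v)) = logn p (N * p ^ k).
      by rewrite -eq2 eq1 cE.
    have l0 w : isX w -> logn p (nn w) = 0%N.
      by move=> Xw; rewrite lognE (negPf (nnP Xw)) !andbF.
    by rewrite !lognM ?expn_gt0 ?(prime_gt0 pp) ?nn_gt0 // !pfactorK // !l0.
  have eq4 : nn v = N.
    by apply/eqP; rewrite -(eqn_pmul2r pk_gt0) -{1}eq3 -eq2 eq1 cE.
  have [hle hW _] := gcoP g.
  have m'E : m' = (md' + sh v)%MM.
    apply/mnmP => w; rewrite mnmDE shE; have [<-|vw] := eqVneq v w.
      by rewrite mul1n -eq3 -eq2 subnKC.
    rewrite mul0n addn0; have [Xw|/hW//] := boolP (isX w).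
    have := nuB hle; rewrite m'd -nu_md' addKn (bigD1 v) //= eq1 (bigD1 w) /=; last first.
      by rewrite Xw eq_sym.
    have wn0 := nn_gt0 Xw.
    move=> /eqP; rewrite -{1}[c]addn0 eqn_add2l eq_sym addn_eq0 muln_eq0.
    rewrite eqn0Ngt wn0 /= subn_eq0 => /andP[h _].
    by apply/eqP; rewrite eqn_leq h hle.
  exists v => //; rewrite /block Xv eq4 eqxx andbT.
  have [_ hX'] := top_fix _ tm'.
  have := hX' r; rewrite m'E [in RHS]msE !wXD !wX_sh // eqxx mul1n => /eqP.
  rewrite eqn_add2l; case: (rr v =P r) => // _; rewrite mul0n eq_sym muln_eq0.
  by rewrite eqn0Ngt nn_gt0 // eqn0Ngt pk_gt0.
have sh_inj v w : (md' + sh v = md' + sh w)%MM -> v = w.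
  move/addmI/mnmP/(_ v); rewrite !shE eqxx; case: eqP => // _.
  by rewrite mul1n => /eqP; rewrite eqn0Ngt pk_gt0.
pose F m' := s (cf m') * gco m' md'.
have reindex : \sum_(m' <- msupp P | m' != md') F m' = \sum_(v | block v) F (md' + sh v)%MM.
  rewrite -big_enum -(big_map (fun v => md' + sh v)%MM xpredT F) /=.
  have flt l (Q : pred 'X_{1..n}) :
      \sum_(m <- l | Q m) F m = \sum_(m <- [seq m <- l | Q m && (F m != 0)]) F m.
    rewrite big_filter [RHS]big_mkcondr; apply: eq_bigr => m _.
    by case: eqP.
  rewrite flt [RHS]flt; apply: perm_big; apply: uniq_perm => [||m'].
  - by rewrite filter_uniq ?msupp_uniq.
  - by rewrite filter_uniq // map_inj_uniq ?enum_uniq.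
  rewrite !mem_filter /=; apply/idP/idP => /andP[].
    move=> /andP[mm' Fm'] m'P; rewrite Fm' /=.
    have [v bv ->] : exists2 v, block v & m' = (md' + sh v)%MM.
      by apply: step => //; apply: contraNneq Fm'; rewrite /F => ->; rewrite mulr0.
    by apply: map_f; rewrite mem_enum.
  move=> Fm' /mapP[v]; rewrite mem_enum => /and3P[Xv _ _] m'E; rewrite Fm' andbT.
  apply/andP; split; last first.
    apply: cfN0; apply: contraNneq Fm'; rewrite /F => ->; rewrite rmorph0 mul0r //.
  apply/eqP => m'md; have /eqP := congr1 (fun m => m v) m'E.
  rewrite /= m'md mnmDE shE eqxx mul1n -{1}[md' v]addn0 eqn_add2l eq_sym.
  by rewrite eqn0Ngt pk_gt0.
(* The coefficients of the equation in H2. The binomial is an integer, so they are fixed by s; at vs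
   it is prime to p by [bin_plogn], so they are not all zero. *)
pose cc v := if block v then cf (md' + sh v)%MM * ('C((md' + sh v)%MM v, md' v))%:R else 0.
have ccF v : block v -> F (md' + sh v)%MM = cc v * b v ^+ (p ^ k) /\ s (cc v) = cc v.
  move=> bv; have /and3P[Xv /eqP vr /eqP vN] := bv.
  have fx : s (cf (md' + sh v)%MM) = cf (md' + sh v)%MM.
    have [->|c0'] := eqVneq (cf (md' + sh v)%MM) 0; first by rewrite rmorph0.
    suff /top_fix[] : top (md' + sh v)%MM by [].
    by rewrite /top cfN0 // sW_sh //= nuD nu_sh // vN -cE nu_md'.
  rewrite /cc bv rmorphM rmorph_nat fx; split=> //.
  rewrite /F fx -mulrA; congr (_ * _); rewrite /gco (bigD1 v) //= big1 ?mulr1 => [|w wv].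
    by rewrite mnmDE shE eqxx mul1n addKn.
  by rewrite mnmDE shE eq_sym (negPf wv) addn0 binn subnn mulr1.
have ccvs : cc vs != 0.
  rewrite /cc /block Xvs !eqxx -msE mulf_neq0 ?natK_neq0 //.
    by rewrite /cf divff ?oner_eq0.
  rewrite [X in 'C(_, X)]mnmBE shE eqxx mul1n bin_sub //.
  exact: bin_plogn.
case/eqP: ccvs; apply: (@H2 r N k cc (cf md')) => [v|v|].
- by have [bv|nb] := boolP (block v); [case: (ccF v bv)|rewrite /cc (negPf nb) rmorph0].
- by rewrite /cc; case: ifP => [/and3P[? /eqP ? /eqP ?] //|_]; rewrite eqxx.
apply: (mulfI (umon_neq0 md')).
have -> : \sum_v cc v * b v ^+ (p ^ k) = \sum_(v | block v) F (md' + sh v)%MM.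
  rewrite [RHS]big_mkcond; apply: eq_bigr => v _; case: ifP => [/ccF[]//|bv].
  by rewrite /cc bv mul0r.
rewrite -reindex E0 kapE {1}msE.
have -> : umon (md' + sh vs)%MM = umon md' * umon (sh vs).
  by rewrite /umon -big_split; apply: eq_bigr => v _; rewrite mnmDE exprD.
rewrite -mulrA mulrC [RHS]mulrC; congr (_ * _); rewrite mulrC; congr (_ * _).
rewrite /umon (bigD1 vs) //= big1 ?mulr1 => [|w wv]; last first.
  by rewrite shE eq_sym (negPf wv) expr0.
by rewrite shE eqxx mul1n /u Xvs exprVn -exprM mulnC.
Qed.

(* A relation with minimal leading monomial is semi-invariant under sg, hence
   involves no x v with isX v; by H1 it is then a single monomial. *)
Theorem difference_alg_independent P : mmap iota x P = 0 -> P = 0.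
Proof.
have [m Pm] : exists m, mlead P = m by exists (mlead P).
move: m P Pm; apply: ltmwf => m0 IH P Pm0 P0; apply/eqP; apply/negPn/negP => Pn0.
pose c0 := P@_m0; have c0n0 : c0 != 0 by rewrite /c0 -Pm0 mleadc_eq0.
(* The ratio of the leading coefficients of [sg P] and P, so that the difference Q below has a
   smaller leading monomial. *)
pose kap := umon m0 * s c0 / c0.
have supp_le m : m \in msupp P -> (m <= m0)%O by rewrite -Pm0; exact: msupp_le_mlead.
have inv : sg P = kap *: P.
  apply/eqP; rewrite -subr_eq0; set Q := _ - _.
  have Q0 : mmap iota x Q = 0.
    by rewrite /Q mmapB mmap_sg mmapZ P0 rmorph0 mulr0 subr0.
  have Qm m : (m0 <= m)%O -> Q@_m = 0.
    move=> hm; rewrite mcoeffB mcoeffZ sgE.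
    rewrite (big_supp (m := m)) => [|->]; last by rewrite rmorph0 mul0r.
    have -> : \sum_(m' <- msupp P | m' != m) s P@_m' * gco m' m = 0.
      rewrite big1_seq // => m' /andP[mm' m'P].
      apply/eqP; rewrite mulf_eq0; apply/orP; right; apply/negPn/negP => /gcoP[hle _ _].
      have m'm : (m <= m')%O by apply: lem_leo; apply/mnm_lepP.
      by case/eqP: mm'; apply/eqP; rewrite eq_le m'm (le_trans (supp_le _ m'P)).
    rewrite addr0 gco_id mulr1; have [mE|mm0] := eqVneq m m0.
      by rewrite mE /kap -/c0 mulfVK // subrr.
    have -> : P@_m = 0; last by rewrite rmorph0 !mulr0 subrr.
    apply: memN_msupp_eq0; apply/negP => /supp_le hm'.
    by case/eqP: mm0; apply/eqP; rewrite eq_le hm hm'.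
  apply/eqP; apply/eqP; apply/negPn/negP => Qn0.
  have lt : (mlead Q < m0)%O.
    rewrite ltNge; apply/negP => /Qm; apply/eqP; rewrite mleadc_eq0.
    exact: Qn0.
  by case/eqP: Qn0; exact: IH lt Q erefl Q0.
have noX := semi_inv_noX inv.
have only m : m \in msupp P -> m = m0.
  move=> mP; pose c := P@_m / c0.
  have cn0 : c != 0 by rewrite mulf_neq0 ?invr_eq0 // -mcoeff_msupp.
  have : s c * umon m = c * umon m0.
    have := semi_invE m c0n0 inv; rewrite (big_supp (m := m)) => [|->]; last first.
      by rewrite mul0r rmorph0 mul0r.
    rewrite gco_id mulr1 [X in _ + X]big1_seq ?addr0 => [|m' /andP[mm' m'P]]; last first.
      apply/eqP; rewrite mulf_eq0; apply/orP; right; apply/negPn/negP => /gcoP[_ hW _].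
      case/eqP: mm'; apply/mnmP => v; have [Xv|/hW//] := boolP (isX v).
      by rewrite !noX.
    rewrite mulrC => ->; rewrite /kap mulrC; congr (_ * _).
    by field; rewrite c0n0 ?fmorph_eq0 ?c0n0.
  move=> /(weight_eq cn0) h.
  have m0P : m0 \in msupp P by rewrite mcoeff_msupp.
  have wX0 m' r : m' \in msupp P -> wX m' r = 0%N.
    by move=> m'P; rewrite /wX big1 // => v /andP[Xv _]; rewrite noX // muln0.
  apply/mnmP => v; have [Xv|nX] := boolP (isX v); first by rewrite !noX.
  (* Outside isX distinct variables have distinct rr, so each weight wW is a single exponent and
     determines the monomial. *)
  have wWv m' : wW m' (rr v) = m' v.
    rewrite /wW (bigD1 v) ?nX ?eqxx //= big1 ?addn0 // => w /andP[/andP[nXw /eqP wv] /eqP []].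
    exact: rrI.
  by have := h (rr v); rewrite !wX0 // !addn0 !wWv.
have PE : P = c0 *: 'X_[m0].
  apply/mpolyP => m; rewrite mcoeffZ mcoeffX; have [<-|mm0] := eqVneq m0 m.
    by rewrite mulr1.
  rewrite mulr0; apply: memN_msupp_eq0; apply: contraNN mm0 => /only->.
  exact: eqxx.
move/eqP: P0; rewrite PE mmapZ mmapX mulf_eq0 fmorph_eq0 (negPf c0n0) /=.
apply/negP; rewrite /mmap1; apply/prodf_neq0 => v _.
have [Xv|nX] := boolP (isX v); last by rewrite expf_neq0 ?x0.
by rewrite noX ?mcoeff_msupp // expr0 oner_eq0.
Qed.

End AlgIndep.

(** * Krull dimension of localised polynomial algebras *)

Record subring_set (T : comNzRingType) (A : set T) : Prop := SubringSet {
  subring1 : A 1;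
  subringD : forall x y, A x -> A y -> A (x + y);
  subringM : forall x y, A x -> A y -> A (x * y);
  subringN : forall x, A x -> A (- x)
}.

Section Chain.
Variables (T : comNzRingType) (A : set T) (hA : subring_set A).

Let A0 : A 0.
Proof. by rewrite -(subrr 1); case: hA => A1 AD _ AN; apply: AD => //; apply: AN. Qed.

Lemma subring_sum (I : Type) (S : seq I) (P : pred I) (F : I -> T) :
  (forall i, P i -> A (F i)) -> A (\sum_(i <- S | P i) F i).
Proof. by move=> h; elim/big_ind: _ => // x y; exact: subringD. Qed.

Lemma subring_prod (I : Type) (S : seq I) (P : pred I) (F : I -> T) :
  (forall i, P i -> A (F i)) -> A (\prod_(i <- S | P i) F i).
Proof. by move=> h; elim/big_ind: _ => [|x y|//]; [exact: subring1|exact: subringM]. Qed.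

Lemma subring_exp x k : A x -> A (x ^+ k).
Proof. by move=> Ax; elim: k => [|k IH]; [exact: subring1|rewrite exprS; exact: subringM]. Qed.

Variables (n : nat) (c : nat -> set T) (f : nat -> T).
Hypothesis cP : forall i, (i <= n)%N -> Spec A (c i).
Hypothesis c_sub : forall i, (i < n)%N -> c i `<=` c i.+1.
Hypothesis f_in : forall i, (i < n)%N -> c i.+1 (f i).
Hypothesis f_notin : forall i, (i < n)%N -> ~ c i (f i).

Let fA i : (i < n)%N -> A (f i).
Proof. by move=> hi; case: (cP hi) => sub _ _ _ _; apply/sub/f_in. Qed.

(* Chasing the lexicographically least exponents: f_j is not in c_j, so the
   least power of f_j can be cancelled, and modulo c_{j+1} only the terms with
   that least power survive. *)
Lemma chain_monomials_free (I : eqType) (ex : I -> nat -> nat) (co : I -> T)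
    (S : seq I) :
  (forall e, A (co e)) -> S != [::] -> uniq S ->
  {in S, forall e, exists2 y, A y & y * co e = 1} ->
  {in S &, forall e e', (forall i, (i < n)%N -> ex e i = ex e' i) -> e = e'} ->
  ~ c 0%N (\sum_(e <- S) co e * \prod_(0 <= i < n) f i ^+ ex e i).
Proof.
move=> coA Sn0 uS coU exI.
suff H j : (j <= n)%N -> forall S' : seq I, S' != [::] -> {subset S' <= S} -> uniq S' ->
    {in S' &, forall e e' i, (i < j)%N -> ex e i = ex e' i} ->
    ~ c j (\sum_(e <- S') co e * \prod_(j <= i < n) f i ^+ ex e i).
  by apply: H => // e e'.
have [k hk] : exists k, (n - j = k)%N by exists (n - j)%N.
elim: k j hk => [|k IH] j hk jn S' S'n0 sub uS' agree cS.
  have jE : j = n by apply/eqP; rewrite eqn_leq jn -subn_eq0 hk.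
  subst j; case: S' S'n0 sub uS' agree cS => // e S' _ sub uS' agree.
  have -> : S' = [::].
    case: S' sub uS' agree => // e' S' sub uS' agree.
    have : e = e' by apply: exI; rewrite ?sub ?inE ?eqxx ?orbT // => i; apply: agree; rewrite ?inE ?eqxx ?orbT.
    by move=> ee; move: uS'; rewrite ee /= inE eqxx.
  rewrite big_seq1 big_geq // mulr1 => ce.
  have [y Ay ye] := coU e (sub e (mem_head _ _)).
  case: (cP (leqnn n)) => _ _ _ absorb [n1 _]; apply: n1.
  by rewrite -ye; exact: absorb.
have jltn : (j < n)%N by rewrite -subn_gt0 hk.
have [mu [[e0 e0S mu0] muM]] : exists mu, (exists2 e, e \in S' & ex e j = mu) /\
    {in S', forall e, (mu <= ex e j)%N}.
  pose Q mu := has (fun e => ex e j == mu) S'.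
  have exQ : exists mu, Q mu.
    case: S' S'n0 @Q {sub uS' agree cS} => // e S' _ Q; exists (ex e j).
    by apply/hasP; exists e; rewrite ?mem_head.
  case: (ex_minnP exQ) => mu /hasP[e eS /eqP emu] muM; exists mu; split; first by exists e.
  by move=> e' e'S; apply: muM; apply/hasP; exists e'.
pose S2 := [seq e <- S' | ex e j == mu].
pose g e := co e * \prod_(j.+1 <= i < n) f i ^+ ex e i.
have gA e : A (g e).
  apply: subringM => //; rewrite big_nat_cond; apply: subring_prod => i.
  by rewrite andbT => /andP[_ /fA]; exact: subring_exp.
have sub2 e : e \in S2 -> e \in S' by rewrite mem_filter => /andP[].
have hcj := cP jltn; have hcj0 := cP jn.
apply: (IH j.+1 _ jltn S2 _ _ _ _ _).
- by rewrite subnS hk.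
- by rewrite -has_filter; apply/hasP; exists e0; rewrite ?mu0.
- by move=> e /sub2 /sub.
- by rewrite filter_uniq.
- move=> e e' he he' i; rewrite ltnS leq_eqVlt => /orP[/eqP->|].
    by move: he he'; rewrite !mem_filter => /andP[/eqP-> _] /andP[/eqP-> _].
  exact: (agree _ _ (sub2 _ he) (sub2 _ he')).
have E : \sum_(e <- S') co e * \prod_(j <= i < n) f i ^+ ex e i =
    f j ^+ mu * \sum_(e <- S') g e * f j ^+ (ex e j - mu).
  rewrite mulr_sumr big_seq [RHS]big_seq; apply: eq_bigr => e eS.
  by rewrite big_ltn // /g mulrCA -{1}(subnKC (muM e eS)) exprD; ring.
have inA : A (\sum_(e <- S') g e * f j ^+ (ex e j - mu)).
  by apply: subring_sum => e _; apply: subringM => //; apply: subring_exp; exact: fA.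
have c1 : c j (\sum_(e <- S') g e * f j ^+ (ex e j - mu)).
  move: cS; rewrite E; case: hcj0 => _ c0 _ _ [n1 prm] /prm -/(_ (subring_exp _ (fA jltn)) inA) [] // fmu.
  exfalso; elim: (mu) fmu => [|q IHq]; first by rewrite expr0.
  rewrite exprS => /prm -/(_ (fA jltn) (subring_exp _ (fA jltn))) [|//].
  exact: f_notin.
have {}c1 := c_sub jltn c1.
case: hcj => subA z add absorb _.
have rest : c j.+1 (\sum_(e <- S' | ex e j != mu) g e * f j ^+ (ex e j - mu)).
  rewrite big_seq_cond; elim/big_ind: _ => // e /andP[eS emu].
  have -> : (ex e j - mu = (ex e j - mu).-1.+1)%N.
    by rewrite prednK // subn_gt0 ltn_neqAle eq_sym emu muM.
  rewrite exprSr mulrA; apply: absorb; last exact: f_in.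
  by apply: subringM => //; apply/subring_exp/fA.
have -> : \sum_(e <- S2) co e * \prod_(j.+1 <= i < n) f i ^+ ex e i =
    \sum_(e <- S') g e * f j ^+ (ex e j - mu)
      - \sum_(e <- S' | ex e j != mu) g e * f j ^+ (ex e j - mu).
  rewrite [X in X - _](bigID (fun e => ex e j == mu)) /= addrK /S2 big_filter.
  by apply: eq_bigr => e /eqP->; rewrite subnn expr0 mulr1.
apply: add => //; rewrite -mulN1r; apply: absorb => //.
by have := subringN hA (subring1 hA).
Qed.

End Chain.

Lemma exists_dependency (F : fieldType) (I J : finType) (M : I -> J -> F) :
  (#|J| < #|I|)%N ->
  exists a : I -> F, (exists i, a i != 0) /\ forall j, \sum_i a i * M i j = 0.
Proof.
move=> cIJ; pose A := \matrix_(i < #|I|, j < #|J|) M (enum_val i) (enum_val j).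
have : kermx A != 0.
  by rewrite kermx_eq0 /row_free neq_ltn (leq_ltn_trans (rank_leq_col A)).
case/rowV0Pn => u /sub_kermxP uA un0.
exists (fun i => u ord0 (enum_rank i)); split.
  case/rV0Pn: un0 => j uj; exists (enum_val j); by rewrite enum_valK.
move=> j; have /matrixP/(_ ord0 (enum_rank j)) := uA; rewrite !mxE => uAj.
rewrite -[RHS]uAj (reindex (@enum_val I predT)) /=; last exact/onW_bij/enum_val_bij.
by apply: eq_bigr => i _; rewrite enum_valK mxE enum_rankK.
Qed.

Lemma card_bmnm_le N k : (#|{: 'X_{1..N < k}}| <= k ^ N)%N.
Proof.
have lt (m : 'X_{1..N < k}) i : ((m : 'X_{1..N}) i < k)%N.
  by apply: leq_ltn_trans (bmdeg m); rewrite mdegE (bigD1 i) //= leq_addr.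
have <- : #|{ffun 'I_N -> 'I_k}| = (k ^ N)%N by rewrite card_ffun !card_ord.
apply: (leq_card (fun m : 'X_{1..N < k} => [ffun i => Ordinal (lt m i)])) => m m' /ffunP h.
apply/val_inj/mnmP => i; have := h i; rewrite !ffunE => /(congr1 val).
exact.
Qed.

(** * Upper bound for chains of primes *)

Section KrullUpper.
Variables (T : comNzRingType) (A : set T) (hA : subring_set A).
Variables (F : fieldType) (N : nat) (phi : {rmorphism {mpoly F[N]} -> T}).
Variables (h : {mpoly F[N]}) (hi : T).
Hypothesis hiP : hi * phi h = 1.
Hypothesis A_phi : forall G, A (phi G).
Hypothesis A_frac : forall x, A x -> exists G e, x * phi h ^+ e = phi G.

Let deg (G : {mpoly F[N]}) := (msize G).-1.

Let degM G H : (deg (G * H) <= deg G + deg H)%N.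
Proof.
have [->|G0] := eqVneq G 0; first by rewrite mul0r /deg msize0.
have [->|H0] := eqVneq H 0; first by rewrite mulr0 /deg msize0.
rewrite /deg msizeM // -[msize G]prednK ?lt0n ?msize_poly_eq0 //.
by rewrite -[msize H]prednK ?lt0n ?msize_poly_eq0 // addSn addnS.
Qed.

Let degX G k : (deg (G ^+ k) <= k * deg G)%N.
Proof.
elim: k => [|k IH]; first by rewrite expr0 /deg msize1.
by rewrite exprS mulSn; apply: leq_trans (degM _ _) _; rewrite leq_add2l.
Qed.

Let deg_prod (I : finType) (G : I -> {mpoly F[N]}) :
  (deg (\prod_i G i) <= \sum_i deg (G i))%N.
Proof.
apply: (big_ind2 (fun g d => deg g <= d)%N) => // [|g d g' d' hg hg'].
  by rewrite /deg msize1.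
by apply: leq_trans (degM _ _) _; apply: leq_add.
Qed.

(** Linear algebra: there are more products of powers of the f_i with exponents below D than
    monomials in N variables of the degree that these products reach. *)
Let dependency n (f : 'I_n -> T) : (N < n)%N -> (forall i, A (f i)) ->
  exists D (a : {ffun 'I_n -> 'I_D} -> F), (exists e, a e != 0) /\
    \sum_e phi (a e)%:MP * \prod_i f i ^+ e i = 0.
Proof.
move=> Nn fA; have /choice[G /choice[ee Gee]] := fun i => A_frac (fA i).
pose E := (\sum_i ee i)%N; have eeE i : (ee i <= E)%N by rewrite /E (bigD1 i) //= leq_addr.
(* A common exponent E gives all f_i the same denominator h^E. *)
pose GE i := G i * h ^+ (E - ee i).
have GEP i : f i * phi h ^+ E = phi (GE i).
  by rewrite /GE rmorphM rmorphXn -Gee -mulrA -exprD subnKC.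
pose B := (\sum_i deg (GE i) + deg h * E)%N.
(* The degrees are at most n B D, hence below K = K0 * D. At most K0^N * D^N monomials have such a
   degree, and D > K0^N makes this less than D^(N+1). *)
pose K0 := (n * B).+1; pose D := (K0 ^ N).+1; pose K := (K0 * D)%N.
pose H (e : {ffun 'I_n -> 'I_D}) := \prod_i (GE i ^+ e i * h ^+ (E * (D - e i))).
have degH e : (deg (H e) < K)%N.
  apply: leq_ltn_trans (deg_prod _) _.
  apply: (@leq_ltn_trans (\sum_(i < n) B * D)%N).
    apply: leq_sum => i _; apply: leq_trans (degM _ _) _.
    rewrite /B mulnDl; apply: leq_add; apply: leq_trans (degX _ _) _.
      rewrite mulnC; apply: leq_mul; last exact: ltnW.
      by rewrite (bigD1 i) //= leq_addr.
    by rewrite mulnC mulnA leq_mul2l leq_subr orbT.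
  by rewrite sum_nat_const card_ord mulnA /K /K0 mulSn -[X in (X < _)%N]add0n ltn_add2r.
have [a [[e ae] aP]] : exists a : {ffun 'I_n -> 'I_D} -> F, (exists e, a e != 0) /\
    forall m : 'X_{1..N < K}, \sum_e a e * (H e)@_m = 0.
  apply: exists_dependency; apply: leq_ltn_trans (card_bmnm_le _ _) _.
  rewrite card_ffun !card_ord /K expnMn; apply: (@leq_trans (D ^ N.+1)%N).
    by rewrite expnS ltn_mul2r expn_gt0 ltnSn.
  by rewrite leq_pexp2l.
exists D, a; split; first by exists e.
have aH : \sum_e (a e)%:MP * H e = 0.
  apply/mpolyP => m; rewrite mcoeff0 raddf_sum /=.
  under eq_bigr do rewrite mcoeffCM.
  have [mK|Km] := ltnP (mdeg m) K; first exact: (aP (BMultinom mK)).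
  rewrite big1 // => e' _; rewrite [X in _ * X]memN_msupp_eq0 ?mulr0 //.
  apply/negP => /msize_mdeg_lt; rewrite ltnNge => /negP; apply.
  by apply: leq_trans Km; have := degH e'; rewrite /deg; case: (msize _).
have hu k : hi ^+ k * phi h ^+ k = 1 by rewrite -exprMn hiP expr1n.
suff key : (\sum_e phi (a e)%:MP * \prod_i f i ^+ e i) * phi h ^+ (n * (E * D))
    = phi (\sum_e (a e)%:MP * H e).
  have /= := congr1 (fun z => hi ^+ (n * (E * D)) * z) key.
  by rewrite mulrCA hu mulr1 aH rmorph0 mulr0.
rewrite rmorph_sum mulr_suml; apply: eq_bigr => e' _; rewrite rmorphM -mulrA.
congr (_ * _); rewrite rmorph_prod.
have -> : phi h ^+ (n * (E * D)) = \prod_(i < n) phi h ^+ (E * D).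
  by rewrite prodr_const card_ord -exprM mulnC.
rewrite -big_split; apply: eq_bigr => i _; rewrite rmorphM !rmorphXn -GEP /=.
rewrite exprMn -exprM -mulrA -exprD; congr (_ * _ ^+ _).
by rewrite -mulnDr subnKC // ltnW.
Qed.

(** A longer chain provides N + 1 elements, each in c_(i+1) and outside c_i. A polynomial relation
    among them contradicts [chain_monomials_free], because its nonzero coefficients come from a
    field and are units of A. *)
Lemma Krull_upper n : prime_chain (Spec A) n -> (n <= N)%N.
Proof.
move=> [c [cP clt]]; rewrite leqNgt; apply/negP => Nn.
have /choice[f fP] : forall i, exists x, (i < n)%N -> c i.+1 x /\ ~ c i x.
  move=> i; have [/clt[_ /existsNP[x hx]]|] := boolP (i < n)%N; last by exists 0.
  by exists x => _; move: hx => /not_implyP.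
have fA (i : 'I_N.+1) : A (f i).
  have hi' : (i < n)%N := leq_trans (ltn_ord i) Nn.
  by case: (cP _ hi') => sub _ _ _ _; apply: sub; case: (fP _ hi').
have [D [a [[e0 ae0] aP]]] := dependency (ltnSn N) fA.
pose ex (e : {ffun 'I_N.+1 -> 'I_D}) i := if insub i is Some j then e j : nat else 0%N.
have exE e (i : 'I_N.+1) : ex e i = e i by rewrite /ex insubT //= => ?; congr (nat_of_ord (e _)); apply: val_inj.
have lt i : (i < N.+1)%N -> (i < n)%N by move=> h'; apply: leq_trans Nn.
apply: (@chain_monomials_free T A hA N.+1 c f _ _ _ _ _ ex (fun e => phi (a e)%:MP)
  (enum (fun e => a e != 0))).
- by move=> i hi'; apply: cP; apply: leq_trans hi' _.
- by move=> i /lt /clt[].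
- by move=> i /lt /fP[].
- by move=> i /lt /fP[].
- by [].
- by apply/eqP => E; have := mem_enum (fun e => a e != 0) e0; rewrite E inE unfold_in ae0.
- exact: enum_uniq.
- move=> e; rewrite mem_enum unfold_in => ae; exists (phi (a e)^-1%:MP) => //.
  by rewrite -rmorphM -mpolyCM mulVf // mpolyC1 rmorph1.
- move=> e e' _ _ h'; apply/ffunP => i; apply: val_inj => /=.
  by rewrite -!exE h'.
rewrite big_enum /= big_mkcond /=.
have [_ z _ _ _] := cP _ (leq0n n); rewrite [X in c 0%N X](_ : _ = 0) //.
rewrite -[RHS]aP; apply: eq_bigr => e _; case: ifP => [_|].
  by rewrite big_mkord; congr (_ * _); apply: eq_bigr => i _; rewrite exE.
by move=> /negbFE/eqP->; rewrite mpolyC0 rmorph0 mul0r.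
Qed.

End KrullUpper.

Lemma mpoly_rmorph_ext (R : comNzRingType) (S : comNzRingType) n
    (f g : {rmorphism {mpoly R[n]} -> S}) :
  (forall c, f c%:MP = g c%:MP) -> (forall i, f 'X_i = g 'X_i) -> f =1 g.
Proof.
move=> hC hX P; rewrite (mpolyE P) !rmorph_sum; apply: eq_bigr => m _.
rewrite -mul_mpolyC !rmorphM hC mpolyXE_id !rmorph_prod; congr (_ * _).
by apply: eq_bigr => i _; rewrite !rmorphXn hX.
Qed.

(** * Lower bound: a chain of specialisations through a point *)

Section Specialize.
Variables (F : fieldType) (N : nat) (c : 'I_N -> F) (i : nat).

Definition specialize : {mpoly F[N]} -> {mpoly F[N]} :=
  mmap (@mpolyC N F) (fun v => if (v < i)%N then (c v)%:MP else 'X_v).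
HB.instance Definition _ := GRing.RMorphism.copy specialize
  (mmap (@mpolyC N F) (fun v => if (v < i)%N then (c v)%:MP else 'X_v)).

End Specialize.

Section KrullLower.
Variables (T : comNzRingType) (A : set T).
Variables (F : fieldType) (N : nat) (phi : {rmorphism {mpoly F[N]} -> T}).
Hypothesis phiI : forall G, phi G = 0 -> G = 0.
Variables (h : {mpoly F[N]}) (c : 'I_N -> F).
Hypothesis AP : forall x, A x <-> exists G e, x * phi h ^+ e = phi G.
Hypothesis hc : h.@[c] != 0.

Local Notation spec := (specialize c).

Let specC i a : spec i a%:MP = a%:MP.
Proof. exact: mmapC. Qed.
Let specX i v : spec i 'X_v = if (v < i)%N then (c v)%:MP else 'X_v.
Proof. by rewrite /specialize mmapX mmap1U. Qed.

Let specM i : {morph spec i : x y / x * y}. Proof. exact: rmorphM. Qed.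
Let specD i : {morph spec i : x y / x + y}. Proof. exact: rmorphD. Qed.
Let specB i : {morph spec i : x y / x - y}. Proof. exact: rmorphB. Qed.
Let specXn i e : {morph spec i : x / x ^+ e}. Proof. exact: rmorphXn. Qed.

Let spec_ev i G : (spec i G).@[c] = G.@[c].
Proof.
have := @mpoly_rmorph_ext _ _ _ (meval c \o spec i : {rmorphism _ -> _}) (meval c).
apply => /= [a|v]; first by rewrite specC.
by rewrite specX; case: ifP => // _; rewrite mevalC mevalXU.
Qed.

Let spec_spec i G : spec i.+1 (spec i G) = spec i.+1 G.
Proof.
have := @mpoly_rmorph_ext _ _ _ (spec i.+1 \o spec i : {rmorphism _ -> _}) (spec i.+1).
apply => /= [a|v]; first by rewrite !specC.
by rewrite [in LHS]specX; case: ifP => // vi; rewrite specC specX ltnS ltnW.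
Qed.

(** h does not vanish at c and specialising does not change values at c. So h stays nonzero at every
    stage and the kernels survive localisation at h. *)
Let spec_h i e : spec i h ^+ e != 0.
Proof.
rewrite expf_neq0 //; apply: contraNneq hc => h0.
by rewrite -(spec_ev i) h0 meval0.
Qed.

(** The extension to the localisation of the kernel of [spec i], that is, of the ideal generated by
    X_v - c_v for v < i. *)
Let P i : set T := [set x | exists G e, x * phi h ^+ e = phi G /\ spec i G = 0].

Let phi_inj G G' : phi G = phi G' -> G = G'.
Proof. by move=> E; apply/eqP; rewrite -subr_eq0; apply/eqP/phiI; rewrite rmorphB E subrr. Qed.

(** Membership does not depend on the fraction chosen for x; this uses that phi is injective and
    that [spec i h] is nonzero. *)
Let PE i x G e : P i x -> x * phi h ^+ e = phi G -> spec i G = 0.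
Proof.
move=> [G' [e' [xE G'0]]] xG.
have E : G' * h ^+ e = G * h ^+ e'.
  by apply: phi_inj; rewrite !rmorphM !rmorphXn -xE -xG mulrAC.
have /eqP := congr1 (spec i) E; rewrite !specM !specXn G'0 mul0r eq_sym.
by rewrite mulf_eq0 (negPf (spec_h i e')) orbF => /eqP.
Qed.

Let P_prime i : Spec A (P i).
Proof.
split.
- by move=> x [G [e [xE _]]]; apply/AP; exists G, e.
- by exists 0, 0%N; rewrite mul0r rmorph0; split=> //; rewrite rmorph0.
- move=> x y [G [e [xE G0]]] [G' [e' [yE G'0]]].
  exists (G * h ^+ e' + G' * h ^+ e), (e + e')%N; split.
    by rewrite rmorphD !rmorphM !rmorphXn -xE -yE exprD; ring.
  by rewrite specD !specM G0 G'0 !mul0r addr0.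
- move=> a x /AP[G [e aE]] [G' [e' [xE G'0]]].
  exists (G * G'), (e + e')%N; split; last by rewrite specM G'0 mulr0.
  by rewrite rmorphM -aE -xE exprD; ring.
split.
  move=> P1; have := @PE i 1 1 0%N P1; rewrite mul1r expr0 !rmorph1.
  by move=> /(_ erefl) /eqP; rewrite oner_eq0.
move=> a b /AP[G [e aE]] /AP[G' [e' bE]] Pab.
have abE : a * b * phi h ^+ (e + e') = phi (G * G').
  by rewrite rmorphM -aE -bE exprD; ring.
have /eqP := PE Pab abE; rewrite specM mulf_eq0 => /orP[] /eqP E.
  by left; exists G, e.
by right; exists G', e'.
Qed.

(** X_i - c_i separates each prime from the next: the linear coefficient of X_i survives in
    [spec i]. *)
Lemma Krull_lower : prime_chain (Spec A) N.
Proof.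
exists P; split=> [i _|i iN]; first exact: P_prime.
split=> [x [G [e [xE G0]]]|sub].
  by exists G, e; split=> //; rewrite -spec_spec G0 rmorph0.
pose v := Ordinal iN.
have vP : P i.+1 (phi ('X_v - (c v)%:MP)).
  exists ('X_v - (c v)%:MP), 0%N; rewrite expr0 mulr1; split=> //.
  by rewrite specB specX specC ltnSn subrr.
move: (@PE i _ ('X_v - (c v)%:MP) 0%N (sub _ vP)); rewrite expr0 mulr1 => /(_ erefl).
rewrite specB specX specC ltnn => /(congr1 (fun G : {mpoly F[N]} => G@_U_(v))).
rewrite mcoeffB mcoeff0 mcoeffXU mcoeffC eqxx mnm1_eq0 mulr0 subr0 => /eqP.
by rewrite oner_eq0.
Qed.

End KrullLower.

(** * Tensor squares of fields *)

Section TensorTheory.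
Local Open Scope quotient_scope.
Variables (L : fieldType) (K : set L).
Implicit Types (G : zmodType) (s : seq (L * L)) (x y : tens K).

(** The homomorphism that a balanced B induces on the tensor product; this is the universal property
    in usable form. *)
Definition tval G (B : L -> L -> G) x : G := bsum B (repr x).

Lemma tval_pi G (B : L -> L -> G) s : balanced K B -> tval B (\pi_(tens K) s) = bsum B s.
Proof.
move=> bB; have /eqmodP/asboolP := reprK (\pi_(tens K) s).
by apply.
Qed.

Lemma tens_ext x y :
  (forall G (B : L -> L -> G), balanced K B -> tval B x = tval B y) -> x = y.
Proof.
move=> h; rewrite -[x]reprK -[y]reprK; apply/eqmodP/asboolP => G B bB.
exact: h.
Qed.

Lemma tval0 G (B : L -> L -> G) : balanced K B -> tval B 0 = 0.
Proof. by move=> bB; rewrite (tval_pi _ bB) /bsum big_nil. Qed.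

Lemma tvalD G (B : L -> L -> G) x y : balanced K B -> tval B (x + y) = tval B x + tval B y.
Proof. by move=> bB; rewrite (tval_pi _ bB) /bsum big_cat. Qed.

Lemma tval_tensor G (B : L -> L -> G) a b : balanced K B -> tval B (tensor K a b) = B a b.
Proof. by move=> bB; rewrite (tval_pi _ bB) /bsum big_seq1. Qed.

Lemma tval_tensorM G (B : L -> L -> G) a b a' b' : balanced K B ->
  tval B (tensor K a b * tensor K a' b') = B (a * a') (b * b').
Proof.
move=> bB; rewrite (tval_pi _ bB) /bsum /mul_seq big_allpairs_dep /=.
have [BDl BDr BK] := bB.
have bal1 c d : balanced K (fun u v => B (u * c) (v * d)).
  by split=> [u u' v|u v v'|k u v Kk]; rewrite ?mulrDl ?BDl ?BDr // -!mulrA BK.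
have bal2 s : balanced K (fun u v => \sum_(y <- s) B (u * y.1) (v * y.2)).
  split=> [u u' v|u v v'|k u v Kk]; rewrite -?big_split; apply: eq_bigr => y _ /=.
  - by have [-> _ _] := bal1 y.1 y.2.
  - by have [_ -> _] := bal1 y.1 y.2.
  by have [_ _ ->] := bal1 y.1 y.2.
have bal3 c d : balanced K (fun u v => B (c * u) (d * v)).
  split=> [u u' v|u v v'|k u v Kk]; rewrite ?mulrDr ?BDl ?BDr //.
  by rewrite (mulrCA c k) (BK k) // (mulrCA d k).
rewrite [LHS](tval_tensor _ _ (bal2 _)).
exact: (tval_tensor _ _ (bal3 a b)).
Qed.

Lemma tensorM a b a' b' : tensor K a b * tensor K a' b' = tensor K (a * a') (b * b').
Proof. by apply: tens_ext => G B bB; rewrite tval_tensorM // tval_tensor. Qed.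

Lemma tensorDl a a' b : tensor K (a + a') b = tensor K a b + tensor K a' b.
Proof. by apply: tens_ext => G B bB; rewrite tvalD // !tval_tensor //; have [-> _ _] := bB. Qed.

Lemma tensorDr a b b' : tensor K a (b + b') = tensor K a b + tensor K a b'.
Proof. by apply: tens_ext => G B bB; rewrite tvalD // !tval_tensor //; have [_ -> _] := bB. Qed.

Definition tinl a := tensor K a 1.
Definition tinr b := tensor K 1 b.

Lemma tinl_zmod_morphism : zmod_morphism tinl.
Proof.
move=> a b; apply/eqP; rewrite -subr_eq opprK /tinl -tensorDl subrK //.
Qed.
Lemma tinr_zmod_morphism : zmod_morphism tinr.
Proof. by move=> a b; apply/eqP; rewrite -subr_eq opprK /tinr -tensorDr subrK. Qed.
Lemma tinl_monoid_morphism : monoid_morphism tinl.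
Proof. by split=> // a b; rewrite /tinl tensorM mulr1. Qed.
Lemma tinr_monoid_morphism : monoid_morphism tinr.
Proof. by split=> // a b; rewrite /tinr tensorM mulr1. Qed.

HB.instance Definition _ := GRing.isZmodMorphism.Build L (tens K) tinl tinl_zmod_morphism.
HB.instance Definition _ := GRing.isMonoidMorphism.Build L (tens K) tinl tinl_monoid_morphism.
HB.instance Definition _ := GRing.isZmodMorphism.Build L (tens K) tinr tinr_zmod_morphism.
HB.instance Definition _ := GRing.isMonoidMorphism.Build L (tens K) tinr tinr_monoid_morphism.

Lemma tensorE a b : tensor K a b = tinl a * tinr b.
Proof. by rewrite tensorM mulr1 mul1r. Qed.

Record subspace_set (V : set L) : Prop := SubspaceSet {
  subspace0 : V 0;
  subspaceD : forall x y : L, V x -> V y -> V (x + y);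
  subspaceZ : forall c x : L, K c -> V x -> V (c * x)
}.

Hypotheses (K0 : K 0) (K1 : K 1) (KN : forall c, K c -> K (- c))
  (KD : forall c d, K c -> K d -> K (c + d)) (KM : forall c d, K c -> K d -> K (c * d))
  (KV : forall c, K c -> K c^-1).

(** By Zorn, a subspace maximal among those avoiding b is a complement of the line K b, i.e. the
    kernel of a K-linear functional with value 1 at b. *)
Lemma maximal_subspace_avoiding (V : set L) b : subspace_set V -> ~ V b ->
  exists W, [/\ subspace_set W, V `<=` W, ~ W b
    & forall x : L, exists2 c, K c & W (x - c * b)].
Proof.
move=> hV Vb.
pose sp := {W : set L | [/\ subspace_set W, V `<=` W & ~ W b]}.
pose R (W W' : sp) := `[< sval W `<=` sval W' >].
have [||||t tmax] := @Zorn sp R.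
- by move=> t; apply/asboolP.
- by move=> r s t /asboolP rs /asboolP st; apply/asboolP => x /rs /st.
- move=> [W1 h1] [W2 h2] /asboolP /= st /asboolP /= ts.
  have E : W1 = W2 by apply/seteqP.
  by subst W2; congr exist; apply: Prop_irrelevance.
- move=> Ch Ctot; have [[t0 t0C]|Cn] := pselect (exists t, Ch t); last first.
    exists (exist _ V (And3 hV (@subset_refl _ V) Vb)) => s Cs; exfalso.
    by apply: Cn; exists s.
  pose W := [set x | exists2 s, Ch s & sval s x].
  have hW : [/\ subspace_set W, V `<=` W & ~ W b].
    split.
    - split.
      + exists t0 => //; by case: (svalP t0) => -[].
      + move=> x y [s Cs sx] [s' Cs' s'y].
        have [/asboolP ss|/asboolP ss] := Ctot s s' Cs Cs'.
          exists s' => //; case: (svalP s') => -[_ add _] _ _; apply: add => //.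
          exact: ss.
        exists s => //; case: (svalP s) => -[_ add _] _ _; apply: add => //.
        exact: ss.
      + move=> c x Kc [s Cs sx]; exists s => //; case: (svalP s) => -[_ _ Z] _ _.
        exact: Z.
    - by move=> x Vx; exists t0 => //; case: (svalP t0) => _ + _; apply.
    - by case=> s _; case: (svalP s).
  exists (exist _ W hW) => s Cs; apply/asboolP => x sx; by exists s.
case: t tmax => W [hW VW Wb] tmax; exists W; split=> // x.
have [Wx|nWx] := pselect (W x); first by exists 0; rewrite ?mul0r ?subr0.
have [W0 WD WZ] := hW.
pose W' := [set y | exists c, K c /\ W (y - c * x)].
have hW' : subspace_set W'.
  split.
  - by exists 0; split=> //; rewrite mul0r subr0.
  - move=> y z [c [Kc yc]] [d [Kd zd]]; exists (c + d); split; first exact: KD.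
    by rewrite mulrDl opprD addrACA; apply: WD.
  - move=> d y Kd [c [Kc yc]]; exists (d * c); split; first exact: KM.
    by rewrite -mulrA -mulrBr; apply: WZ.
have WW' : W `<=` W' by move=> y Wy; exists 0; rewrite mul0r subr0.
(* Either adjoining x to W brings in b, and b = w + c x can be solved for x, or W' contradicts the
   maximality of W. *)
have [[c [Kc bc]]|nb] := pselect (W' b).
  have c0 : c != 0 by apply/eqP => cE; move: bc; rewrite cE mul0r subr0.
  exists c^-1; first exact: KV.
  have -> : x - c^-1 * b = - c^-1 * (b - c * x).
    by rewrite mulNr mulrBr mulrA mulVf // mul1r opprB.
  by apply: WZ => //; apply/KN/KV.
have E := tmax (exist _ W' (And3 hW' (subset_trans VW WW') nb)) (asboolT WW').
exfalso; apply: nWx; have <- : W' = W by have := congr1 sval E.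
by exists 1; rewrite mul1r subrr.
Qed.

(** Apply id (x) phi, where phi is a K-linear functional with value 1 at b_(i0) and 0 at the other
    b_i: it sends the sum to a_(i0). *)
Lemma tens_left_free (I : finType) (b a : I -> L) :
  (forall c : I -> L, (forall i, K (c i)) -> \sum_i c i * b i = 0 -> forall i, c i = 0) ->
  \sum_i tinl (a i) * tinr (b i) = 0 -> forall i, a i = 0.
Proof.
move=> free ab i0.
pose V := [set x | exists2 c : I -> L, (forall i, K (c i)) & x = \sum_(i | i != i0) c i * b i].
have hV : subspace_set V.
  split.
  - by exists (fun=> 0) => //; rewrite big1 // => i _; rewrite mul0r.
  - move=> x y [c Kc ->] [d Kd ->]; exists (fun i => c i + d i) => [i|]; first exact: KD.
    by rewrite -big_split; apply: eq_bigr => i _; rewrite mulrDl.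
  - move=> d x Kd [c Kc ->]; exists (fun i => d * c i) => [i|]; first exact: KM.
    by rewrite mulr_sumr; apply: eq_bigr => i _; rewrite mulrA.
have nV : ~ V (b i0).
  case=> c Kc bE; have := free (fun i => if i == i0 then -1 else c i).
  have Kc' i : K (if i == i0 then -1 else c i) by case: ifP => // _; apply: KN.
  have E : \sum_(i | i != i0) (if i == i0 then -1 else c i) * b i = b i0.
    by rewrite bE; apply: eq_bigr => i /negPf->.
  move=> /(_ Kc'); rewrite (bigD1 i0) //= E eqxx mulN1r addNr => /(_ erefl i0) /eqP.
  by rewrite eqxx oppr_eq0 oner_eq0.
have [W [[W0 WD WZ] VW Wb exphi]] := maximal_subspace_avoiding hV nV.
have WB (x y : L) : W x -> W y -> W (x - y).
  by move=> Wx Wy; apply: WD => //; rewrite -mulN1r; apply: WZ => //; apply: KN.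
have /choice[phi phiP] : forall x : L, exists c, K c /\ W (x - c * b i0).
  by move=> x; have [c Kc Wc] := exphi x; exists c.
have uniq (x c : L) : K c -> W (x - c * b i0) -> phi x = c.
  move=> Kc Wc; have [Kd Wd] := phiP x; apply/eqP; rewrite -subr_eq0.
  apply: contra_notT Wb => cd.
  have -> : b i0 = (phi x - c)^-1 * ((x - c * b i0) - (x - phi x * b i0)).
    have -> : x - c * b i0 - (x - phi x * b i0) = (phi x - c) * b i0 by ring.
    by rewrite mulrA mulVf // mul1r.
  by apply: WZ; [apply/KV/KD => //; apply: KN|apply: WB].
have phiD (x y : L) : phi (x + y) = phi x + phi y.
  have [[Kx Wx] [Ky Wy]] := (phiP x, phiP y); apply: uniq; first exact: KD.
  by rewrite mulrDl opprD addrACA; apply: WD.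
have phiZ (k x : L) : K k -> phi (k * x) = k * phi x.
  move=> Kk; have [Kx Wx] := phiP x; apply: uniq; first exact: KM.
  by rewrite -mulrA -mulrBr; apply: WZ.
have bB : balanced K (fun a b => a * phi b).
  split=> [u u' v|u v v'|k u v Kk]; first by rewrite mulrDl.
    by rewrite phiD mulrDr.
  by rewrite phiZ // mulrCA mulrA.
have := congr1 (tval (fun a b => a * phi b)) ab.
rewrite (big_morph _ (fun x y => tvalD x y bB) (tval0 bB)) tval0 // (bigD1 i0) //=.
rewrite big1 ?addr0 => [|i ii0].
  rewrite -tensorE tval_tensor // (uniq _ 1) ?mulr1 //.
  by rewrite mul1r subrr.
rewrite -tensorE tval_tensor // (uniq _ 0) ?mulr0 // mul0r subr0; apply: VW.
exists (fun j => (j == i)%:R) => [j|]; first by case: eqP.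
rewrite (bigD1 i) //= eqxx mul1r big1 ?addr0 // => j /andP[_ /negPf->].
exact: mul0r.
Qed.

End TensorTheory.

(** * Inverse Frobenius twists and rational functions *)

Lemma fraction_reprE (R : idomainType) (x : {fraction R}) :
  x = FracField.tofrac \n_(repr x) / FracField.tofrac \d_(repr x).
Proof.
rewrite -{1}[x]reprK; set y := repr x.
rewrite !piE; apply/eqmodP; rewrite /= FracField.equivfE /FracField.mulf /FracField.invf.
have d0 : \d_y != 0 by apply: denom_ratioP.
by rewrite !numden_Ratio ?mulf_neq0 ?oner_eq0 // mulr1 mul1r mulrC.
Qed.

Section Frob.
Variables (R : realType) (p : nat) (X : Cinfty R p).
Local Notation C := (Cfield X).
Implicit Types (x y : C) (f g : tate X) (a : {poly C}).

Lemma Cp_prime : prime p. Proof. exact: pcharf_prime (Cinfty_pchar X). Qed.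

Lemma Cpchar_pow n : [pchar C].-nat (p ^ n)%N.
Proof. by rewrite pnatX pnatE ?Cp_prime // Cinfty_pchar. Qed.

Lemma frobI n : injective (fun x => x ^+ (p ^ n)).
Proof.
move=> x y /= /eqP E; have [n0|n0] := posnP (p ^ n)%N.
  by move/eqP: n0; rewrite expn_eq0 (gtn_eqF (prime_gt0 Cp_prime)).
apply/eqP; rewrite -subr_eq0; have := exprDn_pchar x (- y) (Cpchar_pow n).
rewrite exprNn_pchar ?Cpchar_pow // (eqP E) subrr => /eqP.
by rewrite expf_eq0 n0.
Qed.

Lemma CrootK n x : Croot n x ^+ (p ^ n) = x.
Proof.
rewrite /Croot; case: xgetP => [//|h]; exfalso.
have pn0 : (0 < p ^ n)%N by rewrite expn_gt0 (prime_gt0 Cp_prime).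
have [y /rootP] : exists y, root ('X^(p ^ n) - x%:P) y.
  by apply/closed_rootP; rewrite size_XnsubC // eqSS -lt0n.
by rewrite hornerD hornerN hornerXn hornerC => /eqP; rewrite subr_eq0 => /eqP; exact: h.
Qed.

Lemma Croot_eq n x y : y ^+ (p ^ n) = x -> Croot n x = y.
Proof. by move=> E; apply: (@frobI n); rewrite /= CrootK. Qed.

Lemma Croot_zmod_morphism n : zmod_morphism (@Croot R p X n).
Proof.
move=> x y; apply: Croot_eq; rewrite (exprDn_pchar _ _ (Cpchar_pow n)).
by rewrite exprNn_pchar ?Cpchar_pow // !CrootK.
Qed.

Lemma Croot_monoid_morphism n : monoid_morphism (@Croot R p X n).
Proof.
split=> [|x y]; apply: Croot_eq; first by rewrite expr1n.
by rewrite exprMn !CrootK.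
Qed.

HB.instance Definition _ n := GRing.isZmodMorphism.Build C C (@Croot R p X n)
  (@Croot_zmod_morphism n).
HB.instance Definition _ n := GRing.isMonoidMorphism.Build C C (@Croot R p X n)
  (@Croot_monoid_morphism n).

Lemma CrootD m n x : Croot (m + n) x = Croot m (Croot n x).
Proof. by apply: Croot_eq; rewrite expnD exprM !CrootK. Qed.

Lemma Croot0 x : Croot 0 x = x.
Proof. exact: Croot_eq. Qed.

Lemma Croot_fixed n x : Croot n x = x <-> Fq n x.
Proof. by split=> [E|/Croot_eq//]; rewrite /Fq /= -{1}E CrootK. Qed.

Lemma tcoefD f g i : tcoef (f + g) i = tcoef f i + tcoef g i. Proof. by []. Qed.
Lemma tcoefN f i : tcoef (- f) i = - tcoef f i. Proof. by []. Qed.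
Lemma tcoefB f g i : tcoef (f - g) i = tcoef f i - tcoef g i. Proof. by []. Qed.
Lemma tcoefM f g i : tcoef (f * g) i = \sum_(j < i.+1) tcoef f j * tcoef g (i - j)%N.
Proof. by []. Qed.
Lemma tcoef_poly a i : tcoef (tate_of_poly a : tate X) i = a`_i. Proof. by []. Qed.

Lemma tate_of_poly_zmod_morphism : zmod_morphism (@tate_of_poly R p X).
Proof. by move=> a b; apply: tate_ext => i /=; rewrite coefB. Qed.
Lemma tate_of_poly_monoid_morphism : monoid_morphism (@tate_of_poly R p X).
Proof. by split=> // a b; apply: tate_ext => i; rewrite tcoefM /= coefM. Qed.
HB.instance Definition _ := GRing.isZmodMorphism.Build {poly C} (tate X)
  (@tate_of_poly R p X) tate_of_poly_zmod_morphism.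
HB.instance Definition _ := GRing.isMonoidMorphism.Build {poly C} (tate X)
  (@tate_of_poly R p X) tate_of_poly_monoid_morphism.

Lemma tate_of_poly_inj : injective (@tate_of_poly R p X).
Proof. by move=> a b /(congr1 (@tcoef _ _ _)) E; apply/polyP => i; have := congr1 (@^~ i) E. Qed.

Lemma tate_twist_zmod_morphism n : zmod_morphism (@tate_twist R p X n).
Proof. by move=> f g; apply: tate_ext => i /=; rewrite rmorphB. Qed.
Lemma tate_twist_monoid_morphism n : monoid_morphism (@tate_twist R p X n).
Proof.
split=> [|f g]; apply: tate_ext => i /=; first by rewrite !coef1 rmorph_nat.
by rewrite /cauchy_prod rmorph_sum; apply: eq_bigr => j _; rewrite rmorphM.
Qed.
HB.instance Definition _ n := GRing.isZmodMorphism.Build (tate X) (tate X)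
  (@tate_twist R p X n) (@tate_twist_zmod_morphism n).
HB.instance Definition _ n := GRing.isMonoidMorphism.Build (tate X) (tate X)
  (@tate_twist R p X n) (@tate_twist_monoid_morphism n).

Lemma tate_twistD m n f : tate_twist (m + n) f = tate_twist m (tate_twist n f).
Proof. by apply: tate_ext => i /=; rewrite CrootD. Qed.

Lemma tate_twist_inj n : injective (@tate_twist R p X n).
Proof.
apply: raddf_inj => f E; apply: tate_ext => i /=; have := congr1 (fun g => tcoef g i) E.
by move=> /= /(congr1 (fun x => x ^+ (p ^ n))); rewrite /= CrootK expr0n expn_eq0 (gtn_eqF (prime_gt0 Cp_prime)).
Qed.

Lemma tate_twist_eq0 n f : (tate_twist n f == 0) = (f == 0).
Proof.
apply/eqP/eqP => [E|->]; last exact: rmorph0.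
by apply: (@tate_twist_inj n); rewrite rmorph0.
Qed.

Lemma tate_twist_poly n a : tate_twist n (tate_of_poly a) = tate_of_poly (map_poly (Croot n) a).
Proof. by apply: tate_ext => i /=; rewrite coef_map. Qed.

HB.instance Definition _ := GRing.RMorphism.copy (@toLL R p X) (@FracField.tofrac (tate X)).

Lemma toLL_inj : injective (@toLL R p X).
Proof. by move=> f g /eqP; rewrite /toLL tofrac_eq => /eqP. Qed.

Lemma toLL_eq0 f : (toLL f == 0) = (f == 0).
Proof. by rewrite /toLL tofrac_eq0. Qed.

HB.instance Definition _ := GRing.RMorphism.copy (@poly_toLL R p X)
  (@toLL R p X \o @tate_of_poly R p X).

Lemma poly_toLL_inj : injective (@poly_toLL R p X).
Proof. by move=> a b /toLL_inj /tate_of_poly_inj. Qed.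

Lemma poly_toLL_eq0 a : (poly_toLL a == 0) = (a == 0).
Proof. by rewrite -(rmorph0 (@poly_toLL R p X)) (inj_eq poly_toLL_inj). Qed.

Lemma LL_frac (x : LL X) : exists2 fg : tate X * tate X, fg.2 != 0 & x = toLL fg.1 / toLL fg.2.
Proof.
exists (\n_(repr x), \d_(repr x)); first exact: denom_ratioP.
exact: fraction_reprE.
Qed.

(** [twist] is defined on a chosen representative. The twist of the Tate algebra is an injective
    ring morphism, so it preserves the cross-multiplied equality of two representatives. *)
Lemma twist_frac n f g : g != 0 ->
  twist n (toLL f / toLL g) = toLL (tate_twist n f) / toLL (tate_twist n g).
Proof.
move=> g0; rewrite /twist; set x := toLL f / _.
have d0 : \d_(repr x) != 0 by apply: denom_ratioP.
have tw0 (h : tate X) : h != 0 -> toLL (tate_twist n h) != 0.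
  by rewrite toLL_eq0 tate_twist_eq0.
apply/eqP; rewrite eqr_div ?tw0 // -!rmorphM; apply/eqP; congr (toLL (tate_twist n _)).
apply: toLL_inj; rewrite !(rmorphM (@toLL R p X)); apply/eqP.
by rewrite -eqr_div ?toLL_eq0 // -/x; apply/eqP/esym; exact: fraction_reprE.
Qed.

Lemma twist_toLL n f : twist n (toLL f) = toLL (tate_twist n f).
Proof.
by have := twist_frac n f (oner_neq0 _); rewrite !rmorph1 !divr1.
Qed.

Lemma twist_zmod_morphism n : zmod_morphism (@twist R p X n).
Proof.
move=> x y; have [[f g] /= g0 ->] := LL_frac x; have [[h k] /= k0 ->] := LL_frac y.
have tw0 (h' : tate X) : h' != 0 -> toLL (tate_twist n h') != 0.
  by rewrite toLL_eq0 tate_twist_eq0.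
rewrite -mulNr -rmorphN addf_div ?toLL_eq0 // -!rmorphM -rmorphD.
rewrite !twist_frac ?mulf_neq0 // -mulNr addf_div ?tw0 //.
by rewrite -!rmorphN -!rmorphM -!rmorphD.
Qed.

Lemma twist_monoid_morphism n : monoid_morphism (@twist R p X n).
Proof.
split=> [|x y]; first by have := twist_toLL n (1 : tate X); rewrite !rmorph1.
have [[f g] /= g0 ->] := LL_frac x; have [[h k] /= k0 ->] := LL_frac y.
by rewrite mulf_div -!rmorphM !twist_frac ?mulf_neq0 // mulf_div -!rmorphM.
Qed.

HB.instance Definition _ n := GRing.isZmodMorphism.Build (LL X) (LL X)
  (@twist R p X n) (@twist_zmod_morphism n).
HB.instance Definition _ n := GRing.isMonoidMorphism.Build (LL X) (LL X)
  (@twist R p X n) (@twist_monoid_morphism n).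

Lemma twistD m n (x : LL X) : twist (m + n) x = twist m (twist n x).
Proof.
have [[f g] /= g0 ->] := LL_frac x.
have tw0 : tate_twist n g != 0.
  by rewrite tate_twist_eq0.
by rewrite !twist_frac // !tate_twistD.
Qed.

Lemma twist0 (x : LL X) : twist 0 x = x.
Proof.
have [[f g] /= g0 ->] := LL_frac x; rewrite twist_frac //.
by congr (toLL _ / toLL _); apply: tate_ext => i /=; rewrite Croot0.
Qed.

Lemma twist_poly n a : twist n (poly_toLL a) = poly_toLL (map_poly (Croot n) a).
Proof. by rewrite /poly_toLL twist_toLL tate_twist_poly. Qed.

End Frob.

(** * Subfields as field types *)

Record subfield_set (L : fieldType) (F : set L) : Prop := SubfieldSet {
  subfield1 : F 1;
  subfieldB : forall x y, F x -> F y -> F (x - y);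
  subfield_div : forall x y, F x -> F y -> F (x / y)
}.

Section SubfieldType.
Variables (L : fieldType) (F : set L).

Definition sf_mem (hF : subfield_set F) : L -> bool := fun x => `[< F x >].

Variable hF : subfield_set F.

Lemma sf_mem_divring_closed : divring_closed (sf_mem hF).
Proof.
split=> [|x y|x y]; rewrite ?unfold_in; first by apply/asboolP; exact: subfield1.
  by move=> /asboolP Fx /asboolP Fy; apply/asboolP; exact: subfieldB.
by move=> /asboolP Fx /asboolP Fy; apply/asboolP; exact: subfield_div.
Qed.

HB.instance Definition _ := GRing.isDivringClosed.Build L (sf_mem hF) sf_mem_divring_closed.

(** Turns a subset that is a subfield into a field type, over which multivariate polynomials can be
    formed; used for kbar(t) and F_{p^ell}(t). *)
Record subfield_type := SubfieldElt { sf_val : L; sf_valP : sf_mem hF sf_val }.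

HB.instance Definition _ := [isSub for sf_val].
HB.instance Definition _ := [Choice of subfield_type by <:].
HB.instance Definition _ := [SubChoice_isSubIntegralDomain of subfield_type by <:].
HB.instance Definition _ := [SubIntegralDomain_isSubField of subfield_type by <:].

Definition sf_in x (Fx : F x) : subfield_type := @SubfieldElt x (asboolT Fx).

Lemma sf_valF (x : subfield_type) : F (sf_val x).
Proof. by apply/asboolP; exact: sf_valP. Qed.

Lemma sf_val_inj : injective sf_val.
Proof. exact: val_inj. Qed.

HB.instance Definition _ := GRing.RMorphism.copy sf_val (val : subfield_type -> L).

Lemma subfield0 : F 0.
Proof. by rewrite -(subrr 1); apply: (subfieldB hF); exact: subfield1 hF. Qed.
Lemma subfieldN x : F x -> F (- x).
Proof. by move=> Fx; rewrite -sub0r; apply: (subfieldB hF) => //; exact: subfield0. Qed.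
Lemma subfieldD x y : F x -> F y -> F (x + y).
Proof. by move=> Fx /subfieldN Fy; rewrite -[y]opprK; exact: (subfieldB hF). Qed.
Lemma subfieldV x : F x -> F x^-1.
Proof. by move=> Fx; rewrite -[x^-1]mul1r; apply: (subfield_div hF) => //; exact: subfield1 hF. Qed.
Lemma subfieldM x y : F x -> F y -> F (x * y).
Proof. by move=> Fx /subfieldV Fy; rewrite -[y]invrK; exact: (subfield_div hF). Qed.
Lemma subfieldX x n : F x -> F (x ^+ n).
Proof.
move=> Fx; elim: n => [|n IH]; first exact: subfield1 hF.
by rewrite exprS; apply: subfieldM.
Qed.
Lemma subfield_sum (I : Type) (r : seq I) (P : pred I) (f : I -> L) :
  (forall i, P i -> F (f i)) -> F (\sum_(i <- r | P i) f i).
Proof. by move=> h; elim/big_ind: _ => //; [exact: subfield0|exact: subfieldD]. Qed.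
Lemma subfield_nat n : F n%:R.
Proof. by elim: n => [|n IH]; [exact: subfield0|rewrite -addn1 natrD; apply: subfieldD => //; exact: subfield1 hF]. Qed.

Lemma coefs_inD a b : coefs_in F a -> coefs_in F b -> coefs_in F (a + b).
Proof. by move=> ha hb i; rewrite coefD; apply: subfieldD. Qed.
Lemma coefs_inN a : coefs_in F a -> coefs_in F (- a).
Proof. by move=> ha i; rewrite coefN; apply: subfieldN. Qed.
Lemma coefs_inM a b : coefs_in F a -> coefs_in F b -> coefs_in F (a * b).
Proof. by move=> ha hb i; rewrite coefM; apply: subfield_sum => j _; apply: subfieldM. Qed.
Lemma coefs_inC c : F c -> coefs_in F c%:P.
Proof. by move=> Fc i; rewrite coefC; case: eqP => // _; exact: subfield0. Qed.
Lemma coefs_inX : coefs_in F 'X.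
Proof. by move=> i; rewrite coefX; exact: subfield_nat. Qed.
Lemma coefs_in_linear c : F c -> coefs_in F ('X - c%:P).
Proof. by move=> Fc; apply: coefs_inD; [exact: coefs_inX|exact/coefs_inN/coefs_inC]. Qed.

Lemma coefs_in1 : coefs_in F 1.
Proof. by rewrite -polyC1; apply: coefs_inC; exact: subfield1 hF. Qed.
Lemma coefs_inXn a n : coefs_in F a -> coefs_in F (a ^+ n).
Proof.
move=> ha; elim: n => [|n IH]; first exact: coefs_in1.
by rewrite exprS; apply: coefs_inM.
Qed.
Lemma coefs_in_prod (I : Type) (r : seq I) (P : pred I) (f : I -> {poly L}) :
  (forall i, P i -> coefs_in F (f i)) -> coefs_in F (\prod_(i <- r | P i) f i).
Proof. by move=> h; elim/big_ind: _ => //; [exact: coefs_in1|exact: coefs_inM]. Qed.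
Lemma coefs_in_map (a : {poly subfield_type}) : coefs_in F (map_poly sf_val a).
Proof. by move=> i; rewrite coef_map; exact: sf_valF. Qed.
Lemma coefs_inP a : coefs_in F a -> exists b : {poly subfield_type}, a = map_poly sf_val b.
Proof.
move=> ha; exists (\poly_(i < size a) sf_in (ha i)); apply/polyP => i.
rewrite coef_map coef_poly; case: ltnP => // hi; rewrite nth_default //; exact/esym/(rmorph0 sf_val).
Qed.

Lemma adjoin_subfield x : subfield_set (adjoin F x).
Proof.
split=> [|y z|y z].
- exists 1, 1; split; rewrite ?hornerC ?oner_eq0 ?divr1 //; exact: coefs_in1.
- move=> [a [b [ha hb b0 ->]]] [c [d [hc hd d0 ->]]].
  exists (a * d - c * b), (b * d); split; rewrite ?hornerM ?mulf_neq0 //.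
  + by apply: coefs_inD; [|apply: coefs_inN]; apply: coefs_inM.
  + exact: coefs_inM.
  by rewrite hornerD hornerN !hornerM -mulNr addf_div // mulNr.
- move=> [a [b [ha hb b0 ->]]] [c [d [hc hd d0 ->]]].
  have [c0|c0] := eqVneq c.[x] 0.
    exists 0, 1; rewrite c0 mul0r invr0 mulr0 hornerC oner_eq0 horner0 mul0r; split=> //.
      by rewrite -polyC0; apply: coefs_inC; exact: subfield0.
    exact: coefs_in1.
  exists (a * d), (b * c); split; rewrite ?hornerM ?mulf_neq0 //; try exact: coefs_inM.
  by rewrite invf_div mulf_div.
Qed.

Lemma adjoin_poly (a : {poly L}) x : coefs_in F a -> adjoin F x a.[x].
Proof.
by move=> ha; exists a, 1; rewrite hornerC oner_eq0 divr1; split=> //; exact: coefs_in1.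
Qed.

Lemma adjoin_gen x : adjoin F x x.
Proof. by have := @adjoin_poly 'X x coefs_inX; rewrite hornerX. Qed.

Lemma algebraic_overE x : algebraic_over F x <-> algebraicOver sf_val x.
Proof.
split=> [[a [a0 /coefs_inP[b ab]] ax]|[b b0 bx]].
  by exists b; [apply: contraNneq a0 => b0; rewrite ab b0 map_poly0|rewrite -ab].
by exists (map_poly sf_val b); [rewrite map_poly_eq0; split=> //; exact: coefs_in_map|].
Qed.

Lemma algebraic_over_subfield : subfield_set (algebraic_over F).
Proof.
split=> [|x y /algebraic_overE hx /algebraic_overE hy|x y /algebraic_overE hx /algebraic_overE hy];
  apply/algebraic_overE.
- exact: algebraic1.
- exact: algebraic_sub.
- exact: algebraic_div.
Qed.

Lemma algebraic_over_base c : F c -> algebraic_over F c.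
Proof. by move=> Fc; apply/algebraic_overE; exact: (algebraic_id sf_val (sf_in Fc)). Qed.

Lemma algebraic_over_root x n : (0 < n)%N -> algebraic_over F (x ^+ n) -> algebraic_over F x.
Proof.
move=> n0 [a [a0 ha] ax]; exists (a \Po 'X^n).
  split; first by rewrite comp_poly_eq0 // size_polyXn.
  move=> i; rewrite comp_polyE coef_sum; apply: subfield_sum => j _.
  by rewrite coefZ -exprM coefXn; apply: subfieldM => //; exact: subfield_nat.
by move: ax; rewrite /root horner_comp hornerXn.
Qed.

End SubfieldType.

(** * Rational functions and their twists *)

Section Rational.
Variables (R : realType) (p : nat) (X : Cinfty R p).
Local Notation C := (Cfield X).
Local Notation L := (LL X).
Implicit Types (x y : C) (f g : tate X) (a b : {poly C}) (F : set C).

Lemma Fq_subfield n : subfield_set (@Fq R p X n).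
Proof.
split=> [|x y|x y]; rewrite /Fq /= ?expr1n //.
  move=> hx hy; rewrite (exprDn_pchar _ _ (Cpchar_pow X n)) hx.
  by rewrite exprNn_pchar ?Cpchar_pow // hy.
by move=> hx hy; rewrite expr_div_n hx hy.
Qed.

Lemma Fq_theta_subfield n : subfield_set (@Fq_theta R p X n).
Proof. exact/adjoin_subfield/Fq_subfield. Qed.

Lemma kbar_subfield : subfield_set (@kbar R p X).
Proof. exact/algebraic_over_subfield/Fq_theta_subfield. Qed.

Lemma kbar_theta : kbar (theta : C).
Proof. exact/(algebraic_over_base (Fq_theta_subfield 1))/adjoin_gen/Fq_subfield. Qed.

Lemma kbar_root x n : (0 < n)%N -> kbar (x ^+ n) -> kbar x.
Proof. exact/algebraic_over_root/Fq_theta_subfield. Qed.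

Lemma kbar_Croot n x : kbar x -> kbar (Croot n x).
Proof.
move=> hx; apply: (@kbar_root _ (p ^ n)); last by rewrite CrootK.
by rewrite expn_gt0 (prime_gt0 (Cp_prime X)).
Qed.

Lemma setT_subfield : subfield_set ([set: C]).
Proof. by []. Qed.

Lemma ratfun_subfield F : subfield_set F -> subfield_set (@ratfun R p X F).
Proof.
move=> hF; split=> [|x y|x y].
- by exists 1, 1; rewrite oner_eq0 rmorph1 divr1; split=> //; exact: (coefs_in1 hF).
- move=> [a [b [ha hb b0 ->]]] [c [d [hc hd d0 ->]]].
  exists (a * d - c * b), (b * d); rewrite mulf_neq0 //; split=> //.
  + by apply: (coefs_inD hF); [|apply: (coefs_inN hF)]; rewrite //; apply: (coefs_inM hF).
  + exact: (coefs_inM hF).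
  rewrite rmorphB !rmorphM mulrBl; congr (_ - _).
    by rewrite -mulf_div divff ?mulr1 // poly_toLL_eq0.
  by rewrite (mulrC (poly_toLL c) (poly_toLL b)) -mulf_div divff ?mul1r // poly_toLL_eq0.
- move=> [a [b [ha hb b0 ->]]] [c [d [hc hd d0 ->]]].
  have [->|c0] := eqVneq c 0.
    exists 0, 1; rewrite rmorph0 mul0r invr0 mulr0 mul0r oner_eq0; split=> //.
      by rewrite -polyC0; apply: (coefs_inC hF); exact: (subfield0 hF).
    exact: (coefs_in1 hF).
  exists (a * d), (b * c); rewrite mulf_neq0 //; split=> //; try exact: (coefs_inM hF).
  by rewrite !rmorphM invf_div mulf_div.
Qed.

Lemma ratfun_poly F a : subfield_set F -> coefs_in F a -> ratfun F (poly_toLL a).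
Proof. by move=> hF ha; exists a, 1; rewrite rmorph1 divr1 oner_eq0; split=> //; exact: (coefs_in1 hF). Qed.

Lemma ratfunS F G : F `<=` G -> @ratfun R p X F `<=` ratfun G.
Proof.
move=> FG x [a [b [ha hb b0 ->]]]; exists a, b; split=> //.
  by move=> i; exact: FG.
by move=> i; exact: FG.
Qed.

Lemma ratfun_twist F n (x : L) : (forall c, F c -> F (Croot n c)) ->
  @ratfun R p X F x -> ratfun F (twist n x).
Proof.
move=> hF [a [b [ha hb b0 ->]]].
exists (map_poly (Croot n) a), (map_poly (Croot n) b); split.
- by move=> i; rewrite coef_map; exact: hF.
- by move=> i; rewrite coef_map; exact: hF.
- by rewrite map_poly_eq0.
by rewrite fmorph_div /= !twist_poly.
Qed.

Lemma ratfun_coprime (x : L) : ratfun setT x ->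
  exists a b, [/\ coprimep a b, b \is monic & x = poly_toLL a / poly_toLL b].
Proof.
move=> [a [b [_ _ b0 ->]]]; pose g := gcdp a b.
have g0 : g != 0 by rewrite gcdp_eq0 negb_and b0 orbT.
pose a1 := a %/ g; pose b1 := b %/ g.
have aE : a = a1 * g by rewrite divpK // dvdp_gcdl.
have bE : b = b1 * g by rewrite divpK // dvdp_gcdr.
have b10 : b1 != 0 by apply: contraNneq b0 => b10; rewrite bE b10 mul0r.
pose l := lead_coef b1; have l0 : l != 0 by rewrite lead_coef_eq0.
have cop : coprimep a1 b1 by apply: coprimep_div_gcd; rewrite b0 orbT.
exists (l^-1 *: a1), (l^-1 *: b1); split.
- by rewrite coprimepZl ?invr_eq0 // coprimepZr ?invr_eq0.
- by rewrite monicE lead_coefZ mulVf.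
rewrite aE bE !rmorphM -mulf_div divff ?poly_toLL_eq0 // mulr1.
rewrite -!mul_polyC !rmorphM -mulf_div divff ?mul1r //.
by rewrite poly_toLL_eq0 polyC_eq0 invr_eq0.
Qed.

(** A reduced fraction with monic denominator is unique, and the twist preserves this form; an
    invariant fraction therefore has invariant coefficients. *)
Lemma ratfun_twist_fixed n (x : L) : ratfun setT x -> twist n x = x -> ratfun (Fq n) x.
Proof.
move=> /ratfun_coprime[a [b [cop mon ->]]].
have b0 := monic_neq0 mon.
rewrite fmorph_div /= !twist_poly; set a' := map_poly _ a; set b' := map_poly _ b.
have b'0 : b' != 0 by rewrite map_poly_eq0.
move=> /eqP; rewrite eqr_div ?poly_toLL_eq0 // -!rmorphM => /eqP/poly_toLL_inj E.
have cop' : coprimep a' b' by rewrite coprimep_map.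
have mon' : b' \is monic by rewrite map_monic.
have bb' : b = b'.
  apply/eqP; rewrite -eqp_monic // /eqp; apply/andP; split.
    have ba : coprimep b a by rewrite coprimep_sym.
    by rewrite -(Gauss_dvdpr b' ba) -E dvdp_mull.
  have ba : coprimep b' a' by rewrite coprimep_sym.
  by rewrite -(Gauss_dvdpr b ba) E dvdp_mull.
have aa' : a = a' by apply: (mulIf b0); rewrite E -bb'.
exists a, b; split=> // i; apply/Croot_fixed.
  by rewrite -coef_map -/a' -aa'.
by rewrite -coef_map -/b' -bb'.
Qed.

Lemma Fq_t_twist n (x : L) : ratfun (Fq n) x -> twist n x = x.
Proof.
move=> [a [b [ha hb b0 ->]]]; rewrite fmorph_div /= !twist_poly.
congr (poly_toLL _ / poly_toLL _); apply/polyP => i; rewrite coef_map; exact/Croot_fixed.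
Qed.

End Rational.

(** * Evaluation at theta *)

Section Analysis.
Variables (R : realType) (p : nat) (X : Cinfty R p).
Local Notation C := (Cfield X).
Local Notation abs := (@Cabs R p X).
Local Notation th := (@theta R p X).
Local Notation rho := (p%:R : R).
Implicit Types (x y c : C) (f g : tate X) (a b : {poly C}) (e B : R).

Lemma rho_gt1 : 1 < rho.
Proof. by rewrite ltr1n; exact: prime_gt1 (Cp_prime X). Qed.
Lemma rho_gt0 : 0 < rho. Proof. exact: lt_trans ltr01 rho_gt1. Qed.
Lemma rhoX_gt0 n : 0 < rho ^+ n. Proof. exact: exprn_gt0 rho_gt0. Qed.
Lemma rhoX_ge1 n : 1 <= rho ^+ n. Proof. exact: exprn_ege1 (ltW rho_gt1). Qed.
Hint Resolve rho_gt0 rhoX_gt0 rhoX_ge1 : core.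

Lemma absV x : abs x^-1 = (abs x)^-1.
Proof.
have [->|x0] := eqVneq x 0; first by rewrite invr0 abs0 invr0.
have ax0 : abs x != 0 by rewrite Cabs_eq0.
by apply: (mulfI ax0); rewrite -CabsM !divff ?abs1.
Qed.

Lemma absD_le x y e : abs x <= e -> abs y <= e -> abs (x + y) <= e.
Proof. by move=> hx hy; apply: le_trans (CabsD_max x y) _; rewrite ge_max hx. Qed.

Lemma absB_le x y e : abs x <= e -> abs y <= e -> abs (x - y) <= e.
Proof. by move=> hx hy; apply: absD_le; rewrite ?absN. Qed.

Lemma abs_sum_le (I : Type) (r : seq I) (P : pred I) (F : I -> C) e : 0 <= e ->
  (forall i, P i -> abs (F i) <= e) -> abs (\sum_(i <- r | P i) F i) <= e.
Proof. by move=> e0 h; elim/big_ind: _ => //; [rewrite abs0|move=> x y; exact: absD_le]. Qed.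

Lemma abs_eq0P x : (forall e, 0 < e -> abs x <= e) -> x = 0.
Proof.
move=> h; apply/eqP; rewrite -Cabs_eq0 eq_le Cabs_ge0 andbT; apply/ler_addgt0Pr => e e0; rewrite add0r; exact: h.
Qed.

(* The Gauss norm on the disc |t| <= |theta|. *)
Definition bnd f B := forall i, abs (tcoef f i) * rho ^+ i <= B.

Lemma bnd_ge0 f B : bnd f B -> 0 <= B.
Proof. by move=> /(_ 0%N); apply: le_trans; rewrite mulr_ge0 ?Cabs_ge0 // ltW. Qed.

Lemma bnd_le f B B' : B <= B' -> bnd f B -> bnd f B'.
Proof. by move=> BB h i; apply: le_trans (h i) BB. Qed.

Lemma bndN f B : bnd f B -> bnd (- f) B.
Proof. by move=> h i; rewrite tcoefN absN. Qed.

Lemma bndD f g B : bnd f B -> bnd g B -> bnd (f + g) B.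
Proof.
move=> hf hg i; rewrite -ler_pdivlMr // tcoefD.
by apply: absD_le; rewrite ler_pdivlMr.
Qed.

Lemma bndB f g B : bnd f B -> bnd g B -> bnd (f - g) B.
Proof. by move=> hf /bndN; exact: bndD. Qed.

Lemma bndM f g B B' : bnd f B -> bnd g B' -> bnd (f * g) (B * B').
Proof.
move=> hf hg i; have B0 := bnd_ge0 hf; have B'0 := bnd_ge0 hg.
rewrite -ler_pdivlMr // tcoefM; apply: abs_sum_le => [|j _].
  by rewrite divr_ge0 ?mulr_ge0 // ltW.
rewrite CabsM ler_pdivlMr //.
have -> : rho ^+ i = rho ^+ j * rho ^+ (i - j) by rewrite -exprD subnKC // -ltnS.
rewrite mulrACA.
by apply: ler_pM; rewrite ?mulr_ge0 ?Cabs_ge0 // ltW.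
Qed.

Lemma bnd_cst c : bnd (tate_of_poly c%:P) (abs c).
Proof.
move=> i; rewrite tcoef_poly coefC; case: i => [|i] /=; first by rewrite expr0 mulr1.
by rewrite abs0 mul0r Cabs_ge0.
Qed.

Lemma bnd_X : bnd (tate_of_poly 'X) rho.
Proof.
move=> i; rewrite tcoef_poly coefX; case: eqP => [->|_]; first by rewrite abs1 mul1r.
by rewrite abs0 mul0r ltW.
Qed.

Lemma bnd1 : bnd 1 1.
Proof. by have := bnd_cst 1; rewrite polyC1 rmorph1 abs1. Qed.

Lemma bndX f B n : bnd f B -> bnd (f ^+ n) (B ^+ n).
Proof. by move=> h; elim: n => [|n IH]; [exact: bnd1|rewrite !exprS; exact: bndM]. Qed.

Lemma bnd_poly a : exists B, bnd (tate_of_poly a) B.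
Proof.
elim/poly_ind: a => [|a c [B hB]]; first by exists 0 => i; rewrite rmorph0 abs0 mul0r.
exists (Num.max (B * rho) (abs c)); rewrite rmorphD rmorphM; apply: bndD.
  by apply: bnd_le (bndM hB bnd_X); rewrite le_max lexx.
by apply: bnd_le (bnd_cst c); rewrite le_max lexx orbT.
Qed.

Lemma poly_eval_bnd a B : bnd (tate_of_poly a) B -> abs a.[th] <= B.
Proof.
move=> h; rewrite horner_coef; apply: abs_sum_le => [|i _]; first exact: bnd_ge0 h.
by rewrite CabsM absX Cabs_theta; exact: h i.
Qed.

(* f(theta) = v, for f a uniform limit of polynomials on |t| <= |theta|. *)
Definition hasev f v := forall e, 0 < e ->
  exists2 a, bnd (f - tate_of_poly a) e & abs (v - a.[th]) <= e.

Lemma hasev_poly a : hasev (tate_of_poly a) a.[th].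
Proof.
move=> e e0; exists a; last by rewrite subrr abs0 ltW.
by move=> i; rewrite subrr abs0 mul0r ltW.
Qed.

Lemma hasev_lim f v :
  (forall e, 0 < e -> exists g w, [/\ hasev g w, bnd (f - g) e & abs (v - w) <= e]) ->
  hasev f v.
Proof.
move=> h e e0; have [g [w [gw fg vw]]] := h e e0; have [a ga wa] := gw e e0.
exists a; first by rewrite -[f](subrK g) -addrA; exact: bndD.
by rewrite -[v](subrK w) -addrA; exact: absD_le.
Qed.

Lemma hasev_bnd f v B : hasev f v -> bnd f B -> abs v <= B.
Proof.
move=> h fB; have B0 := bnd_ge0 fB.
suff H e : 0 < e -> abs v <= Num.max B e.
  have [B0'|B0'] := ltP 0 B; first by have := H _ B0'; rewrite maxxx.
  have B00 : B = 0 by apply/eqP; rewrite eq_le B0 B0'.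
  rewrite B00 leNgt; apply/negP => v0.
  have := H (abs v / 2) (divr_gt0 v0 (ltr0n _ 2)); rewrite B00 => /le_trans.
  move=> /(_ (abs v / 2)); rewrite ge_max lexx andbT divr_ge0 ?Cabs_ge0 // => /(_ isT).
  by lra.
move=> e0; have [a fa va] := h e e0; rewrite -[v](subrK a.[th]).
apply: absD_le; first by rewrite le_max va orbT.
apply: poly_eval_bnd; rewrite -[tate_of_poly a](subKr f).
by apply: bndB; [apply: bnd_le fB|apply: bnd_le fa]; rewrite le_max lexx ?orbT.
Qed.

Lemma hasevD f g v w : hasev f v -> hasev g w -> hasev (f + g) (v + w).
Proof.
move=> hf hg e e0; have [a fa va] := hf e e0; have [b gb wb] := hg e e0.
exists (a + b); first by rewrite rmorphD opprD addrACA; exact: bndD.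
by rewrite hornerD opprD addrACA; exact: absD_le.
Qed.

Lemma hasev_ub f v : hasev f v -> exists2 B, 0 < B & bnd f B.
Proof.
move=> /(_ 1 ltr01)[a fa _]; have [B aB] := bnd_poly a.
exists (Num.max B 1); first by rewrite lt_max ltr01 orbT.
rewrite -[f](subrK (tate_of_poly a)); apply: bndD.
  by apply: bnd_le fa; rewrite le_max lexx orbT.
by apply: bnd_le aB; rewrite le_max lexx.
Qed.

Lemma hasevM f g v w : hasev f v -> hasev g w -> hasev (f * g) (v * w).
Proof.
move=> hf hg; have [B B0 fB] := hasev_ub hf; have [B' B'0 gB] := hasev_ub hg.
have vB := hasev_bnd hf fB; have wB := hasev_bnd hg gB.
(* The bound d (B + B') <= e handles both cross terms, and d <= B keeps the approximating polynomial
   a within the bound B of f. *)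
move=> e e0; pose d := Num.min (e / (B + B')) (Num.min B B').
have d0 : 0 < d by rewrite !lt_min divr_gt0 ?addr_gt0 // B0.
have d1 : d * (B + B') <= e by rewrite -ler_pdivlMr ?addr_gt0 // ge_min lexx.
have dB : d <= B by rewrite !ge_min lexx !orbT.
have [a fa va] := hf d d0; have [b gb wb] := hg d d0.
have aB : bnd (tate_of_poly a) B.
  by rewrite -[tate_of_poly a](subKr f); apply: bndB => //; exact: bnd_le fa.
have aBv := poly_eval_bnd aB.
have dB1 : d * B' <= e by apply: le_trans d1; rewrite ler_pM2l // lerDr ltW.
have dB2 : B * d <= e by apply: le_trans d1; rewrite mulrC ler_pM2l // lerDl ltW.
exists (a * b).
  have -> : f * g - tate_of_poly (a * b) =
     (f - tate_of_poly a) * g + tate_of_poly a * (g - tate_of_poly b).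
    by rewrite rmorphM; ring.
  by apply: bndD; [apply: bnd_le (bndM fa gB)|apply: bnd_le (bndM aB gb)].
rewrite hornerM; have -> : v * w - a.[th] * b.[th] = (v - a.[th]) * w + a.[th] * (w - b.[th]).
  by ring.
apply: absD_le; rewrite CabsM; [apply: le_trans dB1|apply: le_trans dB2].
  by apply: ler_pM; rewrite ?Cabs_ge0.
by apply: ler_pM; rewrite ?Cabs_ge0.
Qed.

Lemma hasev_uniq f v w : hasev f v -> hasev f w -> v = w.
Proof.
move=> hv hw; apply/eqP; rewrite -subr_eq0; apply/eqP/abs_eq0P => e e0.
have [a fa va] := hv e e0; have [b fb wb] := hw e e0.
have -> : v - w = (v - a.[th]) - (w - b.[th]) + (a - b).[th].
  by rewrite hornerD hornerN; ring.
apply: absD_le; first exact: absB_le.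
apply: poly_eval_bnd; rewrite rmorphB.
have -> : tate_of_poly a - tate_of_poly b = (f - tate_of_poly b) - (f - tate_of_poly a) :> tate X by ring.
exact: bndB.
Qed.

Lemma hasevXn f v n : hasev f v -> hasev (f ^+ n) (v ^+ n).
Proof.
move=> h; elim: n => [|n IH]; last by rewrite !exprS; exact: hasevM.
by have := hasev_poly 1; rewrite rmorph1 hornerC.
Qed.

Lemma hasev_sum (I : Type) (r : seq I) (P : pred I) (F : I -> tate X) (G : I -> C) :
  (forall i, P i -> hasev (F i) (G i)) ->
  hasev (\sum_(i <- r | P i) F i) (\sum_(i <- r | P i) G i).
Proof.
move=> h; apply: (big_ind2 hasev) => //; last by move=> *; exact: hasevD.
by have := hasev_poly 0; rewrite rmorph0 horner0.
Qed.

Lemma hasev_prod (I : Type) (r : seq I) (P : pred I) (F : I -> tate X) (G : I -> C) :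
  (forall i, P i -> hasev (F i) (G i)) ->
  hasev (\prod_(i <- r | P i) F i) (\prod_(i <- r | P i) G i).
Proof.
move=> h; apply: (big_ind2 hasev) => //; last by move=> *; exact: hasevM.
by have := hasev_poly 1; rewrite rmorph1 hornerC.
Qed.

End Analysis.

(** * Limits in the Tate algebra and their values at theta *)

Section Limits.
Variables (R : realType) (p : nat) (X : Cinfty R p).
Local Notation C := (Cfield X).
Local Notation abs := (@Cabs R p X).
Local Notation th := (@theta R p X).
Local Notation rho := (p%:R : R).
Implicit Types (x y c : C) (f g : tate X) (a b : {poly C}) (e B : R).
Let rho0 := rho_gt0 X.
Let rhoX0 := rhoX_gt0 X.
Let rhoX1 := rhoX_ge1 X.
Hint Resolve rho0 rhoX0 rhoX1 : core.

Lemma tends_to_uniq (u : nat -> C) l l' : tends_to abs u l -> tends_to abs u l' -> l = l'.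
Proof.
move=> h h'; apply/eqP; rewrite -subr_eq0; apply/eqP/abs_eq0P => e e0.
have [N hN] := h e e0; have [M hM] := h' e e0.
have -> : l - l' = (u (N + M)%N - l') - (u (N + M)%N - l) by ring.
by apply: absB_le; apply: ltW; [apply: hM|apply: hN]; rewrite ?leq_addr ?leq_addl.
Qed.

Lemma ClimE (u : nat -> C) l : tends_to abs u l -> Clim u = l.
Proof.
move=> h; have h' : tends_to abs u (Clim u) by exact: (@xgetPex _ 0 [set l | tends_to abs u l]) (ex_intro _ l h).
exact: tends_to_uniq h' h.
Qed.

Lemma cauchy_Clim (u : nat -> C) :
  (forall e, 0 < e -> exists N, forall n, (N <= n)%N -> abs (u n.+1 - u n) <= e) ->
  tends_to abs u (Clim u).
Proof.
move=> h; suff [l hl] : exists l, tends_to abs u l by rewrite (ClimE hl).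
apply: Cinfty_complete => e e0.
have e20 : 0 < e / 2 by rewrite divr_gt0.
have [N hN] := h _ e20; exists N.
have H m k : (N <= m)%N -> abs (u (m + k)%N - u m) <= e / 2.
  move=> Nm; elim: k => [|k IH]; first by rewrite addn0 subrr abs0 ltW.
  rewrite addnS -[u _.+1](subrK (u (m + k)%N)) -addrA; apply: absD_le => //.
  by apply: hN; apply: leq_trans Nm (leq_addr _ _).
have e2e : e / 2 < e by lra.
move=> m n Nm Nn; apply: le_lt_trans e2e.
case: (leqP m n) => [mn|/ltnW nm].
  by rewrite -[u m - u n]opprB absN -(subnKC mn); exact: H.
by rewrite -(subnKC nm); exact: H.
Qed.

Definition gconv (u : nat -> tate X) f := forall e, 0 < e ->
  exists N : nat, forall n, (N <= n)%N -> forall i, abs (tcoef (u n - f) i) < e.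

Lemma gconv_uniq u f g : gconv u f -> gconv u g -> f = g.
Proof.
move=> hf hg; apply: tate_ext => i; apply/eqP; rewrite -subr_eq0; apply/eqP/abs_eq0P => e e0.
have [N hN] := hf e e0; have [M hM] := hg e e0.
have -> : tcoef f i - tcoef g i = tcoef (u (N + M)%N - g) i - tcoef (u (N + M)%N - f) i.
  by rewrite !tcoefB; ring.
by apply: absB_le; apply: ltW; [apply: hM|apply: hN]; rewrite ?leq_addr ?leq_addl.
Qed.

Lemma tate_limE u f : gconv u f -> tate_lim u = f.
Proof.
move=> h; have h' : gconv u (tate_lim u) by exact: (@xgetPex _ 0 [set f | gconv u f]) (ex_intro _ f h).
exact: gconv_uniq h' h.
Qed.

Lemma gconvS u f : gconv u f -> gconv (fun n => u n.+1) f.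
Proof. by move=> h e /h[N hN]; exists N => n Nn; apply: hN; exact: leqW. Qed.

Lemma gconv_eq u v f : u =1 v -> gconv u f -> gconv v f.
Proof. by move=> uv; have -> : v = u by apply/funext => n; rewrite uv. Qed.

Lemma gconvDl g u f : gconv u f -> gconv (fun n => g + u n) (g + f).
Proof. by move=> h e /h[N hN]; exists N => n /hN; rewrite opprD addrACA subrr add0r. Qed.

Lemma gconvMl g u f : gconv u f -> gconv (fun n => g * u n) (g * f).
Proof.
move=> h e e0; have [B B0 gB] := tate_bounded g.
have [N hN] := h _ (divr_gt0 e0 B0); exists N => n Nn i.
rewrite -mulrBr tcoefM; apply: (abs_sum_lt (f := fun j => tcoef g j * tcoef (u n - f) (i - j)%N)) => // j _.
rewrite CabsM; apply: le_lt_trans (_ : B * (abs (tcoef (u n - f) (i - j)%N)) < e).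
  by rewrite ler_wpM2r ?Cabs_ge0 // ltW.
by rewrite mulrC -ltr_pdivlMr //; exact: hN.
Qed.

Lemma gconv_twist r u f : gconv u f -> gconv (fun n => tate_twist r (u n)) (tate_twist r f).
Proof.
move=> h e e0; have [N hN] := h _ (exprn_gt0 (p ^ r) e0); exists N => n Nn i.
have pr0 : (0 < p ^ r)%N by rewrite expn_gt0 (Cinfty_p_gt0 X).
rewrite -rmorphB /= -(ltr_pXn2r pr0) ?nnegrE ?Cabs_ge0 // ?(ltW e0) //.
by rewrite -absX CrootK; exact: hN.
Qed.

(** [tate_lim] is a limit for the Gauss norm on |t| <= 1, which does not control values at theta.
    This is the stronger convergence on |t| <= |theta|. *)
Definition conv (u : nat -> tate X) f := forall e, 0 < e ->
  exists N : nat, forall n, (N <= n)%N -> bnd (u n - f) e.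

Lemma bnd_coef f B i : bnd f B -> abs (tcoef f i) <= B.
Proof. by move/(_ i); apply: le_trans; rewrite ler_peMr ?Cabs_ge0. Qed.

Lemma conv_gconv u f : conv u f -> gconv u f.
Proof.
move=> h e e0; have e2 : 0 < e / 2 by rewrite divr_gt0.
have [N hN] := h _ e2; exists N => n /hN hn i.
by apply: le_lt_trans (bnd_coef i hn) _; lra.
Qed.

(** Each coefficient converges by completeness, and the bounds weighted by |theta|^i pass to the
    limit. The limit series is also a Gauss limit, so uniqueness identifies it with [tate_lim u].
    Consecutive differences suffice since the norm is ultrametric. *)
Lemma conv_tate_lim u :
  (forall e, 0 < e -> exists N, forall n, (N <= n)%N -> bnd (u n.+1 - u n) e) ->
  conv u (tate_lim u).
Proof.
move=> h.
have H e : 0 < e -> exists N, forall m n, (N <= m)%N -> (m <= n)%N -> bnd (u n - u m) e.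
  move=> e0; have [N hN] := h _ e0; exists N => m n Nm mn; rewrite -(subnKC mn).
  elim: (n - m)%N => [|k IH]; first by move=> i; rewrite addn0 subrr abs0 mul0r ltW.
  rewrite addnS -[u _.+1](subrK (u (m + k)%N)) -addrA; apply: bndD => //.
  by apply: hN; apply: leq_trans Nm (leq_addr _ _).
have lim i : tends_to abs (fun n => tcoef (u n) i) (Clim (fun n => tcoef (u n) i)).
  apply: cauchy_Clim => e e0; have [N hN] := h _ e0; exists N => n Nn.
  by rewrite -tcoefB; apply: bnd_coef; exact: hN.
pose l i := Clim (fun n => tcoef (u n) i).
have L e : 0 < e -> exists N, forall n, (N <= n)%N -> forall i, abs (tcoef (u n) i - l i) * rho ^+ i <= e.
  move=> e0; have [N hN] := H _ e0; exists N => n Nn i.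
  have [M hM] := lim i _ (divr_gt0 e0 (rhoX0 i)).
  rewrite -ler_pdivlMr // -[tcoef (u n) i](subrK (tcoef (u (n + M)%N) i)) -addrA.
  apply: absD_le; last by apply: ltW; apply: hM; exact: leq_addl.
  rewrite -absN opprB -tcoefB ler_pdivlMr //; apply: hN => //; exact: leq_addr.
have lP : tends_to abs l 0.
  move=> e e0; have e2 : 0 < e / 2 by rewrite divr_gt0.
  have [N hN] := L _ e2; have [M hM] := tcoefP (u N) e2; exists M => i Mi.
  rewrite subr0 -[l i](subKr (tcoef (u N) i)); apply: le_lt_trans (_ : e / 2 < e); last by lra.
  apply: absB_le; first by have := hM _ Mi; rewrite subr0 => /ltW.
  apply: le_trans (hN _ (leqnn _) i); by rewrite ler_peMr ?Cabs_ge0.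
have uf : conv u (Tate lP) by move=> e /L[N hN]; exists N => n Nn i; exact: hN.
by rewrite (tate_limE (conv_gconv uf)).
Qed.

Lemma tate_lim_eval u (w : nat -> C) :
  (forall e, 0 < e -> exists N, forall n, (N <= n)%N -> bnd (u n.+1 - u n) e) ->
  (forall n, hasev (u n) (w n)) ->
  tends_to abs w (Clim w) /\ hasev (tate_lim u) (Clim w).
Proof.
move=> h hw.
have hwd n : hasev (u n.+1 - u n) (w n.+1 - w n).
  have h1 := hasevM (hasev_poly (-1)%:P) (hw n).
  have := hasevD (hw n.+1) h1; rewrite hornerC mulN1r rmorphN rmorph1 rmorphN rmorph1 mulN1r.
  exact.
have wl : tends_to abs w (Clim w).
  apply: cauchy_Clim => e /h[N hN]; exists N => n /hN; exact: hasev_bnd.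
split=> //; apply: hasev_lim => e e0.
have [N hN] := conv_tate_lim h e0; have [M hM] := wl _ e0.
exists (u (N + M)%N), (w (N + M)%N); split=> //.
  by rewrite -opprB; apply: bndN; apply: hN; exact: leq_addr.
by rewrite -opprB absN; apply: ltW; apply: hM; exact: leq_addl.
Qed.

Lemma tcoef_cstM c f i : tcoef (tate_of_poly c%:P * f) i = c * tcoef f i.
Proof.
rewrite tcoefM big_ord_recl big1 => [|j _]; first by rewrite tcoef_poly coefC addr0 subn0.
by rewrite tcoef_poly coefC /= mul0r.
Qed.

Lemma tcoef_XM f i : tcoef (tate_of_poly 'X * f) i = if i is j.+1 then tcoef f j else 0.
Proof.
rewrite tcoefM big_ord_recl tcoef_poly coefX mul0r add0r.
case: i => [|i]; first by rewrite big_ord0.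
rewrite big_ord_recl big1 => [|j _]; first by rewrite tcoef_poly coefX mul1r addr0 /= subSS subn0.
by rewrite tcoef_poly coefX mul0r.
Qed.

Lemma rho_pow_large e : 0 < e -> exists M, forall n, (M <= n)%N -> (rho ^+ n)^-1 <= e.
Proof.
move=> e0; have [M hM] : exists M : nat, e^-1 <= M%:R.
  exists (Num.truncn e^-1).+1; exact/ltW/truncnS_gt.
exists M => n Mn; rewrite invf_ple ?posrE //; apply: le_trans hM _.
apply: (@le_trans _ _ n%:R); first by rewrite ler_nat.
rewrite -natrX ler_nat; apply/ltnW/ltn_expl; exact: prime_gt1 (Cp_prime X).
Qed.

Section Linear.
Variable c : C.
Hypothesis rc : rho <= abs c.

Let ac0 : 0 < abs c. Proof. exact: lt_le_trans rc. Qed.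

Let c0 : c != 0.
Proof. by rewrite -Cabs_eq0; apply: lt0r_neq0. Qed.

(** These are the coefficients of the geometric series of (t - c)^-1. *)
Lemma inv_linearP : tends_to abs (fun k => - c ^- k.+1) 0.
Proof.
move=> e e0; have e2 : 0 < e / 2 by rewrite divr_gt0.
have [M hM] := rho_pow_large e2; exists M => n Mn; rewrite subr0 absN absV absX.
apply: le_lt_trans (_ : e / 2 < e); last by lra.
apply: le_trans (hM n.+1 (leqW Mn)); rewrite lef_pV2 ?posrE ?exprn_gt0 //.
by apply: lerXn2r => //; rewrite nnegrE ltW.
Qed.

Definition inv_linear := Tate inv_linearP.

Lemma inv_linearM : inv_linear * (tate_of_poly ('X - c%:P)) = 1.
Proof.
apply: tate_ext => i; rewrite mulrC rmorphB mulrBl tcoefB tcoef_XM tcoef_cstM.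
rewrite [RHS]coef1; case: i => [|i] /=.
  by rewrite sub0r mulrN opprK expr1 divff.
by rewrite [c ^+ i.+2]exprS invfM mulrN mulrA divff // mul1r opprK addNr.
Qed.

Lemma inv_linear_bnd : bnd inv_linear (abs c)^-1.
Proof.
move=> i; rewrite /= absN absV absX exprS invfM -mulrA ler_piMr ?invr_ge0 ?Cabs_ge0 //.
rewrite mulrC ler_pdivrMr ?exprn_gt0 // mul1r; apply: lerXn2r => //; rewrite nnegrE ?Cabs_ge0 //.
Qed.

(** When |c| >= |theta|^2, the ratio theta / c has absolute value at most 1/p, so the geometric
    series still converges at theta. *)
Lemma inv_linear_hasev : rho ^+ 2 <= abs c -> hasev inv_linear (th - c)^-1.
Proof.
move=> rc2; have rc' : rho < abs c.
  by apply: lt_le_trans rc2; rewrite expr2 ltr_pMr // rho_gt1.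
have tc0 : th - c != 0.
  by rewrite subr_eq0; apply/eqP => E; move: rc'; rewrite -E Cabs_theta ltxx.
pose q := rho / abs c; have q0 : 0 <= q by rewrite divr_ge0 ?ltW.
have qr : q <= rho^-1.
  by rewrite /q ler_pdivrMr // mulrC ler_pdivlMr // -expr2.
have geom e : 0 < e -> exists N, q ^+ N <= e.
  move=> e0; have [N hN] := rho_pow_large e0; exists N; apply: le_trans (hN N (leqnn N)).
  by rewrite -exprVn; apply: lerXn2r => //; rewrite nnegrE ?invr_ge0 ltW.
(* Truncations of the geometric series; the error is (t/c)^N / (t - c). *)
pose a N : {poly C} := (- c^-1)%:P * \sum_(k < N) (c^-1%:P * 'X) ^+ k.
have aE N : a N * ('X - c%:P) = 1 - (c^-1%:P * 'X) ^+ N.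
  have -> : 'X - c%:P = (- c)%:P * (1 - c^-1%:P * 'X) :> {poly C}.
    by rewrite mulrBr mulr1 mulrA -polyCM mulNr divff // !polyCN polyC1 mulN1r opprK addrC.
  rewrite /a mulrACA -polyCM mulrNN mulVf // polyC1 mul1r mulrC.
  by rewrite -opprB mulNr -subrX1 opprB.
have [B B0 hB] : exists2 B, 0 < B & forall N,
   bnd (inv_linear - tate_of_poly (a N)) (B * q ^+ N) /\ abs ((th - c)^-1 - (a N).[th]) <= B * q ^+ N.
  exists (Num.max (abs c)^-1 (abs (th - c)^-1)); first by rewrite lt_max invr_gt0 ac0.
  move=> N; have qN0 : 0 <= q ^+ N by rewrite exprn_ge0.
  split.
    have -> : inv_linear - tate_of_poly (a N) = inv_linear * tate_of_poly ((c^-1%:P * 'X) ^+ N).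
      have -> : (c^-1%:P * 'X) ^+ N = 1 - a N * ('X - c%:P) by rewrite aE subKr.
      by rewrite rmorphB rmorph1 (rmorphM _ (a N)) mulrBr mulr1 mulrCA inv_linearM mulr1.
    apply: (@bnd_le _ _ _ _ ((abs c)^-1 * q ^+ N)).
      by rewrite ler_wpM2r // le_max lexx.
    apply: bndM; first exact: inv_linear_bnd.
    rewrite rmorphXn; apply: bndX; rewrite rmorphM /q mulrC; apply: bndM; first exact: bnd_X.
    by rewrite -absV; exact: bnd_cst.
  have -> : (th - c)^-1 - (a N).[th] = (th - c)^-1 * (th / c) ^+ N.
    apply: (mulIf tc0); rewrite mulrBl mulVf // mulrAC mulVf // mul1r.
    have := congr1 (fun b : {poly C} => b.[th]) (aE N).
    rewrite /= hornerM hornerD hornerN hornerX hornerC => ->.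
    by rewrite !hornerE opprB addrC subrK mulrC.
  rewrite CabsM absX CabsM (absV c) Cabs_theta -/q.
  by rewrite ler_wpM2r // le_max lexx orbT.
move=> e e0; have [N hN] := geom _ (divr_gt0 e0 B0); have [h1 h2] := hB N.
have le : B * q ^+ N <= e by rewrite mulrC -ler_pdivlMr.
by exists (a N); [apply: bnd_le h1|apply: le_trans le].
Qed.

End Linear.
End Limits.

(** * The function Omega_r *)

Section Omega.
Variables (R : realType) (p : nat) (X : Cinfty R p).
Local Notation C := (Cfield X).
Local Notation abs := (@Cabs R p X).
Local Notation th := (@theta R p X).
Local Notation rho := (p%:R : R).
Implicit Types (x y c : C) (f g : tate X) (a b : {poly C}) (e B : R).
Let rho0 := rho_gt0 X.
Let rhoX0 := rhoX_gt0 X.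
Let rhoX1 := rhoX_ge1 X.
Hint Resolve rho0 rhoX0 rhoX1 : core.

Local Notation cst c := (tate_of_poly c%:P : tate X).
Local Notation t := (tate_of_poly 'X : tate X).

Lemma th_neq0 : th != 0.
Proof. by rewrite -Cabs_eq0 Cabs_theta; exact: lt0r_neq0. Qed.

Lemma abs_thX n : abs (th ^+ n) = rho ^+ n.
Proof. by rewrite absX Cabs_theta. Qed.

Lemma abs_1B x : abs x < 1 -> abs (1 - x) = 1.
Proof.
move=> x1; apply/eqP; rewrite eq_le; apply/andP; split.
  by apply: absB_le; rewrite ?abs1 // ltW.
rewrite leNgt; apply/negP => h; have := CabsD_max (1 - x) x.
by rewrite subrK abs1 leNgt gt_max h x1.
Qed.

Variables (r : nat) (r0 : (0 < r)%N) (eta : nat -> C).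
Hypothesis etaP : eta r ^+ (p ^ r).-1 = - th.
Let q := (p ^ r)%N.

Let q1 : (1 < q)%N.
Proof. by rewrite /q -(exp1n r) ltn_exp2r // (prime_gt1 (Cp_prime X)). Qed.

Let qi i : (i < p ^ (r * i))%N.
Proof.
apply: (@leq_ltn_trans (r * i)%N); first by rewrite leq_pmull.
by rewrite ltn_expl // (prime_gt1 (Cp_prime X)).
Qed.

Lemma eta_neq0 : eta r != 0.
Proof.
apply/eqP => E; have := etaP; rewrite E expr0n.
have -> : ((p ^ r).-1 == 0)%N = false by move: q1; rewrite /q; case: (p ^ r)%N => [|[]].
by move/eqP; rewrite eq_sym oppr_eq0 (negPf th_neq0).
Qed.

Let z i := th ^- (p ^ (r * i)).
Let om N : tate X := \prod_(1 <= i < N.+1) (1 - cst (z i) * t).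
Let w N : C := \prod_(1 <= i < N.+1) (1 - th / th ^+ (p ^ (r * i))).

Let abs_z i : abs (z i) = (rho ^+ (p ^ (r * i)))^-1.
Proof. by rewrite /z absV abs_thX. Qed.

(** The norm is at most p^(1 - p^(ri)), and i < p^(ri) turns this into a bound that visibly tends to
    0. *)
Let zt_bnd i : bnd (cst (z i) * t) (rho ^+ i)^-1.
Proof.
apply: bnd_le (bndM (bnd_cst _) (bnd_X X)); rewrite abs_z.
rewrite ler_pdivrMl // ler_pdivlMr // -exprS.
apply: ler_weXn2l; [exact: ltW (rho_gt1 X)|exact: qi].
Qed.

Let bnd_1 e : 1 <= e -> bnd (1 : tate X) e.
Proof. by move=> h; apply: bnd_le h (bnd1 X). Qed.

Let om_bnd N : bnd (om N) 1.
Proof.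
rewrite /om; elim: N => [|N IH]; first by rewrite big_geq //; exact: bnd_1.
rewrite big_nat_recr //=; apply: (@bnd_le _ _ _ _ (1 * 1)); first by rewrite mulr1.
apply: bndM => //; apply: bndB; first exact: bnd_1.
by apply: bnd_le (zt_bnd _); rewrite invf_le1.
Qed.

Let om_cauchy e : 0 < e -> exists N, forall n, (N <= n)%N -> bnd (om n.+1 - om n) e.
Proof.
move=> e0; have [M hM] := rho_pow_large X e0; exists M => n Mn.
rewrite /om big_nat_recr //= mulrBr mulr1 addrAC subrr sub0r; apply: bndN.
apply: bnd_le (bndM (om_bnd n) (zt_bnd n.+1)); rewrite mul1r.
by apply: hM; exact: leqW.
Qed.

Let om_ev N : hasev (om N) (w N).
Proof.
apply: hasev_prod => i _; have := hasev_poly (1 - (z i)%:P * 'X : {poly C}).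
rewrite rmorphB rmorph1 rmorphM !hornerE [z i * th]mulrC.
exact.
Qed.

Let abs_w N : abs (w N) = 1.
Proof.
rewrite /w big_nat_cond; elim/big_ind: _ => [|x y hx hy|i]; first exact: abs1.
  by rewrite CabsM hx hy mulr1.
rewrite andbT => /andP[i1 _]; apply: abs_1B.
rewrite CabsM absV abs_thX Cabs_theta ltr_pdivrMr // mul1r -{1}[rho]expr1.
by rewrite ltr_eXn2l ?(rho_gt1 X) //; apply: leq_ltn_trans (qi i).
Qed.

Lemma OmegaE : Omega eta r = cst (eta r ^- q) * tate_lim om.
Proof. by []. Qed.

Lemma pi_tildeE : pi_tilde eta r = th * eta r * Clim (fun N => (w N)^-1).
Proof.
rewrite /pi_tilde; congr (_ * Clim _); apply/funext => N.
by rewrite /w prodfV.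
Qed.

(** From eta^(q-1) = -theta follows eta^(-q) = -(theta eta)^(-1), and the product at theta is
    inverse to the one in pi_tilde. Its partial products all have absolute value 1, so the limit is
    nonzero and inverting commutes with it. *)
Lemma Omega_eval : hasev (Omega eta r) (- (pi_tilde eta r)^-1).
Proof.
have [wl hW] := tate_lim_eval om_cauchy om_ev.
set W := Clim w in wl hW.
have aW : abs W = 1.
  have [N hN] := wl 1 ltr01; have h := hN N (leqnn N).
  have wN0 : w N != 0 by rewrite -Cabs_eq0 abs_w oner_eq0.
  have -> : W = w N * (1 - (w N - W) / w N) by field.
  by rewrite CabsM abs_w mul1r abs_1B // CabsM absV abs_w invr1 mulr1.
have W0 : W != 0 by rewrite -Cabs_eq0 aW oner_eq0.
have wV : Clim (fun N => (w N)^-1) = W^-1.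
  apply: ClimE => e /wl[N hN]; exists N => n /hN h.
  have wn0 : w n != 0 by rewrite -Cabs_eq0 abs_w oner_eq0.
  have -> : (w n)^-1 - W^-1 = - ((w n - W) * ((w n)^-1 * W^-1)).
    by field; rewrite wn0 W0.
  by rewrite absN !CabsM !absV abs_w aW !invr1 !mulr1.
rewrite OmegaE pi_tildeE wV.
have -> : - (th * eta r * W^-1)^-1 = eta r ^- q * W.
  have e0 := eta_neq0.
  have -> : q = (p ^ r).-1.+1 by rewrite prednK // ltnW.
  rewrite exprS etaP; field.
  by rewrite oppr_eq0 !th_neq0 e0 W0.
apply: hasevM => //; have := hasev_poly (eta r ^- q)%:P.
by rewrite hornerC.
Qed.

Let tcoef0M f g : tcoef (f * g) 0 = tcoef f 0 * tcoef g 0.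
Proof. by rewrite tcoefM big_ord_recl big_ord0 addr0. Qed.

(** Every partial product has constant coefficient 1, hence cannot tend to 0. *)
Lemma Omega_neq0 : Omega eta r != 0.
Proof.
rewrite OmegaE mulf_neq0 //.
  rewrite -(rmorph0 (@tate_of_poly R p X)) (inj_eq (@tate_of_poly_inj _ _ _)) polyC_eq0.
  by rewrite invr_eq0 expf_neq0 // eta_neq0.
apply/eqP => E; have t10 : tcoef (1 : tate X) 0 = 1 by exact: (coef1 C 0).
have om0 n : tcoef (om n) 0 = 1.
  rewrite /om; elim: n => [|n IH]; first by rewrite big_geq.
  by rewrite big_nat_recr // tcoef0M IH mul1r tcoefB t10 tcoef_cstM tcoef_poly coefX mulr0 subr0.
have half : 0 < 1 / 2 :> R by lra.
have [K hK] := conv_tate_lim om_cauchy half.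
have := bnd_coef 0 (hK K (leqnn K)); rewrite E subr0 om0 abs1.
by lra.
Qed.

Lemma tate_twist_linear n c k :
  tate_twist n (t - cst (c ^+ (p ^ (n + k)))) = t - cst (c ^+ (p ^ k)).
Proof.
rewrite -!rmorphB tate_twist_poly map_polyXsubC /=.
by rewrite (_ : Croot n _ = c ^+ (p ^ k)) //; apply: Croot_eq; rewrite addnC expnD exprM.
Qed.

(** The twist moves the factor of index i+1 to index i, that of index 1 to 1 - t/theta, and eta^(-q)
    to eta^(-1); then eta^(-1) (1 - t/theta) = (t - theta) eta^(-q). *)
Lemma Omega_twist : tate_twist r (Omega eta r) = tate_of_poly ('X - th%:P) * Omega eta r.
Proof.
have twc c : tate_twist r (cst c) = cst (Croot r c).
  by rewrite tate_twist_poly map_polyC.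
have twt : tate_twist r t = t by rewrite tate_twist_poly map_polyX.
rewrite OmegaE rmorphM /= twc.
have -> : Croot r (eta r ^- q) = (eta r)^-1.
  by apply: Croot_eq; rewrite exprVn.
have twom N : tate_twist r (om N.+1) = (1 - cst th^-1 * t) * om N.
  rewrite /om rmorph_prod big_ltn //= big_add1 /=; congr (_ * _).
    rewrite rmorphB rmorph1 rmorphM /= twc twt; congr (1 - cst _ * t).
    by apply: Croot_eq; rewrite /z muln1 exprVn.
  apply: eq_bigr => i _; rewrite rmorphB rmorph1 rmorphM /= twc twt; congr (1 - cst _ * t).
  by apply: Croot_eq; rewrite /z exprVn -exprM mulnS expnD [(p ^ r * _)%N]mulnC.
have lim := conv_gconv (conv_tate_lim om_cauchy).
have -> : tate_twist r (tate_lim om) = (1 - cst th^-1 * t) * tate_lim om.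
  apply: gconv_uniq (gconvS (gconv_twist r lim)) _.
  by apply: gconv_eq (gconvMl _ lim) => N; rewrite twom.
rewrite !mulrA; congr (_ * _); rewrite -!rmorphM -(rmorph1 (@tate_of_poly R p X)) -rmorphB -rmorphM.
congr tate_of_poly.
have e0 := eta_neq0; have t0 := th_neq0.
have -> : eta r ^- q = - (th * eta r)^-1.
  have -> : q = (p ^ r).-1.+1 by rewrite prednK // ltnW.
  by rewrite exprS etaP mulrN invrN mulrC.
have -> : (- (th * eta r)^-1)%:P = - ((eta r)^-1%:P * th^-1%:P) :> {poly C}.
  by rewrite -polyCM invfM mulrC polyCN.
have TB : th%:P * th^-1%:P = 1 :> {poly C} by rewrite -polyCM divff.
set A := (eta r)^-1%:P; set B := th^-1%:P in TB *; set T := th%:P in TB *.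
have -> : ('X - T) * - (A * B) = A * (T * B) - A * (B * 'X) by ring.
by rewrite TB; ring.
Qed.

End Omega.

(** * The series L_{alpha,rn} *)

Lemma geometric_gap (q n l i M s : nat) : (1 < q)%N -> (l * q.-1 < n * q)%N ->
  (q.-1 * s + q = q * q ^ i)%N -> (n * q + q.-1 * M <= q ^ i)%N ->
  (l * q ^ i + M <= n * s)%N.
Proof.
move=> q1 lq sE h; have q0 : (0 < q.-1)%N by case: q q1 {lq sE h} => [|[]].
rewrite -(leq_pmul2l q0).
set Q := (q ^ i)%N in sE h *.
(* As l (q-1) <= nq - 1, the product (q-1) (ns - l q^i) is at least q^i - nq. *)
have h1 : (l * q.-1 * Q + Q <= n * q * Q)%N.
  by rewrite -{2}[Q]mul1n -mulnDl leq_mul2r addn1 lq orbT.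
have h2 : (q.-1 * (n * s) + n * q = n * q * Q)%N.
  by rewrite mulnCA -mulnDr sE mulnA.
have -> : (q.-1 * (l * Q + M) = l * q.-1 * Q + q.-1 * M)%N by rewrite mulnDr mulnA [(q.-1 * l)%N]mulnC.
lia.
Qed.

Lemma geometric_sum (q i : nat) : (1 < q)%N ->
  (q.-1 * \sum_(1 <= j < i.+1) q ^ j + q = q * q ^ i)%N.
Proof.
move=> q1; elim: i => [|i IH]; first by rewrite big_geq // muln0 expn0 muln1.
rewrite big_nat_recr //= mulnDr addnAC IH -expnS -{1}[(q ^ i.+1)%N]mul1n -mulnDl.
by rewrite add1n prednK // ltnW.
Qed.

Section Lseries.
Variables (R : realType) (p : nat) (X : Cinfty R p).
Local Notation C := (Cfield X).
Local Notation abs := (@Cabs R p X).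
Local Notation th := (@theta R p X).
Local Notation rho := (p%:R : R).
Implicit Types (x y c : C) (f g : tate X) (a b : {poly C}) (e B : R).
Let rho0 := rho_gt0 X.
Let rhoX0 := rhoX_gt0 X.
Let rhoX1 := rhoX_ge1 X.
Hint Resolve rho0 rhoX0 rhoX1 : core.

Local Notation cst c := (tate_of_poly c%:P : tate X).
Local Notation t := (tate_of_poly 'X : tate X).

Lemma linear_unit c : rho <= abs c -> (t - cst c) \is a GRing.unit.
Proof.
by move=> h; apply/unitrPr; exists (inv_linear h); rewrite mulrC -rmorphB inv_linearM.
Qed.

Lemma linear_inv c (h : rho <= abs c) : (t - cst c)^-1 = inv_linear h.
Proof.
have U := linear_unit h.
by apply: (mulrI U); rewrite divrr // mulrC -rmorphB inv_linearM.
Qed.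

Variables (r n l : nat) (r0 : (0 < r)%N) (n0 : (0 < n)%N).
Local Notation q := (p ^ r)%N.
Hypothesis lq : (l * q.-1 < n * q)%N.
Let al : C := th ^+ l.

Let p1 : (1 < p)%N := prime_gt1 (Cp_prime X).
Let q1 : (1 < q)%N.
Proof. by rewrite -(exp1n r) ltn_exp2r. Qed.

Let lin j : tate X := t - cst (th ^+ (p ^ (r * j))).

Let c_ge j : rho <= abs (th ^+ (p ^ (r * j))).
Proof. by rewrite (abs_thX X) -{1}[rho]expr1 ler_eXn2l ?(rho_gt1 X) ?expn_gt0 ?(ltnW p1). Qed.

Let lin_unit j : lin j \is a GRing.unit.
Proof. exact: linear_unit. Qed.

Let lin_bnd j : bnd (lin j)^-1 (rho ^+ (p ^ (r * j)))^-1.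
Proof. by rewrite /lin (linear_inv (c_ge j)) -(abs_thX X); exact: inv_linear_bnd. Qed.

Let lin_ev j : (0 < j)%N -> hasev (lin j)^-1 (th - th ^+ (p ^ (r * j)))^-1.
Proof.
move=> j0; rewrite /lin (linear_inv (c_ge j)); apply: inv_linear_hasev.
rewrite (abs_thX X) ler_eXn2l ?(rho_gt1 X) //.
apply: (@leq_trans p) => //; rewrite -{1}[p]expn1 leq_exp2l // muln_gt0 r0.
exact: j0.
Qed.

Let T i : tate X := cst (al ^+ (p ^ (r * i))) / \prod_(1 <= j < i.+1) lin j ^+ n.

Let TE i : T i = cst (al ^+ (p ^ (r * i))) * \prod_(1 <= j < i.+1) (lin j)^-1 ^+ n.
Proof.
rewrite /T -prodrV => [|j _]; last by rewrite unitrX.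
by congr (_ * _); apply: eq_bigr => j _; rewrite exprVn.
Qed.

Let T_bnd i : bnd (T i) (rho ^+ (l * q ^ i) / rho ^+ (n * \sum_(1 <= j < i.+1) q ^ j)).
Proof.
rewrite TE; apply: bndM.
  apply: bnd_le (bnd_cst _); rewrite /al -exprM (abs_thX X) expnM.
  exact: lexx.
elim: i => [|i IH]; first by rewrite !big_geq // muln0 expr0 invr1; exact: bnd1.
have -> : (\sum_(1 <= j < i.+2) q ^ j = \sum_(1 <= j < i.+1) q ^ j + q ^ i.+1)%N.
  by rewrite big_nat_recr.
rewrite big_nat_recr //= mulnDr exprD invfM; apply: bndM => //.
by rewrite mulnC exprM -exprVn; apply: bndX; rewrite -expnM; exact: lin_bnd.
Qed.

Let T_ev i : hasev (T i) (al ^+ (p ^ (r * i)) / Lden X r i ^+ n).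
Proof.
rewrite TE; apply: hasevM; first by have := hasev_poly (al ^+ (p ^ (r * i)))%:P; rewrite hornerC.
rewrite /Lden -prodrXl -prodfV big_nat_cond [X in hasev _ X]big_nat_cond.
apply: hasev_prod => j /andP[/andP[j1 _] _]; rewrite -exprVn.
by apply: hasevXn; exact: lin_ev.
Qed.

(** The i-th term has norm at most p to the power l q^i - n (q + ... + q^i). The condition l <
    nq/(q-1), which is the convergence condition of [Plog] at theta^l, sends this exponent to minus
    infinity. *)
Let T_small e : 0 < e -> exists N, forall i, (N <= i)%N -> bnd (T i) e.
Proof.
move=> e0; have [M hM] := rho_pow_large X e0; exists (n * q + q.-1 * M)%N => i hi.
apply: bnd_le (T_bnd i); apply: le_trans (hM M (leqnn M)).
rewrite ler_pdivrMr // ler_pdivlMl // -exprD ler_eXn2l ?(rho_gt1 X) // addnC.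
apply: geometric_gap (geometric_sum i q1) _ => //.
by apply: leq_trans hi _; apply/ltnW/ltn_expl.
Qed.

Let S N : tate X := \sum_(1 <= i < N.+1) T i.
Let W N : C := \sum_(1 <= i < N.+1) al ^+ (p ^ (r * i)) / Lden X r i ^+ n.

Let S_cauchy e : 0 < e -> exists N, forall k, (N <= k)%N -> bnd (S k.+1 - S k) e.
Proof.
move=> /T_small[N hN]; exists N => k Nk; rewrite /S big_nat_recr //= addrAC subrr add0r.
by apply: hN; exact: leqW.
Qed.

Let S_ev N : hasev (S N) (W N).
Proof. by apply: hasev_sum => i _; exact: T_ev. Qed.

Let LseriesE : Lseries al r n = cst al + tate_lim S.
Proof. by []. Qed.

Lemma Lseries_eval : hasev (Lseries al r n) (Plog r n al).
Proof.
have [Wl hS] := tate_lim_eval S_cauchy S_ev.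
have -> : Plog r n al = al + Clim W.
  (* The partial sums of [Plog] start at index 0 with the term [al], so they run one index ahead of
     those of W. *)
  apply: ClimE => e /Wl[N hN]; exists N.+1 => -[//|k] Nk.
  rewrite big_ltn // /Lden big_geq // expr1n divr1 muln0 expn0 expr1 opprD addrACA subrr add0r.
  exact: hN.
rewrite LseriesE; apply: hasevD => //; have := hasev_poly al%:P.
by rewrite hornerC.
Qed.

(** With T_0 = alpha, the twist sends T_(i+1) to T_i / (t - theta)^n, so the sum over i >= 1 becomes
    the whole series divided by (t - theta)^n. *)
Lemma Lseries_twist : tate_twist r (Lseries al r n) =
  cst (Croot r al) + (t - cst th)^-1 ^+ n * Lseries al r n.
Proof.
have twc c : tate_twist r (cst c) = cst (Croot r c).
  by rewrite tate_twist_poly map_polyC.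
have lin0 : lin 0 = t - cst th by rewrite /lin muln0 expn0 expr1.
have twl j : tate_twist r (lin j.+1) = lin j by rewrite /lin mulnS tate_twist_linear.
have twV j : tate_twist r ((lin j.+1)^-1 ^+ n) = (lin j)^-1 ^+ n.
  by rewrite rmorphXn rmorphV //= twl.
have twT i : tate_twist r (T i.+1) = (t - cst th)^-1 ^+ n * T i.
  rewrite !TE rmorphM /= twc big_add1 /= big_ltn // rmorphM rmorph_prod /=.
  rewrite twV lin0 mulrCA; congr (_ * (cst _ * _)).
    by apply: Croot_eq; rewrite -exprM mulnS expnD mulnC.
  by apply: eq_bigr => j _; exact: twV.
have twS N : tate_twist r (S N.+1) = (t - cst th)^-1 ^+ n * (cst al + S N).
  have T0 : T 0 = cst al by rewrite TE big_geq // mulr1 muln0 expn0 expr1.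
  rewrite -T0 /S -(big_ltn (F := T)) // mulr_sumr rmorph_sum big_add1 /=.
  by apply: eq_bigr => i _; exact: twT.
rewrite LseriesE rmorphD /= twc; congr (_ + _).
have lim := conv_gconv (conv_tate_lim S_cauchy).
apply: gconv_uniq (gconvS (gconv_twist r lim)) _.
by apply: gconv_eq (gconvMl _ (gconvDl _ lim)) => N; rewrite twS.
Qed.

End Lseries.

(** * Independence of the weights *)

Section RootCount.
Variables (C : closedFieldType) (S : pred C).
Implicit Types (a b : {poly C}).

(** The degree of the part of the zero divisor of a supported on S, with multiplicities; being
    additive it can be applied to multiplicative relations. *)
Definition root_count a := count S (sval (closed_field_poly_normal a)).

Lemma root_countE a c s : a != 0 -> a = c *: \prod_(z <- s) ('X - z%:P) ->
  root_count a = count S s.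
Proof.
move=> a0 aE; rewrite /root_count; case: closed_field_poly_normal => s' /= aE'.
apply/permP/prod_XsubC_eq.
have cE : c = lead_coef a by rewrite aE lead_coefZ (monicP (monic_prod_XsubC _ _ _)) mulr1.
apply: (scalerI (_ : lead_coef a != 0)); first by rewrite lead_coef_eq0.
by rewrite -aE' -cE.
Qed.

Lemma root_countM a b : a != 0 -> b != 0 ->
  root_count (a * b) = (root_count a + root_count b)%N.
Proof.
move=> a0 b0; rewrite [in RHS]/root_count.
case: (closed_field_poly_normal a) => s /= aE; case: (closed_field_poly_normal b) => s' /= bE.
rewrite -count_cat; apply: (root_countE (c := lead_coef a * lead_coef b)).
  by rewrite mulf_neq0.
by rewrite big_cat /= {1}aE {1}bE -scalerAl -scalerAr scalerA.
Qed.

Lemma root_count1 : root_count 1 = 0%N.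
Proof. by rewrite (root_countE (c := 1) (s := [::])) ?oner_eq0 // big_nil scale1r. Qed.

Lemma root_countX a n : a != 0 -> root_count (a ^+ n) = (n * root_count a)%N.
Proof.
move=> a0; elim: n => [|n IH]; first by rewrite expr0 root_count1.
by rewrite exprS root_countM ?expf_neq0 // IH mulSn.
Qed.

Lemma root_count_prod (I : Type) (r : seq I) (P : pred I) (F : I -> {poly C}) :
  (forall i, P i -> F i != 0) ->
  root_count (\prod_(i <- r | P i) F i) = (\sum_(i <- r | P i) root_count (F i))%N.
Proof.
move=> F0; elim: r => [|i r IH]; first by rewrite !big_nil root_count1.
rewrite !big_cons; case: ifP => // Pi; rewrite root_countM ?IH ?F0 //.
by elim/big_ind: _ => [|x y hx hy|k /F0//]; [exact: oner_neq0|exact: mulf_neq0].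
Qed.

Lemma root_count_XsubC c : root_count ('X - c%:P) = S c.
Proof.
rewrite (root_countE (c := 1) (s := [:: c])) ?polyXsubC_eq0 //=; first by rewrite addn0.
by rewrite big_seq1 scale1r.
Qed.

End RootCount.

(** Strong induction: in the sum for j = r + 1 every other divisor is smaller and already dealt
    with. *)
Lemma divisor_sums_inj d (e e' : 'I_d -> nat) :
  (forall j, (0 < j)%N -> (\sum_(r < d | r.+1 %| j) e r = \sum_(r < d | r.+1 %| j) e' r)%N) ->
  e =1 e'.
Proof.
move=> h r; have [m] := ubnP r; elim: m r => // m IH r; rewrite ltnS => rm.
have := h r.+1 isT; rewrite (bigD1 r) // [in RHS](bigD1 r) //=.
rewrite [in RHS](eq_bigr e) => [/eqP|i /andP[ir ir']]; first by rewrite eqn_add2r => /eqP.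
apply/esym/IH; apply: leq_trans rm; rewrite ltn_neqAle ir' /= -ltnS.
exact: dvdn_leq.
Qed.

Section Characters.
Variables (R : realType) (p : nat) (X : Cinfty R p).
Local Notation C := (Cfield X).
Local Notation L := (LL X).
Local Notation th := (@theta R p X).
Implicit Types (a b : {poly C}).

Variables (l d : nat) (l0 : (0 < l)%N).
Hypothesis dvd_l : forall r, (r < d)%N -> (r.+1 %| l)%N.

(** For r dividing l, this is the multiplier a_r in twist_l Omega_r = a_r Omega_r. *)
Definition omega_factor r : {poly C} := \prod_(i < l %/ r) ('X - (Croot (r * i) th)%:P).

Lemma omega_factor_monic r : omega_factor r \is monic.
Proof. by rewrite rpred_prod // => i _; exact: monicXsubC. Qed.

(* The Frobenius orbits of theta, distinguished modulo l; 'X - Croot (r * i) th has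
   its root in orb (r * i), and orb is stable under the twist by l. *)
Let orb j x := `[< exists M N, x ^+ (p ^ (l * M + j)) = th ^+ (p ^ (l * N)) >].

Let orb_Croot j x : orb j (Croot l x) = orb j x.
Proof.
apply/asboolP/asboolP => -[M [N E]].
  exists M, N.+1; rewrite -[x in LHS](CrootK l x) -exprM mulnC exprM E.
  by rewrite -exprM mulnS [(l + _)%N]addnC expnD.
exists M.+1, N; rewrite mulnS -addnA expnD exprM CrootK.
exact: E.
Qed.

Let th_inj : injective (fun k => th ^+ (p ^ k)).
Proof.
move=> k k' /(congr1 (@Cabs R p X)); rewrite !abs_thX => /eqP.
have p1 := prime_gt1 (Cp_prime X).
rewrite -!natrX eqr_nat eqn_exp2l // eqn_exp2l // => /eqP.
exact.
Qed.

(** The powers theta^(p^k) are pairwise distinct because |theta| > 1, so lying in an orbit is a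
    congruence of exponents modulo l. *)
Let orb_th j k : orb j (Croot k th) = (k == j %[mod l]).
Proof.
have H M N : (Croot k th ^+ (p ^ (l * M + j)) = th ^+ (p ^ (l * N))) <->
    (l * M + j = l * N + k)%N.
  split=> [/(congr1 (fun x => x ^+ (p ^ k)))|E].
    rewrite -!exprM -!expnD [(_ + k)%N]addnC expnD exprM CrootK.
    exact: th_inj.
  apply: (@frobI _ _ _ k); rewrite /= -!exprM -!expnD [(_ + k)%N]addnC expnD exprM CrootK.
  by rewrite E.
apply/asboolP/eqP => [[M [N /H E]]|E].
  have := congr1 (modn^~ l) E; rewrite /= ![(l * _)%N]mulnC !modnMDl => ->.
  by [].
exists (k %/ l)%N, (j %/ l)%N; apply/H.
transitivity (l * (k %/ l) + (j %/ l * l + j %% l))%N; first by rewrite -divn_eq.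
transitivity (l * (j %/ l) + (k %/ l * l + k %% l))%N; last by rewrite -divn_eq.
by rewrite E addnCA ![(_ %/ l * l)%N]mulnC.
Qed.

(** The exponents r i with i < l/r run once through the multiples of r modulo l. *)
Let orb_omega j r : (r < d)%N -> root_count (orb j) (omega_factor r.+1) = (r.+1 %| j)%N :> nat.
Proof.
move=> rd; have /dvdnP[k lE] := dvd_l rd; have k0 : (0 < k)%N by move: l0; rewrite lE; case: k {lE}.
rewrite root_count_prod => [|i _]; last by rewrite polyXsubC_eq0.
under eq_bigr do rewrite root_count_XsubC orb_th.
have -> : (l %/ r.+1 = k)%N by rewrite lE mulnK.
have [/dvdnP[j' jE]|nj] := boolP (r.+1 %| j)%N.
  have hk : (j' %% k < k)%N by rewrite ltn_mod.
  have E i : (r.+1 * i == j %[mod l])%N = (i == j' %[mod k])%N.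
    rewrite jE lE [(j' * _)%N]mulnC [(k * _)%N]mulnC -!muln_modr eqn_pmul2l //.
  rewrite (bigD1 (Ordinal hk)) //= E modn_mod eqxx big1 // => i.
  rewrite -val_eqE /= E => /negPf; rewrite -{1}(modn_small (ltn_ord i)) => ->.
  by [].
rewrite big1 // => i _; apply/eqP; rewrite eqb0; apply: contraNN nj => /eqP E.
have rl : (r.+1 %| l)%N by exact: dvd_l.
have H m : (r.+1 %| m)%N = (r.+1 %| m %% l)%N by rewrite {1}(divn_eq m l) dvdn_addr // dvdn_mull.
by rewrite H -E -H dvdn_mulr.
Qed.

Let root_count_map j a : a != 0 ->
  root_count (orb j) (map_poly (Croot l) a) = root_count (orb j) a.
Proof.
move=> a0; rewrite [in RHS]/root_count; case: (closed_field_poly_normal a) => s /= aE.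
rewrite (@root_countE _ _ _ (Croot l (lead_coef a)) (map (Croot l) s)).
- by rewrite count_map; apply: eq_count => x /=; exact: orb_Croot.
- by rewrite map_poly_eq0.
rewrite {1}aE map_polyZ /= rmorph_prod big_map; congr (_ *: _).
by apply: eq_bigr => x _; rewrite /= map_polyXsubC.
Qed.

(** Count roots in the orbit j. The twist by l preserves the count, so y cancels and the sums of e_r
    and of e'_r over the divisors r of j agree, for every j. *)
Lemma character_independence (e e' : 'I_d -> nat) (y : L) : ratfun setT y -> y != 0 ->
  twist l y * \prod_(r < d) poly_toLL (omega_factor r.+1) ^+ e r =
  y * \prod_(r < d) poly_toLL (omega_factor r.+1) ^+ e' r -> e =1 e'.
Proof.
move=> [a [b [_ _ b0 ->]]]; rewrite mulf_eq0 invr_eq0 negb_or !poly_toLL_eq0 b0 andbT => a0.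
have prodE (f : 'I_d -> nat) : \prod_(r < d) poly_toLL (omega_factor r.+1) ^+ f r =
    poly_toLL (\prod_(r < d) omega_factor r.+1 ^+ f r).
  by rewrite rmorph_prod; apply: eq_bigr => r _; rewrite rmorphXn.
rewrite fmorph_div /= !twist_poly !prodE.
set a' := map_poly _ a; set b' := map_poly _ b; set Q := \prod_(r < d) _; set Q' := \prod_(r < d) _.
have b'0 : b' != 0 by rewrite map_poly_eq0.
have a'0 : a' != 0 by rewrite map_poly_eq0.
have Q0 (f : 'I_d -> nat) : \prod_(r < d) omega_factor r.+1 ^+ f r != 0.
  by apply/prodf_neq0 => r _; rewrite expf_neq0 // monic_neq0 // omega_factor_monic.
move=> E; have {}E : a' * Q * b = a * Q' * b'.
  apply: poly_toLL_inj; rewrite !rmorphM /=; apply/eqP.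
  rewrite -eqr_div ?poly_toLL_eq0 //; apply/eqP.
  by rewrite mulrAC E mulrAC.
apply: divisor_sums_inj => j _.
have := congr1 (root_count (orb j)) E.
rewrite !root_countM ?mulf_neq0 ?Q0 // !root_count_map // => /eqP.
rewrite eqn_add2r eqn_add2l.
have cQ (f : 'I_d -> nat) : root_count (orb j) (\prod_(r < d) omega_factor r.+1 ^+ f r) =
   (\sum_(r < d | r.+1 %| j) f r)%N.
  rewrite root_count_prod => [|r _]; last by rewrite expf_neq0 // monic_neq0 // omega_factor_monic.
  rewrite [RHS]big_mkcond; apply: eq_bigr => r _.
  rewrite root_countX ?monic_neq0 ?omega_factor_monic // orb_omega //.
  by case: (_ %| _)%N; rewrite ?muln1 ?muln0.
by rewrite !cQ => /eqP.
Qed.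

End Characters.

(** * Difference equations over the field of rational functions *)

Section FrobeniusDecomposition.
Variables (R : realType) (p : nat) (X : Cinfty R p).
Local Notation C := (Cfield X).
Local Notation L := (LL X).
Implicit Types (a b : {poly C}).
Variable k : nat.
Local Notation q := (p ^ k)%N.

Let q0 : (0 < q)%N. Proof. by rewrite expn_gt0 (prime_gt0 (Cp_prime X)). Qed.

Lemma polyC_pchar_pow : [pchar {poly C}].-nat q.
Proof. by rewrite (eq_pnat _ (@pchar_poly C)) Cpchar_pow. Qed.

Lemma coef_frobenius a i :
  (a ^+ q)`_i = if (q %| i)%N then a`_(i %/ q) ^+ q else 0.
Proof.
elim/poly_ind: a i => [|a c IH] i.
  by rewrite expr0n eqn0Ngt q0 !coef0 expr0n eqn0Ngt q0 if_same.
rewrite (exprDn_pchar _ _ polyC_pchar_pow) exprMn coefD coefMXn -polyC_exp coefC IH.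
rewrite coefD coefMX coefC; case: (ltnP i q) => iq.
  rewrite add0r divn_small //= add0r; case: eqP => [->|i0]; first by rewrite dvdn0.
  by case: ifP => // /dvdn_leq h; move: iq; rewrite ltnNge h // lt0n; exact/eqP.
have i0 : (i == 0)%N = false by apply: gtn_eqF; apply: leq_trans iq.
have di0 : (i %/ q == 0)%N = false by apply: gtn_eqF; rewrite divn_gt0.
rewrite i0 di0 !addr0 dvdn_subl //; case: ifP => // _.
by rewrite -[in RHS](subnK iq) divnDr // divnn q0 addn1.
Qed.

(** Sort the terms by their exponent modulo q and extract q-th roots of the coefficients, which
    exist in C. *)
Lemma poly_frobenius_decomp a : exists z : nat -> {poly C},
  a = \sum_(i < q) 'X^i * z i ^+ q.
Proof.
exists (fun i => \poly_(m < size a) Croot k a`_(i + q * m)).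
apply/polyP => j; rewrite coef_sum.
have hj : (j %% q < q)%N by rewrite ltn_mod.
rewrite (bigD1 (Ordinal hj)) //= big1 ?addr0 => [|i ij]; last first.
  rewrite coefXnM coef_frobenius; case: ltnP => // ile; case: ifP => // /dvdnP[m jE].
  case/eqP: ij; apply: val_inj => /=.
  by rewrite -(subnKC ile) jE addnC modnMDl modn_small.
rewrite coefXnM coef_frobenius ltnNge leq_mod /=.
have E : (j - j %% q = j %/ q * q)%N by rewrite {1}(divn_eq j q) addnK.
rewrite E dvdn_mull // mulnK // coef_poly; case: ltnP => h.
  by rewrite CrootK mulnC addnC -divn_eq.
rewrite expr0n eqn0Ngt q0 nth_default //; apply: leq_trans h _; exact: leq_div.
Qed.

(** The terms t^i z_i^q only involve exponents congruent to i modulo q, so they cannot interfere. *)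
Lemma poly_frobenius_free (z : nat -> {poly C}) :
  \sum_(i < q) 'X^i * z i ^+ q = 0 -> forall i, (i < q)%N -> z i = 0.
Proof.
move=> E i iq; apply/polyP => m; rewrite coef0.
have := congr1 (fun a : {poly C} => a`_(i + m * q)) E; rewrite coef0 coef_sum.
rewrite (bigD1 (Ordinal iq)) //= big1 ?addr0 => [|j ji]; last first.
  rewrite coefXnM coef_frobenius; case: ltnP => // jle; case: ifP => // /dvdnP[m' jE].
  case/eqP: ji; apply: val_inj => /=.
  have := congr1 (modn^~ q) (subnKC jle); rewrite jE addnC modnMDl [(i + _)%N]addnC modnMDl.
  by rewrite !modn_small.
rewrite coefXnM coef_frobenius ltnNge leq_addr /= addKn dvdn_mull // mulnK //.
by move/eqP; rewrite expf_eq0 => /andP[_ /eqP].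
Qed.

Local Notation tt := (poly_toLL 'X : L).

Lemma ratfun_frobenius_decomp (y : L) : ratfun setT y ->
  exists z : nat -> L, (forall i, ratfun setT (z i)) /\
    y = \sum_(i < q) tt ^+ i * z i ^+ q.
Proof.
move=> [a [b [_ _ b0 ->]]].
(* Since a / b = a b^(q-1) / b^q, the denominator is made a q-th power. *)
have [z zE] := poly_frobenius_decomp (a * b ^+ q.-1).
exists (fun i => poly_toLL (z i) / poly_toLL b); split=> [i|]; first by exists (z i), b.
have B0 : poly_toLL b ^+ q != 0 by rewrite expf_neq0 // poly_toLL_eq0.
apply: (mulIf B0); rewrite mulr_suml.
under eq_bigr => i _ do rewrite expr_div_n -mulrA divfK // -!rmorphXn -rmorphM.
rewrite -rmorph_sum -zE rmorphM rmorphXn -[in LHS](prednK q0) exprS mulrA divfK //.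
by rewrite poly_toLL_eq0.
Qed.

Lemma ratfun_frobenius_free (z : nat -> L) : (forall i, ratfun setT (z i)) ->
  \sum_(i < q) tt ^+ i * z i ^+ q = 0 -> forall i, (i < q)%N -> z i = 0.
Proof.
move=> zR E.
have [b b0 bP] : exists2 b, b != 0 & forall i, (i < q)%N -> exists a, z i * poly_toLL b = poly_toLL a.
  elim: (q) => [|m [b b0 bP]]; first by exists 1; rewrite ?oner_eq0.
  have [c [d [_ _ d0 zE]]] := zR m.
  exists (b * d); first by rewrite mulf_neq0.
  move=> i; rewrite ltnS leq_eqVlt => /orP[/eqP->|/bP[a aE]].
    exists (c * b); rewrite zE [b * d]mulrC !rmorphM mulrA divfK ?poly_toLL_eq0 //.
  by exists (a * d); rewrite !rmorphM mulrA aE.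
have /choice[a aP] : forall i, exists a, (i < q)%N -> z i * poly_toLL b = poly_toLL a.
  by move=> i; case: (ltnP i q) => [/bP[a aE]|_]; [exists a|exists 0].
have a0 : \sum_(i < q) 'X^i * a i ^+ q = 0.
  apply: (@poly_toLL_inj R p X); rewrite rmorph0 rmorph_sum.
  have := congr1 (fun x => x * poly_toLL b ^+ q) E; rewrite mul0r mulr_suml => E'.
  rewrite -[RHS]E'; apply: eq_bigr => i _.
  rewrite (rmorphM (@poly_toLL R p X)) !(rmorphXn (@poly_toLL R p X)) /=.
  by rewrite -(aP i (ltn_ord i)) exprMn mulrA.
move=> i iq; have /eqP := aP i iq; rewrite (poly_frobenius_free a0 iq) rmorph0.
by rewrite mulf_eq0 poly_toLL_eq0 (negPf b0) orbF => /eqP.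
Qed.

End FrobeniusDecomposition.

Local Opaque LL.

Lemma twist_Z_identity (F : fieldType) (d o x k : F) : d != 0 ->
  d * o * (k + x / d) = o * x + k * d * o.
Proof. by move=> d0; field. Qed.

Lemma tau_poly_identity (F : fieldType) (a' b' b d h : F) : b' != 0 ->
  (a' + h * b') * d * b = (a' / b' * d + h * d) * b * b'.
Proof. by move=> b'0; field. Qed.

(** * Relations fixed by the twist by r *)

Section Tau.
Variables (R : realType) (p : nat) (X : Cinfty R p).
Local Notation C := (Cfield X).
Local Notation L := (LL X).
Local Notation abs := (@Cabs R p X).
Local Notation th := (@theta R p X).
Implicit Types (a b : {poly C}) (f : tate X).

Lemma abs_Fq r c : (0 < r)%N -> Fq r c -> c != 0 -> abs c = 1.
Proof.
have p1 := prime_gt1 (Cp_prime X); move=> r0; rewrite /Fq /=.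
have pr : (1 < p ^ r)%N by rewrite -(exp1n r) ltn_exp2r.
rewrite -(prednK (ltnW pr)) exprS => E c0.
have /(congr1 abs) : c ^+ (p ^ r).-1 = 1 by apply: (mulfI c0); rewrite E mulr1.
rewrite absX abs1 => /eqP; rewrite pexpr_eq1 ?Cabs_ge0 //; first by move/eqP.
by rewrite -ltnS prednK // ltnW.
Qed.

(** theta is transcendental over the finite field: nonzero coefficients have absolute value 1 and
    |theta| > 1, so the leading term dominates. *)
Lemma coef_Fq_theta_neq0 r a : (0 < r)%N -> coefs_in (Fq r) a -> a.[th] = 0 -> a = 0.
Proof.
move=> r0 ha ath; apply/eqP; apply/negPn/negP => a0.
have [n sz] : exists n, size a = n.+1 by exists (size a).-1; rewrite prednK // size_poly_gt0.
move: ath; rewrite horner_coef sz big_ord_recr /= => /eqP; rewrite addr_eq0 => /eqP E.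
have an : a`_n != 0 by rewrite -[n]/(n.+1.-1) -sz -/(lead_coef a) lead_coef_eq0.
have lt : abs (\sum_(i < n) a`_i * th ^+ i) < p%:R ^+ n.
  apply: (abs_sum_lt (f := fun i => a`_i * th ^+ i)); first exact: rhoX_gt0.
  move=> i ilt; rewrite CabsM abs_thX; have [->|ai] := eqVneq a`_i 0.
    by rewrite abs0 mul0r rhoX_gt0.
  by rewrite (abs_Fq r0) // mul1r ltr_eXn2l // rho_gt1.
by move: lt; rewrite E absN CabsM abs_thX (abs_Fq r0) // mul1r ltxx.
Qed.

(** Invariant coefficients lie in a finite field, where nonzero elements have absolute value 1; as
    they tend to 0, almost all vanish. *)
Lemma tate_twist_fixed r f : (0 < r)%N -> tate_twist r f = f ->
  exists2 a, coefs_in (Fq r) a & f = tate_of_poly a.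
Proof.
move=> r0 ff; have fF i : Fq r (tcoef f i).
  by apply/Croot_fixed; rewrite -[in RHS]ff.
have [N hN] := tcoefP f (ltr01 : 0 < 1 :> R).
exists (\poly_(i < N) tcoef f i).
  by move=> i; rewrite coef_poly; case: ifP => // _; exact: subfield0 (Fq_subfield X r).
apply: tate_ext => i; rewrite tcoef_poly coef_poly; case: ltnP => // Ni.
apply/eqP; apply/negPn/negP => fi0; have := hN i Ni; rewrite subr0.
by rewrite (abs_Fq r0 (fF i) fi0) ltxx.
Qed.

Lemma ratfun_common_denominator (F : set C) (M : nat) (c : 'I_M -> L) :
  subfield_set F -> (forall j, ratfun F (c j)) ->
  exists b, [/\ b != 0, coefs_in F b
    & forall j, exists2 a, coefs_in F a & c j * poly_toLL b = poly_toLL a].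
Proof.
move=> hF /= hc; have /choice[ab abP] : forall j, exists ab : {poly C} * {poly C},
    [/\ coefs_in F ab.1, coefs_in F ab.2, ab.2 != 0 & c j = poly_toLL ab.1 / poly_toLL ab.2].
  by move=> j; have [a [b h]] := hc j; exists (a, b).
exists (\prod_j (ab j).2); split.
- by apply/prodf_neq0 => j _; case: (abP j).
- by apply: (coefs_in_prod hF) => j _; case: (abP j).
move=> j; exists ((ab j).1 * \prod_(i | i != j) (ab i).2).
  apply: (coefs_inM hF); first by case: (abP j).
  by apply: (coefs_in_prod hF) => i _; case: (abP i).
have [_ _ b0 ->] := abP j.
by rewrite (bigD1 j) //= !rmorphM mulrA divfK // poly_toLL_eq0.
Qed.

Variables (r n M : nat) (r0 : (0 < r)%N) (n0 : (0 < n)%N) (eta : nat -> C).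
Hypothesis etaP : eta r ^+ (p ^ r).-1 = - th.
Variable la : 'I_M -> nat.
Hypothesis laP : forall j, (la j * (p ^ r).-1 < n * p ^ r)%N.
Let al j : C := th ^+ la j.
Hypothesis indep : forall (c0 : C) (c : 'I_M -> C), Fq_theta r c0 ->
  (forall j, Fq_theta r (c j)) ->
  c0 * pi_tilde eta r ^+ n + \sum_j c j * Plog r n (al j) = 0 ->
  c0 = 0 /\ forall j, c j = 0.

Variables (Om : L) (Xs : 'I_M -> L).
Hypothesis OmE : Om = toLL (Omega eta r).
Hypothesis XsE : forall j, Xs j = toLL (Lseries (al j) r n).
Let Z j := Om ^+ n * Xs j.
Let D : {poly C} := 'X - th%:P.

Let Om0 : Om != 0.
Proof. by rewrite OmE toLL_eq0 Omega_neq0. Qed.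

Let D0 : poly_toLL D != 0 :> L.
Proof. by rewrite poly_toLL_eq0 polyXsubC_eq0. Qed.

Lemma twist_Omega : twist r Om = poly_toLL D * Om.
Proof. by rewrite OmE twist_toLL Omega_twist // rmorphM. Qed.

Lemma twist_Lseries j :
  twist r (Xs j) = poly_toLL (Croot r (al j))%:P + Xs j / poly_toLL D ^+ n.
Proof.
rewrite XsE twist_toLL (Lseries_twist X r0 (laP j)) rmorphD rmorphM; congr (_ + _).
rewrite mulrC rmorphXn rmorphV /=; last first.
  by apply: linear_unit; rewrite Cabs_theta.
by rewrite exprVn -rmorphB.
Qed.

(** Omega^n acquires the factor (t - theta)^n, which cancels the denominator in the twist of L_j.
    Hence Z_j is only translated, by a polynomial multiple of Omega^n. *)
Lemma twist_Z j : twist r (Z j) = Z j + poly_toLL ((Croot r (al j))%:P * D ^+ n) * Om ^+ n.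
Proof.
rewrite /Z rmorphM rmorphXn /= twist_Omega twist_Lseries exprMn.
have : poly_toLL D ^+ n != 0 :> L by rewrite expf_neq0.
rewrite (rmorphM (@poly_toLL R p X)) (rmorphXn (@poly_toLL R p X)) /=.
exact: twist_Z_identity.
Qed.

(* The denominator of y is fixed by the twist, so the invariant element is, up to
   a factor in F_{p^r}[t], a polynomial over F_{p^r}; its value at theta is a linear
   relation between pi_tilde ^+ n and the polylogarithms. *)
Lemma tau_relation (y : L) (c : 'I_M -> L) : ratfun setT y ->
  (forall j, ratfun (Fq r) (c j)) ->
  twist r (y * Om ^+ n + \sum_j c j * Z j) = y * Om ^+ n + \sum_j c j * Z j ->
  forall j, c j = 0.
Proof.
move=> yR cR vfix.
have [E [E0 EF caEx]] := ratfun_common_denominator (Fq_subfield X r) cR.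
have /choice[ca caP] : forall j, exists a, coefs_in (Fq r) a /\ c j * poly_toLL E = poly_toLL a.
  by move=> j; have [a] := caEx j; exists a.
have caF j := (caP j).1; have caE j := (caP j).2.
pose h := \sum_j ca j * (Croot r (al j))%:P.
have pE0 : poly_toLL E != 0 :> L by rewrite poly_toLL_eq0.
have twE : twist r (poly_toLL E) = poly_toLL E :> L.
  by apply: Fq_t_twist; exact: ratfun_poly (Fq_subfield X r) EF.
have y1R : ratfun setT (poly_toLL E * y).
  apply: (subfieldM (ratfun_subfield (setT_subfield X))) => //.
  by apply: (ratfun_poly (setT_subfield X)).
have [A [B [cop mon yE]]] := ratfun_coprime y1R.
have B0 := monic_neq0 mon; have pB0 : poly_toLL B != 0 :> L by rewrite poly_toLL_eq0.
have OmX0 := expf_neq0 n Om0.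
(* The c_j are fixed by the twist, so the terms c_j Z_j cancel and Om^n can be divided out, leaving
   an equation between rational functions. *)
have key : twist r y * poly_toLL D ^+ n + \sum_j c j * poly_toLL ((Croot r (al j))%:P * D ^+ n) = y.
  apply: (mulIf OmX0); rewrite mulrDl.
  move: vfix; rewrite rmorphD rmorphM rmorphXn /= twist_Omega rmorph_sum exprMn mulrA.
  rewrite (eq_bigr (fun j => c j * Z j + c j * poly_toLL ((Croot r (al j))%:P * D ^+ n) * Om ^+ n)); last first.
    by move=> j _; rewrite rmorphM /= twist_Z (Fq_t_twist (cR j)) mulrDr mulrA.
  by rewrite big_split /= -mulr_suml addrA addrAC => /addIr.
pose A' := map_poly (Croot r) A; pose B' := map_poly (Croot r) B.
have B'0 : B' != 0 by rewrite map_poly_eq0.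
have pol : (A' + h * B') * D ^+ n * B = A * B'.
  apply: (@poly_toLL_inj R p X).
  have key1 : twist r (poly_toLL E * y) * poly_toLL D ^+ n + poly_toLL (h * D ^+ n) = poly_toLL E * y.
    rewrite -[in RHS]key mulrDr rmorphM /= twE mulrA; congr (_ + _).
    rewrite /h mulr_suml rmorph_sum mulr_sumr; apply: eq_bigr => j _.
    by rewrite -mulrA (rmorphM (@poly_toLL R p X)) /= -caE -mulrA mulrCA.
  move: key1; rewrite yE fmorph_div /= !twist_poly -/A' -/B' => key1.
  have pB'0 : poly_toLL B' != 0 :> L by rewrite poly_toLL_eq0.
  rewrite [RHS](rmorphM (@poly_toLL R p X)) /= -[poly_toLL A](divfK pB0) -key1.
  rewrite !(rmorphM (@poly_toLL R p X)) (rmorphD (@poly_toLL R p X)) (rmorphM (@poly_toLL R p X)).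
  rewrite (rmorphXn (@poly_toLL R p X)) /=.
  exact: tau_poly_identity.
(* B is prime to A and divides A B', hence divides B'; both are monic of the same degree. *)
have BB' : B = B'.
  have mon' : B' \is monic by rewrite map_monic.
  apply/eqP; rewrite -eqp_monic // -dvdp_size_eqp ?size_map_poly //.
  have BA : coprimep B A by rewrite coprimep_sym.
  by rewrite -(Gauss_dvdpr B' BA) -pol dvdp_mulIr.
have BF : coefs_in (Fq r) B.
  by move=> i; apply/Croot_fixed; rewrite -coef_map -/B' -BB'.
(* As n > 0, the factor (t - theta)^n makes the term with A vanish at theta, so the value of V there
   involves only polylogarithms. *)
have Ath : A.[th] = 0.
  have -> : A = (A' + h * B') * D ^+ n by apply: (mulIf B0); rewrite pol -BB'.
  by rewrite hornerM horner_exp hornerXsubC subrr expr0n (gtn_eqF n0) mulr0.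
pose Omt := Omega eta r; pose Ls j := Lseries (al j) r n.
pose V : tate X := tate_of_poly A * Omt ^+ n +
  \sum_j tate_of_poly (B * ca j) * (Omt ^+ n * Ls j).
have VE : toLL V = poly_toLL (B * E) * (y * Om ^+ n + \sum_j c j * Z j).
  rewrite /V rmorphD rmorphM rmorphXn rmorph_sum mulrDr /= -OmE; congr (_ + _).
    rewrite mulrA; congr (_ * _); rewrite (rmorphM (@poly_toLL R p X)) /=.
    by rewrite -mulrA yE mulrC divfK.
  rewrite mulr_sumr; apply: eq_bigr => j _; rewrite 2!rmorphM rmorphXn /= -OmE -XsE -/(Z j) [RHS]mulrA; congr (_ * _).
  rewrite -/(poly_toLL (B * ca j)) !(rmorphM (@poly_toLL R p X)) /= -caE.
  by rewrite -mulrA [poly_toLL E * _]mulrC.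
have Vfix : tate_twist r V = V.
  apply: (@toLL_inj R p X); rewrite -twist_toLL VE rmorphM /= vfix; congr (_ * _).
  apply: Fq_t_twist; apply: (ratfun_poly (Fq_subfield X r)).
  exact: (coefs_inM (Fq_subfield X r)).
have [P PF VP] := tate_twist_fixed r0 Vfix.
pose w := pi_tilde eta r; have ind := indep; rewrite -/w in ind.
(* If pi_tilde vanished, c0 = 1 with all c_j = 0 would be a forbidden relation. *)
have w0 : w != 0.
  apply/eqP => w0; suff : (1 : C) = 0 /\ (forall j : 'I_M, (0 : C) = 0).
    by case=> /eqP; rewrite oner_eq0.
  apply: (ind 1 (fun=> 0)).
  - exact: subfield1 (Fq_theta_subfield X r).
  - by move=> _; exact: subfield0 (Fq_theta_subfield X r).
  - rewrite w0 expr0n (gtn_eqF n0) mulr0 add0r big1 // => j _; exact: mul0r.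
have Vev : hasev V (A.[th] * (- w^-1) ^+ n +
    \sum_j (B * ca j).[th] * ((- w^-1) ^+ n * Plog r n (al j))).
  have Oev : hasev (Omt ^+ n) ((- w^-1) ^+ n) by apply: hasevXn; exact: Omega_eval.
  apply: hasevD; first by apply: hasevM => //; exact: hasev_poly.
  apply: hasev_sum => j _; apply: hasevM; first exact: hasev_poly.
  by apply: hasevM => //; exact: (Lseries_eval X r0 (laP j)).
have PE : P.[th] = \sum_j (B * ca j).[th] * ((- w^-1) ^+ n * Plog r n (al j)).
  have := hasev_uniq (hasev_poly P) (_ : hasev _ _); rewrite -VP => /(_ _ Vev).
  by rewrite Ath mul0r add0r.
(* Omega takes the value -1/pi_tilde at theta, so multiplying the formula for P(theta) by
   (-pi_tilde)^n gives a relation with these coefficients. *)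
suff [_ all0] : - ((-1) ^+ n * P.[th]) = 0 /\ forall j, (B * ca j).[th] = 0.
  move=> j; have /eqP := coef_Fq_theta_neq0 r0 (coefs_inM (Fq_subfield X r) BF (caF j)) (all0 j).
  rewrite mulf_eq0 (negPf B0) /= => /eqP ca0.
  have /eqP := caE j; rewrite ca0 rmorph0 mulf_eq0 (negPf pE0) orbF => /eqP.
  exact.
apply: ind.
- have hF := Fq_theta_subfield X r.
  apply: (subfieldN hF); apply: (subfieldM hF); last exact: (adjoin_poly (Fq_subfield X r)).
  by apply: (subfieldX hF); apply: (subfieldN hF); exact: subfield1 hF.
- move=> j; apply: (adjoin_poly (Fq_subfield X r)).
  by apply: (coefs_inM (Fq_subfield X r)).
- rewrite PE mulNr; apply/eqP; rewrite addrC subr_eq0; apply/eqP.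
  rewrite mulr_sumr mulr_suml; apply: eq_bigr => j _.
  rewrite (exprNn w^-1 n).
  have sq : (-1) ^+ n * (-1) ^+ n = 1 :> C by rewrite -exprMn mulrNN mulr1 expr1n.
  have -> (u v s z : C) : s * (u * (s * z * v)) * w ^+ n = (s * s) * (z * w ^+ n) * (u * v) by ring.
  by rewrite sq mul1r -exprMn mulVf // expr1n mul1r.
Qed.

End Tau.

Lemma sigma_Z_identity (F : fieldType) (a o x b c : F) : a != 0 ->
  c * (a * o * (x / a + b)) = c * (o * x) + c * b * (a * o).
Proof. by move=> a0; field. Qed.

Lemma sigma_shift_identity (F : fieldType) (y d o k s s' y' : F) :
  y * d * o + k * o + s - (y' * o + s') = (y * d + k - y') * o + (s - s').
Proof. by ring. Qed.

Lemma pow_div_identity (F : fieldType) (y a : F) (n q : nat) :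
  (y / a ^+ n) ^+ q = y ^+ q / a ^+ (q * n).
Proof. by rewrite expr_div_n -exprM mulnC. Qed.

Lemma sum_frobenius (A : comNzRingType) (q : nat) (I : Type) (r : seq I) (P : pred I) (F : I -> A) :
  (0 < q)%N -> [pchar A].-nat q -> (\sum_(i <- r | P i) F i) ^+ q = \sum_(i <- r | P i) F i ^+ q.
Proof.
move=> q0 hq; apply: (big_morph (fun x => x ^+ q)) => [x y|]; first exact: exprDn_pchar.
by rewrite expr0n (gtn_eqF q0).
Qed.

Lemma LL_pchar (R : realType) (p : nat) (X : Cinfty R p) : p \in [pchar LL X].
Proof. by rewrite (fmorph_pchar (@poly_toLL R p X \o polyC)) Cinfty_pchar. Qed.

(** * Relations fixed by the twist by ell *)

Section Sigma.
Variables (R : realType) (p : nat) (X : Cinfty R p).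
Local Notation C := (Cfield X).
Local Notation L := (LL X).
Local Notation th := (@theta R p X).
Implicit Types (a : {poly C}) (f : tate X).

Variables (r n M l : nat) (r0 : (0 < r)%N) (n0 : (0 < n)%N) (l0 : (0 < l)%N) (eta : nat -> C).
Hypothesis etaP : eta r ^+ (p ^ r).-1 = - th.
Variable la : 'I_M -> nat.
Hypothesis laP : forall j, (la j * (p ^ r).-1 < n * p ^ r)%N.
Local Notation al j := (th ^+ la j).
Hypothesis indep : forall (c0 : C) (c : 'I_M -> C), Fq_theta r c0 ->
  (forall j, Fq_theta r (c j)) ->
  c0 * pi_tilde eta r ^+ n + \sum_j c j * Plog r n (al j) = 0 ->
  c0 = 0 /\ forall j, c j = 0.
Variables (Om : L) (Xs : 'I_M -> L).
Hypothesis OmE : Om = toLL (Omega eta r).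
Hypothesis XsE : forall j, Xs j = toLL (Lseries (al j) r n).
Hypothesis weight_free : forall y : L, ratfun setT y ->
  twist l (y * Om ^+ n) = y * Om ^+ n -> y = 0.

Let D : L := poly_toLL ('X - th%:P).
Let kap j : L := poly_toLL ((Croot r (al j))%:P * ('X - th%:P) ^+ n).
Let RT := ratfun_subfield (setT_subfield X).

(* If some c j is 1, subtracting the relation from its twist by r gives one with
   fewer nonzero coefficients, so a minimal relation is fixed by that twist. *)
Lemma sigma_relation (y : L) (c : 'I_M -> L) : ratfun setT y ->
  (forall j, ratfun (Fq l) (c j)) ->
  twist l (y * Om ^+ n + \sum_j c j * (Om ^+ n * Xs j)) =
    y * Om ^+ n + \sum_j c j * (Om ^+ n * Xs j) ->
  forall j, c j = 0.
Proof.
have FT := @ratfunS R p X (Fq l) setT (@subsetT _ _).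
have [m] := ubnP #|[pred j | c j != 0]|; elim: m c y => // m IH c y; rewrite ltnS => cm yR cR vfix.
suff : ~ exists j, c j != 0.
  by move=> /forallNP h j; apply/eqP/negPn/negP; exact: h.
case=> j0 cj0.
have RF := ratfun_subfield (Fq_subfield X l).
pose d := (c j0)^-1; have dF : ratfun (Fq l) d by apply: (subfieldV RF); exact: cR.
pose c1 j := c j * d; pose y1 := y * d.
have c1F j : ratfun (Fq l) (c1 j) by apply: (subfieldM RF).
have y1R : ratfun setT y1 by apply: (subfieldM RT) => //; exact: FT.
pose Z j := Om ^+ n * Xs j.
pose v1 := y1 * Om ^+ n + \sum_j c1 j * Z j.
have v1E : v1 = (y * Om ^+ n + \sum_j c j * Z j) * d.
  rewrite mulrDl /v1 /y1 mulrAC mulr_suml; congr (_ + _).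
  by apply: eq_bigr => j _; rewrite /c1 mulrAC.
have v1fix : twist l v1 = v1.
  by rewrite v1E rmorphM /= vfix (Fq_t_twist dF).
pose y2 := twist r y1 * D ^+ n + \sum_j twist r (c1 j) * kap j - y1.
pose c2 j := twist r (c1 j) - c1 j.
have tauv : twist r v1 = twist r y1 * D ^+ n * Om ^+ n +
    (\sum_j twist r (c1 j) * kap j) * Om ^+ n + \sum_j twist r (c1 j) * Z j.
  rewrite /v1 rmorphD rmorphM rmorphXn rmorph_sum /= (twist_Omega r0 etaP OmE) exprMn mulrA -addrA.
  congr (_ + _); rewrite mulr_suml -big_split; apply: eq_bigr => j _.
  by rewrite rmorphM /= (twist_Z r0 etaP laP OmE XsE) mulrDr -/(Z j) addrC mulrA.
have w2E : twist r v1 - v1 = y2 * Om ^+ n + \sum_j c2 j * Z j.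
  have -> : \sum_j c2 j * Z j = \sum_j twist r (c1 j) * Z j - \sum_j c1 j * Z j.
    by rewrite -sumrB; apply: eq_bigr => i _; rewrite mulrBl.
  rewrite tauv /v1 /y2; exact: sigma_shift_identity.
have twC x : twist l (twist r x) = twist r (twist l x) :> L by rewrite -!twistD addnC.
have RFr j : ratfun (Fq l) (twist r (c1 j)).
  by apply: ratfun_twist (c1F j) => x /Croot_fixed E; apply/Croot_fixed; rewrite -!CrootD addnC CrootD E.
have c2F j : ratfun (Fq l) (c2 j) by apply: (subfieldB RF).
have twT (x : L) : ratfun setT x -> ratfun setT (twist r x) by exact: ratfun_twist.
have y2R : ratfun setT y2.
  apply: (subfieldB RT) => //; apply: (subfieldD RT).
    apply: (subfieldM RT); first exact: twT.
    by apply: (subfieldX RT); exact: ratfun_poly (setT_subfield X) _.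
  apply: (subfield_sum RT) => j _; apply: (subfieldM RT); first by apply: FT.
  exact: ratfun_poly (setT_subfield X) _.
have w2fix : twist l (y2 * Om ^+ n + \sum_j c2 j * Z j) = y2 * Om ^+ n + \sum_j c2 j * Z j.
  by rewrite -w2E rmorphB /= twC v1fix.
have c2j0 : c2 j0 = 0 by rewrite /c2 /c1 /d divff // rmorph1 subrr.
have c20 : forall j, c2 j = 0.
  apply: (IH c2 y2) => //; apply: leq_trans cm; apply: proper_card; apply/properP; split.
    apply/fintype.subsetP => j; rewrite !inE /c2 /c1; apply: contraNneq => ->.
    by rewrite mul0r rmorph0 subrr.
  by exists j0; rewrite !inE ?c2j0 ?eqxx.
(* With all c2 zero, y2 Om^n alone is invariant, which [weight_free] excludes unless y2 = 0. *)
have y20 : y2 = 0.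
  apply: weight_free => //; move: w2fix; rewrite big1 ?addr0 // => j _.
  by rewrite c20 mul0r.
have v1tau : twist r v1 = v1.
  apply/eqP; rewrite -subr_eq0 w2E y20 mul0r add0r big1 // => j _.
  by rewrite c20 mul0r.
(* Invariance under the twist by r puts the coefficients in F_{p^r}(t), so [tau_relation] applies
   and contradicts c1 j0 = 1. *)
have c1r j : ratfun (Fq r) (c1 j).
  apply: ratfun_twist_fixed; first exact: FT.
  by apply/eqP; rewrite -subr_eq0; apply/eqP; exact: c20.
have := tau_relation r0 n0 etaP laP indep OmE XsE y1R c1r v1tau j0.
by rewrite /c1 /d divff // => /eqP; rewrite oner_eq0.
Qed.

Variables (a : L) (b : 'I_M -> L).
Hypothesis a0 : a != 0.
Hypothesis aR : ratfun setT a.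
Hypothesis bR : forall j, ratfun setT (b j).
Hypothesis sOm : twist l Om = a * Om.
Hypothesis sXs : forall j, twist l (Xs j) = Xs j / a ^+ n + b j.

(* C(t) is free over its p^k-th powers, with basis 1, t, .., t^(p^k - 1). *)
Lemma sigma_relation_pow k (y : L) (c : 'I_M -> L) : ratfun setT y ->
  (forall j, ratfun (Fq l) (c j)) ->
  twist l y + \sum_j c j * b j ^+ (p ^ k) = y / a ^+ (p ^ k * n) ->
  forall j, c j = 0.
Proof.
move=> yR cR E.
have FT := @ratfunS R p X (Fq l) setT (@subsetT _ _).
set q := (p ^ k)%N in E *.
have q0 : (0 < q)%N by rewrite expn_gt0 (prime_gt0 (Cp_prime X)).
have chL : [pchar L].-nat q by rewrite /q pnatX pnatE ?(Cp_prime X) // LL_pchar.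
have [yi [yiR yiE]] := ratfun_frobenius_decomp k yR.
have /choice[ci ciP] : forall j, exists z : nat -> L, (forall i, ratfun setT (z i)) /\
    c j = \sum_(i < q) poly_toLL 'X ^+ i * z i ^+ q.
  by move=> j; exact: ratfun_frobenius_decomp (FT _ (cR j)).
have twt i : twist l (poly_toLL 'X ^+ i) = poly_toLL 'X ^+ i :> L.
  by rewrite rmorphXn /= twist_poly map_polyX.
have twdec (z : nat -> L) : twist l (\sum_(i < q) poly_toLL 'X ^+ i * z i ^+ q) =
    \sum_(i < q) poly_toLL 'X ^+ i * (twist l (z i)) ^+ q.
  rewrite rmorph_sum; apply: eq_bigr => i _; rewrite rmorphM /= twt.
  by congr (_ * _); exact: rmorphXn.
have twT (x : L) : ratfun setT x -> ratfun setT (twist l x) by exact: ratfun_twist.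
have exprB (u v : L) : (u - v) ^+ q = u ^+ q - v ^+ q.
  by rewrite exprDn_pchar // exprNn_pchar.
have free (z : nat -> L) : (forall i, ratfun setT (z i)) ->
    \sum_(i < q) poly_toLL 'X ^+ i * z i ^+ q = 0 -> forall i, (i < q)%N -> z i = 0.
  exact: (@ratfun_frobenius_free R p X k).
pose X1 : L := poly_toLL 'X.
(* The twist fixes t, so by uniqueness of the coordinates an invariant c_j has invariant
   coordinates. *)
have cfix j i : (i < q)%N -> twist l (ci j i) = ci j i.
  move=> iq; have [ciR cE] := ciP j; apply/eqP; rewrite -subr_eq0; apply/eqP.
  apply: (free (fun i => twist l (ci j i) - ci j i)) iq => [i'|].
    by apply: (subfieldB RT) => //; exact: twT.
  have := Fq_t_twist (cR j); rewrite {1}cE twdec cE => /eqP; rewrite -subr_eq0 -sumrB => /eqP E'.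
  rewrite -[RHS]E'; apply: eq_bigr => i' _.
  rewrite -mulrBr; congr (_ * _).
  exact: exprB.
(* The t^i-component of the equation is the q-th power of an equation of the same form with k =
   0. *)
have zE i : (i < q)%N -> twist l (yi i) + \sum_j ci j i * b j = yi i / a ^+ n.
  move=> iq; apply/eqP; rewrite -subr_eq0; apply/eqP.
  apply: (free (fun i => twist l (yi i) + \sum_j ci j i * b j - yi i / a ^+ n)) iq => [i'|].
    apply: (subfieldB RT); last first.
      by apply: (subfield_div RT) => //; apply: (subfieldX RT).
    apply: (subfieldD RT); first exact: twT.
    by apply: (subfield_sum RT) => j _; apply: (subfieldM RT) => //; case: (ciP j).
  have : twist l y + \sum_j c j * b j ^+ q - y / a ^+ (q * n) = 0 by rewrite E subrr.
  rewrite yiE twdec mulr_suml => E'; rewrite -[RHS]E'.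
  have -> : \sum_j c j * b j ^+ q = \sum_(i < q) X1 ^+ i * \sum_j (ci j i * b j) ^+ q.
    rewrite (eq_bigr (fun j => \sum_(i < q) X1 ^+ i * (ci j i * b j) ^+ q)).
      by rewrite exchange_big; apply: eq_bigr => i' _; rewrite mulr_sumr.
    move=> j _; rewrite {1}(ciP j).2 mulr_suml; apply: eq_bigr => i' _.
    by rewrite exprMn mulrA.
  rewrite -big_split -sumrB; apply: eq_bigr => i' _ /=.
  rewrite -mulrDr -mulrA -mulrBr; congr (_ * _).
  by rewrite exprB exprDn_pchar // (sum_frobenius _ _ _ q0 chL) pow_div_identity.
have OmX0 : a ^+ n != 0 by exact: expf_neq0.
move=> j; rewrite (ciP j).2 big1 // => i _.
suff -> : ci j i = 0 by rewrite expr0n (gtn_eqF q0) mulr0.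
have ciF j' : ratfun (Fq l) (ci j' i).
  by apply: ratfun_twist_fixed; [case: (ciP j')|exact: cfix].
apply: (sigma_relation (y := yi i) (c := fun j => ci j i)) => //.
rewrite rmorphD rmorphM rmorphXn rmorph_sum /= sOm.
have -> : \sum_j twist l (ci j i * (Om ^+ n * Xs j)) =
    \sum_j ci j i * (Om ^+ n * Xs j) + (\sum_j ci j i * b j) * (a ^+ n * Om ^+ n).
  rewrite mulr_suml -big_split; apply: eq_bigr => j' _ /=.
  rewrite rmorphM rmorphM rmorphXn /= sOm sXs (cfix j' i (ltn_ord i)) exprMn.
  exact: sigma_Z_identity.
rewrite exprMn addrA addrAC [in RHS]addrC [LHS]addrC; congr (_ + _).
by rewrite -mulrDl zE // mulrA divfK.
Qed.

End Sigma.

Section Restriction.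
Variables (L : fieldType) (F : set L) (hF : subfield_set F) (S : {rmorphism L -> L}).
Hypothesis SF : forall x, F x -> F (S x).

Definition sf_restrict (x : subfield_type hF) : subfield_type hF := sf_in hF (SF (sf_valF x)).

Lemma sf_restrict_zmod_morphism : zmod_morphism sf_restrict.
Proof. move=> x y; apply: sf_val_inj; rewrite [RHS]rmorphB.
exact: (etrans (congr1 S (rmorphB (@sf_val _ _ hF) x y)) (rmorphB S _ _)). Qed.
Lemma sf_restrict_monoid_morphism : monoid_morphism sf_restrict.
Proof.
split=> [|x y]; apply: sf_val_inj.
  by rewrite [RHS]rmorph1; exact: (etrans (congr1 S (rmorph1 (@sf_val _ _ hF))) (rmorph1 S)).
rewrite [RHS]rmorphM.
exact: (etrans (congr1 S (rmorphM (@sf_val _ _ hF) x y)) (rmorphM S _ _)).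
Qed.
HB.instance Definition _ := GRing.isZmodMorphism.Build _ _ sf_restrict sf_restrict_zmod_morphism.
HB.instance Definition _ := GRing.isMonoidMorphism.Build _ _ sf_restrict sf_restrict_monoid_morphism.
End Restriction.

(** * Iterated twists of Omega_r and of the L-series *)

Lemma Lseries_step_identity (F : fieldType) (u x a b d n : F) :
  u + (x / a + b) / d = x / (a * d) + (u + b / d).
Proof. by rewrite mulrDl -mulrA -invfM addrCA. Qed.

Section IteratedTwist.
Variables (R : realType) (p : nat) (X : Cinfty R p).
Local Notation C := (Cfield X).
Local Notation L := (LL X).
Local Notation th := (@theta R p X).
Variables (r : nat) (r0 : (0 < r)%N) (eta : nat -> C).
Hypothesis etaP : eta r ^+ (p ^ r).-1 = - th.

Let lin (i : nat) : {poly C} := 'X - (Croot (r * i) th)%:P.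
Let prd (i : nat) : {poly C} := \prod_(k < i) lin k.

Lemma lin_kbar i : coefs_in kbar (lin i).
Proof. by apply/(coefs_in_linear (kbar_subfield X))/kbar_Croot; exact: kbar_theta. Qed.

Lemma twist_linear i : twist (r * i) (poly_toLL ('X - th%:P)) = poly_toLL (lin i) :> L.
Proof. by rewrite twist_poly rmorphB /= map_polyX map_polyC. Qed.

Lemma twist_iter_Omega i :
  twist (r * i) (toLL (Omega eta r)) = poly_toLL (prd i) * toLL (Omega eta r).
Proof.
elim: i => [|i IH]; first by rewrite muln0 twist0 /prd big_ord0 rmorph1 mul1r.
rewrite mulnS addnC twistD (twist_Omega r0 etaP erefl) rmorphM /= IH twist_linear.
rewrite /prd big_ord_recr (rmorphM (@poly_toLL R p X)) /=.
by rewrite mulrCA mulrA.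
Qed.

Variables (n la : nat).
Hypothesis laP : (la * (p ^ r).-1 < n * p ^ r)%N.
Let al : C := th ^+ la.

Lemma twist_iter_Lseries i : exists2 b : L, kbar_t b &
  twist (r * i) (toLL (Lseries al r n)) = toLL (Lseries al r n) / poly_toLL (prd i) ^+ n + b.
Proof.
have hK := ratfun_subfield (@kbar_subfield R p X).
elim: i => [|i [b bK IH]].
  exists 0; first exact: (subfield0 hK).
  by rewrite muln0 twist0 /prd big_ord0 rmorph1 expr1n divr1 addr0.
have XE : forall j : 'I_1, toLL (Lseries al r n) = toLL (Lseries (th ^+ (fun=> la) j) r n) by [].
have := @twist_Lseries R p X r n 1 r0 (fun=> la) (fun=> laP) (fun=> toLL (Lseries al r n)) XE ord0.
rewrite -/al => step.
exists (poly_toLL (map_poly (Croot (r * i)) (Croot r al)%:P) + b / poly_toLL (lin i) ^+ n).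
  apply: (subfieldD hK).
    apply: (ratfun_poly (kbar_subfield X)); rewrite map_polyC.
    apply: (coefs_inC (kbar_subfield X)); do 2!apply: kbar_Croot.
    apply: (subfieldX (kbar_subfield X)); exact: kbar_theta.
  apply: (subfield_div hK) => //; apply: (subfieldX hK).
  by apply: (ratfun_poly (kbar_subfield X)); exact: lin_kbar.
rewrite mulnS addnC twistD step rmorphD fmorph_div rmorphXn /= IH twist_linear twist_poly.
rewrite /prd big_ord_recr (rmorphM (@poly_toLL R p X)) /= exprMn.
exact: Lseries_step_identity.
Qed.

End IteratedTwist.

Lemma big_inj_support (V : nmodType) (I J : finType) (g : J -> I) (F : I -> V) :
  injective g -> (forall i, F i != 0 -> exists j, i = g j) ->
  \sum_i F i = \sum_j F (g j).
Proof.
move=> gI hF; rewrite (bigID (mem (g @: predT))) /= addrC big1 ?add0r.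
  by rewrite big_imset //= => x y _ _; exact: gI.
move=> i /negP hi; apply/eqP/negPn/negP => /hF[j ij]; apply: hi.
by rewrite ij; apply/imsetP; exists j.
Qed.

(** * Algebraic independence over kbar(t) *)

Section Independence.
Variables (R : realType) (p : nat) (X : Cinfty R p).
Local Notation C := (Cfield X).
Local Notation L := (LL X).
Local Notation th := (@theta R p X).

Variables (d l : nat) (l0 : (0 < l)%N) (dvd_l : forall r, (r < d)%N -> (r.+1 %| l)%N).
Variable eta : nat -> C.
Hypothesis etaP : forall r, (0 < r)%N -> eta r ^+ (p ^ r).-1 = - th.
Variables (U : 'I_d -> nat) (N M : forall i, 'I_(U i) -> nat).
Variable la : forall i (k : 'I_(U i)), 'I_(M k) -> nat.
Hypothesis N_gt0 : forall i (k : 'I_(U i)), (0 < N k)%N.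
Hypothesis N_inj : forall i, injective (@N i).
Hypothesis N_p : forall i (k : 'I_(U i)), ~~ (p %| N k)%N.
Hypothesis laP : forall i (k : 'I_(U i)) j, (@la i k j * (p ^ i.+1).-1 < N k * p ^ i.+1)%N.
(** The guard 0 < M k accommodates p = 2, r = 1, where there are no L-series and no basis is
    given. *)
Hypothesis indep : forall i (k : 'I_(U i)) (c0 : C) (c : 'I_(M k) -> C), (0 < M k)%N ->
  Fq_theta i.+1 c0 -> (forall j, Fq_theta i.+1 (c j)) ->
  c0 * pi_tilde eta i.+1 ^+ N k + \sum_j c j * Plog i.+1 (N k) (th ^+ la j) = 0 ->
  c0 = 0 /\ forall j, c j = 0.

Local Notation gens := ('I_d + {i : 'I_d & {k : 'I_(U i) & 'I_(M k)}})%type.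

Definition gen_val (g : gens) : L :=
  match g with
  | inl i => toLL (Omega eta i.+1)
  | inr t => toLL (Lseries (th ^+ la (tagged (tagged t))) (tag t).+1 (N (tag (tagged t))))
  end.

Let hK := ratfun_subfield (kbar_subfield X).
Let K : fieldType := subfield_type hK.
Let iota : {rmorphism K -> L} := @sf_val _ _ hK.
Let a_val (r : 'I_d) : L := poly_toLL (omega_factor X l r.+1).

Let kbar_t_ratfun (x : L) : kbar_t x -> ratfun setT x.
Proof. exact: (ratfunS (@subsetT _ _)). Qed.

Let a_valK r : kbar_t (a_val r).
Proof.
apply: (ratfun_poly (kbar_subfield X)); apply: (coefs_in_prod (kbar_subfield X)) => i _.
exact: lin_kbar.
Qed.

Let a_val0 r : a_val r != 0.
Proof. by rewrite poly_toLL_eq0 monic_neq0 // omega_factor_monic. Qed.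

Let twist_om (r : 'I_d) : twist l (toLL (Omega eta r.+1)) = a_val r * toLL (Omega eta r.+1).
Proof.
have := twist_iter_Omega (ltn0Sn r) (etaP (ltn0Sn r)) (l %/ r.+1).
by rewrite mulnC divnK // dvd_l.
Qed.

Let gen_weight (g : gens) : L :=
  match g with
  | inl i => a_val i
  | inr t => (a_val (tag t) ^+ N (tag (tagged t)))^-1
  end.

Let twist_gen (g : gens) : exists b : K,
  twist l (gen_val g) = gen_weight g * gen_val g + iota b /\
  (if g is inl _ then b = 0 else True).
Proof.
case: g => [i|[i [k j]]] /=.
  by exists 0; split=> //; rewrite rmorph0 addr0; exact: twist_om.
have [b bK E] := twist_iter_Lseries X (ltn0Sn i) (laP j) (l %/ i.+1).
exists (sf_in hK bK); split=> //; move: E.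
by rewrite mulnC divnK ?dvd_l // => ->; rewrite mulrC.
Qed.

(** The equation reads twist_l(y) a_r^n = y, which [character_independence] forbids for y nonzero
    and n > 0. *)
Let weight_free (r : 'I_d) n (y : L) : (0 < n)%N -> ratfun setT y ->
  twist l (y * toLL (Omega eta r.+1) ^+ n) = y * toLL (Omega eta r.+1) ^+ n -> y = 0.
Proof.
move=> n0 yR; rewrite rmorphM rmorphXn /= twist_om exprMn mulrA => E.
have Om0 : toLL (Omega eta r.+1) != 0 :> L by rewrite toLL_eq0 (Omega_neq0 (ltn0Sn r) (etaP (ltn0Sn r))).
have OmX0 := expf_neq0 n Om0.
have {}E := mulIf OmX0 E; apply/eqP/negPn/negP => y0.
have := @character_independence R p X l d l0 dvd_l
  (fun i => if i == r then n else 0%N) (fun=> 0%N) y yR y0.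
rewrite [X in _ = _ * X -> _]big1 ?mulr1; last by move=> i _; exact: expr0.
rewrite (bigD1 r) //= eqxx big1 ?mulr1; last first.
  by move=> i /negPf ->; exact: expr0.
by move=> /(_ E r); rewrite eqxx => nE; rewrite nE in n0.
Qed.

Let twistK (x : L) : kbar_t x -> kbar_t (twist l x).
Proof. by apply: ratfun_twist => c; exact: kbar_Croot. Qed.

(** An instance of [difference_alg_independent]: H1 is [character_independence], and H2 is
    [sigma_relation_pow] for the one block that carries the coefficients. *)
Lemma gen_val_alg_free (P : mpoly #|{: gens}| K) :
  mmap (S := L) iota (fun v => gen_val (enum_val v)) P = 0 -> P = 0.
Proof.
have /choice[b bP] := twist_gen.
pose isX : pred 'I_#|{: gens}| := fun v => if enum_val v is inr _ then true else false.
pose rr (v : 'I_#|{: gens}|) := match enum_val v with inl i => i | inr t => tag t end.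
pose nn (v : 'I_#|{: gens}|) := match enum_val v with inl i => 0%N | inr t => N (tag (tagged t)) end.
pose a r : K := sf_in hK (a_valK r).
have chK : p \in [pchar K] by rewrite -(fmorph_pchar iota) LL_pchar.
apply: (@difference_alg_independent K L p (Cp_prime X) chK iota
  (sf_restrict twistK) (@twist R p X l) _ 'I_d a _ _ isX rr nn (fun v => b (enum_val v))).
- by [].
- by move=> r; rewrite -(fmorph_eq0 iota); exact: a_val0.
- move=> v; rewrite /isX; case: (enum_val v) (bP (enum_val v)) => // i [] //.
- by move=> v; rewrite /isX /nn /=; case: (enum_val v).
- move=> v w; rewrite /isX /rr /= => hv hw E; apply: enum_val_inj.
  by move: hv hw E; case: (enum_val v) => // i; case: (enum_val w) => // i' _ _ ->.
- move=> v; apply: (etrans (proj1 (bP (enum_val v)))); congr (_ * _ + _).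
  rewrite /isX /rr /nn /=; case: (enum_val v) => [i|t] //=.
  by rewrite -[in LHS](rmorphXn iota (N (tag (tagged t))) (a (tag t))) -fmorphV.
- move=> v; rewrite /isX /=; case: (enum_val v) => // i _.
  by rewrite toLL_eq0 (Omega_neq0 (ltn0Sn i) (etaP (ltn0Sn i))).
- move=> e e' y y0 E; apply: (@character_independence R p X l d l0 dvd_l e e' (iota y)).
  + exact: kbar_t_ratfun (sf_valF y).
  + by rewrite fmorph_eq0.
  + have := congr1 iota E; rewrite !rmorphM !rmorph_prod /= => E'.
    have pE (f : 'I_d -> nat) : \prod_(r < d) poly_toLL (omega_factor X l r.+1) ^+ f r = \prod_i iota (a i ^+ f i).
      by apply: eq_bigr => r _; rewrite rmorphXn.
    by rewrite !pE.
move=> r n k c y cfix csupp E v; apply/eqP/negPn/negP => cv0.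
have [vX vr vn] := csupp v cv0.
case vE : (enum_val v) => [//|[i [k0 j0]]]; first by move: vX; rewrite /isX vE.
move: vr vn; rewrite /rr /nn vE /= => ri nN; rewrite -ri -nN in csupp E => {r ri n nN}.
(* Lists the variables of the block of v. Since N is injective for fixed r, the support of c lies in
   this block. *)
pose g (j : 'I_(M k0)) : 'I_#|{: gens}| := enum_rank (inr (Tagged (fun i => {k : 'I_(U i) & 'I_(M k)}) (Tagged (fun k : 'I_(U i) => 'I_(M k)) j)) : gens).
have gI : injective g.
  move=> j j' /enum_rank_inj [] /eqP; rewrite eq_Tagged /= => /eqP/eqP.
  by rewrite eq_Tagged /= => /eqP.
have supp w : c w != 0 -> exists j, w = g j.
  move=> cw; have [] := csupp w cw; rewrite /isX /rr /nn.
  case wE : (enum_val w) => [//|[i' [k' j']]] _ /= ii; subst i'.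
  move=> /N_inj kk; subst k'.
  by exists j'; rewrite /g -wE enum_valK.
have vg : v = g j0 by rewrite /g -vE enum_valK.
suff : forall j, iota (c (g j)) = 0.
  by move=> /(_ j0) /eqP; rewrite fmorph_eq0 -vg (negPf cv0).
refine (@sigma_relation_pow R p X i.+1 (N k0) (M k0) l (ltn0Sn i) (N_gt0 k0) eta (etaP (ltn0Sn i))
  (@la i k0) (@laP i k0) (fun c0 c => @indep i k0 c0 c (leq_ltn_trans (leq0n j0) (ltn_ord j0))) (toLL (Omega eta i.+1))
  (fun j => toLL (Lseries (th ^+ la j) i.+1 (N k0))) erefl (fun j => erefl) _ (a_val i)
  (fun j => iota (b (enum_val (g j)))) (a_val0 i) _ _ (twist_om i) _ k (iota y)
  (fun j => iota (c (g j))) _ _ _).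
- by move=> z zR; exact: weight_free.
- exact: kbar_t_ratfun (a_valK i).
- by move=> j; exact: kbar_t_ratfun (sf_valF _).
- move=> j; have [] := bP (enum_val (g j)); rewrite /g enum_rankK /= => -> _.
  by rewrite mulrC.
- exact: kbar_t_ratfun (sf_valF y).
- move=> j; apply: ratfun_twist_fixed; first exact: kbar_t_ratfun (sf_valF _).
  exact: (congr1 iota (cfix (g j))).
have := congr1 iota E; rewrite rmorphD fmorph_div rmorphXn /= rmorph_sum => E'.
rewrite -[in RHS]E' /=; congr (_ + _).
rewrite (big_inj_support gI) /=.
  by apply: eq_bigr => j _; rewrite rmorphXn.
move=> w; rewrite mulf_eq0 fmorph_eq0 negb_or => /andP[cw _]; exact: supp.
Qed.

End Independence.

(** * Independence in the tensor square *)

Section BaseChange.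
Variables (L : fieldType) (K : set L) (hK : subfield_set K).
Local Notation KT := (subfield_type hK).
Variables (n : nat) (x : 'I_n -> L).
Hypothesis x_free : forall P : {mpoly KT[n]}, mmap (@sf_val _ _ hK) x P = 0 -> P = 0.

(** The monomials in x are linearly independent over K, so [tens_left_free] makes their images 1 (x)
    x^m independent over L (x) 1. *)
Lemma tens_alg_free (P : {mpoly L[n]}) :
  mmap (tinl K) (fun v => tinr K (x v)) P = 0 -> P = 0.
Proof.
pose k := msize P; pose I : finType := 'X_{1..n < k}.
rewrite (mmapE k) // => E.
apply/mpolyP => m; rewrite mcoeff0.
have [mk|mk] := boolP (mdeg m < k)%N; last first.
  by apply: memN_msupp_eq0; apply: contra mk => /msize_mdeg_lt.
have := @tens_left_free L K (subfield0 hK) (subfield1 hK) (subfieldN hK) (subfieldD hK)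
  (subfieldM hK) (subfieldV hK) I (fun m => mmap1 x m) (fun m => P@_m) _ _ (BMultinom mk).
apply.
  move=> c cK E' i.
  pose Q : {mpoly KT[n]} := \sum_(m : I) sf_in hK (cK m) *: 'X_[m].
  have Q0 : Q = 0.
    apply: x_free; rewrite -[RHS]E' /Q raddf_sum /=; apply: eq_bigr => m' _.
    by rewrite mmapZ /= mmapX.
  have := congr1 (fun Q : {mpoly KT[n]} => Q@_i) Q0; rewrite mcoeff0 /Q raddf_sum /=.
  rewrite (bigD1 i) //= big1 ?addr0 => [|j ji].
    by rewrite mcoeffZ mcoeffX eqxx mulr1 => /(congr1 (@sf_val _ _ hK)).
  by rewrite mcoeffZ mcoeffX -[bmnm j == bmnm i]/(j == i) (negPf ji) mulr0.
rewrite -[RHS]E; apply: eq_bigr => m' _; congr (_ * _).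
by rewrite /mmap1 rmorph_prod; apply: eq_bigr => v _; rewrite rmorphXn.
Qed.

End BaseChange.

Section ChangeOfVariables.
Variables (L : fieldType) (K F : set L) (hF : subfield_set F).
Variables (I B : finType) (Om : I -> L) (Xs : B -> L) (ri : B -> I) (N : B -> nat).
Local Notation T := (I + B)%type.
Local Notation n := #|{: I + B}|.
Hypothesis Om0 : forall i, Om i != 0.
Hypothesis free : forall P : {mpoly L[n]},
  mmap (tinl K) (fun v => tinr K (match enum_val v with inl i => Om i | inr t => Xs t end)) P = 0 ->
  P = 0.

Definition gen_tens (g : T) : tens K :=
  match g with
  | inl i => tinl K (Om i)^-1 * tinr K (Om i)
  | inr t => tinr K (Om (ri t) ^+ N t) * (tinr K (Xs t) - tinl K (Xs t))
  end.

Definition gen_eval : {mpoly (subfield_type hF)[n]} -> tens K :=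
  mmap (tinl K \o @sf_val _ _ hF) (fun v => gen_tens (enum_val v)).

HB.instance Definition _ := GRing.RMorphism.copy gen_eval gen_eval.

Lemma gen_evalC c : gen_eval c%:MP = tinl K (sf_val c).
Proof. by rewrite /gen_eval mmapC. Qed.

Lemma gen_evalX g : gen_eval 'X_(enum_rank g) = gen_tens g.
Proof. by rewrite /gen_eval mmapX mmap1U enum_rankK. Qed.

Let vX (g : T) : {mpoly L[n]} := 'X_(enum_rank g).
(** The entries [gen_tens] written as polynomials in the independent elements 1 (x) Omega and 1 (x)
    L, with coefficients in L (x) 1. *)
Let gen_poly (g : T) : {mpoly L[n]} :=
  match g with
  | inl i => (Om i)^-1 *: vX (inl i)
  | inr t => vX (inl (ri t)) ^+ N t * (vX (inr t) - (Xs t)%:MP)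
  end.
Let chi : {rmorphism {mpoly (subfield_type hF)[n]} -> {mpoly L[n]}} :=
  mmap (@mpolyC n L \o @sf_val _ _ hF) (fun v => gen_poly (enum_val v)).

Let psi : {rmorphism {mpoly L[n]} -> tens K} :=
  mmap (tinl K) (fun v => tinr K (match enum_val v with inl i => Om i | inr t => Xs t end)).

Let gen_evalE G : gen_eval G = psi (chi G).
Proof.
rewrite -[RHS]/((psi \o chi) G); apply: mpoly_rmorph_ext => [c|v].
  by rewrite [LHS]gen_evalC /= /chi /psi !mmapC.
rewrite -(enum_valK v) [LHS]gen_evalX /= /chi /psi !mmapX !mmap1U enum_rankK.
case: (enum_val v) => [i|t]; rewrite /gen_tens /gen_poly /vX.
  by rewrite mmapZ mmapX mmap1U enum_rankK.
rewrite rmorphM rmorphXn rmorphB /= !mmapX !mmap1U mmapC !enum_rankK.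
by rewrite rmorphXn.
Qed.

Let Q := {fraction {mpoly L[n]}}.
Let toQ : {rmorphism {mpoly L[n]} -> Q} := @FracField.tofrac {mpoly L[n]}.
Let toQ_inj P : toQ P = 0 -> P = 0.
Proof. by move/eqP; rewrite tofrac_eq0 => /eqP. Qed.

(** The inverse of the substitution [gen_poly]. It is triangular, and division by powers of Omega
    takes it into the fraction field. *)
Let back_val (g : T) : Q :=
  match g with
  | inl i => toQ (Om i)%:MP * toQ (vX (inl i))
  | inr t => toQ (Xs t)%:MP + toQ (vX (inr t)) / (toQ (Om (ri t))%:MP * toQ (vX (inl (ri t)))) ^+ N t
  end.
Let back : {rmorphism {mpoly L[n]} -> Q} :=
  mmap (toQ \o @mpolyC n L) (fun v => back_val (enum_val v)).

Let backE G : back (chi G) = toQ (map_mpoly (@sf_val _ _ hF) G).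
Proof.
rewrite -[LHS]/((back \o chi) G) -[RHS]/((toQ \o map_mpoly (@sf_val _ _ hF)) G).
have vX0 g : toQ (vX g) != 0.
  apply/eqP => /toQ_inj /(congr1 (fun P : {mpoly L[n]} => P@_(U_(enum_rank g)%MM))) /eqP.
  by rewrite mcoeff0 mcoeffX eqxx oner_eq0.
have Om0' i : toQ (Om i)%:MP != 0.
  by apply/eqP => /toQ_inj /eqP; rewrite mpolyC_eq0 (negPf (Om0 i)).
apply: mpoly_rmorph_ext => [c|v] /=.
  by rewrite /back /chi !mmapC map_mpolyC /= ?mmapC.
rewrite /chi map_mpolyX mmapX mmap1U -[in RHS](enum_valK v) -/(vX _).
case: (enum_val v) => [i|t]; rewrite /gen_poly.
  rewrite /back mmapZ /vX mmapX mmap1U enum_rankK /= mulrA -rmorphM -mpolyCM mulVf //.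
  by rewrite rmorph1 mul1r.
rewrite rmorphM rmorphXn rmorphB /= /back /vX !mmapX !mmap1U mmapC !enum_rankK /=.
rewrite addrAC subrr add0r mulrC divfK // expf_neq0 // mulf_neq0 //.
  exact: Om0'.
exact: (vX0 (inl (ri t))).
Qed.

(** [back] after [chi] is the inclusion of polynomial rings, so chi is injective; so is psi, by the
    independence hypothesis. *)
Lemma gen_eval_inj G : gen_eval G = 0 -> G = 0.
Proof.
rewrite gen_evalE => /free chi0; apply/mpolyP => m; rewrite mcoeff0.
have /toQ_inj : toQ (map_mpoly (@sf_val _ _ hF) G) = 0 by rewrite -backE chi0 rmorph0.
move=> /(congr1 (fun P : {mpoly L[n]} => P@_m)); rewrite mcoeff0 mcoeff_map_mpoly => /eqP.
by rewrite fmorph_eq0 => /eqP.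
Qed.

End ChangeOfVariables.

(** * Matrices *)

Section FirstColumn.
Variables (T : comNzRingType) (m : nat).
Implicit Types (w : T) (y : nat -> T).

(** The common shape of the blocks of Phi and Psi, closed under products and inverses. The entry
    [y k] stands in row k + 1, below w. *)
Definition fc_mx w y : 'M[T]_m.+1 :=
  \matrix_(i, j) if j == ord0 then (if i == ord0 then w else y i.-1) else (i == j)%:R.

Lemma fc_mx_mul w y w' y' :
  fc_mx w y *m fc_mx w' y' = fc_mx (w * w') (fun k => y k * w' + y' k).
Proof.
apply/matrixP => i j; rewrite !mxE; have [->|j0] := eqVneq j ord0; last first.
  rewrite (bigD1 j) //= !mxE eqxx (negPf j0) mulr1 big1 ?addr0 // => k kj.
  by rewrite !mxE (negPf j0) (negPf kj) mulr0.
rewrite (bigD1 ord0) //= !mxE /=; have [->|i0] := eqVneq i ord0.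
  rewrite big1 ?addr0 // => k k0.
  by rewrite !mxE (negPf k0) eq_sym (negPf k0) mul0r.
rewrite (bigD1 i) //= !mxE eqxx (negPf i0) mul1r big1 ?addr0 // => k /andP[k0 ki].
by rewrite !mxE (negPf k0) eq_sym (negPf ki) mul0r.
Qed.

Lemma fc_mx1 w y : w = 1 -> y =1 (fun=> 0) -> fc_mx w y = 1%:M.
Proof.
move=> -> y0; apply/matrixP => i j; rewrite !mxE; have [->|j0] := eqVneq j ord0 => //.
by rewrite y0; case: eqP.
Qed.

Lemma eq_fc_mx w w' y y' :
  w = w' -> (forall k, (k < m)%N -> y k = y' k) -> fc_mx w y = fc_mx w' y'.
Proof.
move=> -> yy; apply/matrixP => i j; rewrite !mxE; case: ifP => // _.
case: ifP => // i0; rewrite yy // -ltnS prednK ?ltn_ord // lt0n.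
by rewrite -[i != 0%N :> nat]/(i != ord0) i0.
Qed.

End FirstColumn.

Lemma map_fc_mx (T T' : comNzRingType) (f : {rmorphism T -> T'}) m w y :
  map_mx f (fc_mx m w y) = fc_mx m (f w) (f \o y).
Proof.
apply/matrixP => i j; rewrite !mxE; do 2?case: ifP => // _.
by rewrite rmorph_nat.
Qed.

Lemma fc_mx_inv (F : fieldType) m (w : F) y : w != 0 ->
  fc_mx m w y \in unitmx /\ invmx (fc_mx m w y) = fc_mx m w^-1 (fun k => - (y k / w)).
Proof.
move=> w0; have E : fc_mx m w y *m fc_mx m w^-1 (fun k => - (y k / w)) = 1%:M.
  by rewrite fc_mx_mul; apply: fc_mx1 => [|k]; [exact: divff|exact: subrr].
have [u _] := mulmx1_unit E; split=> //.
by apply: (can_inj (mulKmx u)); rewrite mulmxV // E.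
Qed.

Section BlockDiagonal.
Variables (n : nat) (p_ : 'I_n -> nat).

Lemma mul_mxdiag (T : pzSemiRingType) (A B : forall i, 'M[T]_(p_ i)) :
  \mxdiag_i A i *m \mxdiag_i B i = \mxdiag_i (A i *m B i).
Proof.
rewrite [X in _ *m X]/mxdiag mul_mxdiag_mxblock; apply/eq_mxblock => i j.
have [e|_] := eqVneq i j; last by rewrite mulmx0.
by case: j / e; rewrite !conform_mx_id.
Qed.

Lemma map_mxdiag (T T' : nmodType) (f : {additive T -> T'}) (A : forall i, 'M[T]_(p_ i)) :
  map_mx f (\mxdiag_i A i) = \mxdiag_i map_mx f (A i).
Proof.
apply/matrixP => u v; rewrite !mxE.
have [e|_] := eqVneq (tagnat.sig1 u) (tagnat.sig1 v); last by rewrite !mxE raddf0.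
by move: (tagnat.sig2 v); rewrite -e => w; rewrite !conform_mx_id mxE.
Qed.

Lemma mxdiag_entry (T : nmodType) (Q : T -> Prop) (A : forall i, 'M[T]_(p_ i)) :
  Q 0 -> (forall i k k', Q (A i k k')) -> forall u v, Q ((\mxdiag_i A i) u v).
Proof.
move=> Q0 QA u v; rewrite !mxE.
have [e|_] := eqVneq (tagnat.sig1 u) (tagnat.sig1 v); last by rewrite mxE.
by move: (tagnat.sig2 v); rewrite -e => w; rewrite conform_mx_id.
Qed.

Lemma mxdiag_Rank (T : nmodType) (A : forall i, 'M[T]_(p_ i)) i k k' :
  (\mxdiag_i A i) (tagnat.Rank i k) (tagnat.Rank i k') = A i k k'.
Proof. by have /matrixP/(_ k k') := submxblock_diag A i; rewrite mxE. Qed.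

Lemma mxdiag_eq1 (T : pzSemiRingType) (A : forall i, 'M[T]_(p_ i)) :
  (forall i, A i = 1%:M) -> \mxdiag_i A i = 1%:M.
Proof. by move=> A1; rewrite (eq_mxdiag (B'_ := fun i => 1%:M)) ?mxdiagZ. Qed.

Lemma mxdiag_unit (T : comUnitRingType) (A : forall i, 'M[T]_(p_ i)) :
  (forall i, A i \in unitmx) -> \mxdiag_i A i \in unitmx.
Proof.
move=> Au; suff /mulmx1_unit[] : \mxdiag_i A i *m \mxdiag_i invmx (A i) = 1%:M by [].
by rewrite mul_mxdiag; apply: mxdiag_eq1 => i; rewrite mulmxV.
Qed.

Lemma invmx_mxdiag (T : comUnitRingType) (A : forall i, 'M[T]_(p_ i)) :
  (forall i, A i \in unitmx) -> invmx (\mxdiag_i A i) = \mxdiag_i invmx (A i).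
Proof.
move=> Au; have uA := mxdiag_unit Au.
apply: (can_inj (mulKmx uA)); rewrite mulmxV // mul_mxdiag mxdiag_eq1 // => i.
exact: mulmxV.
Qed.

End BlockDiagonal.

(** * Dimension of a Galois group with polynomial coordinates *)

Section GaloisDimension.
Variables (R : realType) (p : nat) (X : Cinfty R p).
Local Notation L := (LL X).
Variables (r N n : nat) (Psi : 'M[L]_N).
Let hF := ratfun_subfield (Fq_subfield X r).
Local Notation FT := (subfield_type hF).
Variable phi : {rmorphism {mpoly FT[n]} -> LtensL X}.
Hypothesis phiC : forall c, phi c%:MP = inL1 (sf_val c).
Hypothesis phi_inj : forall G, phi G = 0 -> G = 0.
Variables (G : 'M[{mpoly FT[n]}]_N) (c : 'I_n -> FT).
Hypothesis phiG : map_mx phi G = Psi_tilde Psi.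
Hypothesis G_var : forall v, exists i j, G i j = 'X_v.
Hypothesis G_one : map_mx (meval c) G = 1%:M.
Hypothesis Psi_unit : Psi \in unitmx.

Let h := \det G.
Let phi_h : phi h = \det (Psi_tilde Psi).
Proof. by rewrite -phiG det_map_mx. Qed.

Let phi_entry k : phi (mxvec G ord0 k) = mxvec (Psi_tilde Psi) ord0 k.
Proof. by rewrite -phiG -map_mxvec mxE. Qed.

(** Every variable is an entry of G, so the entries of Psi_tilde generate the whole image of phi;
    the image of mu is its localisation at det G. *)
Lemma im_muP x : im_mu r Psi x <-> exists Q e, x * phi h ^+ e = phi Q.
Proof.
rewrite phi_h; split=> [[P [e [PF E]]]|[Q [e E]]].
  exists (\sum_(m <- msupp P) (sf_in hF (PF m))%:MP * mmap1 (fun k => mxvec G ord0 k) m), e.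
  apply: (etrans E); rewrite /mmap rmorph_sum; apply: eq_bigr => m _; rewrite rmorphM phiC; congr (_ * _).
  by rewrite /mmap1 rmorph_prod; apply: eq_bigr => k _; rewrite rmorphXn phi_entry.
have /choice[ij ijP] : forall v, exists ij, mxvec G ord0 ij = 'X_v.
  by move=> v; have [i [j ijE]] := G_var v; exists (mxvec_index i j); rewrite mxvecE.
pose P1 : {rmorphism {mpoly FT[n]} -> {mpoly FT[N * N]}} := mmap (@mpolyC (N * N) FT) (fun v => 'X_(ij v)).
exists (map_mpoly (@sf_val _ _ hF) (P1 Q)), e; split=> [u|].
  by rewrite mcoeff_map_mpoly; exact: sf_valF.
pose ev : {rmorphism {mpoly L[N * N]} -> LtensL X} :=
  mmap (tinl (@kbar_t R p X)) (fun k => mxvec (Psi_tilde Psi) ord0 k).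
apply: (etrans E); rewrite -[RHS]/((ev \o map_mpoly (@sf_val _ _ hF) \o P1) Q).
apply: mpoly_rmorph_ext => [a|v].
  by rewrite phiC /= /P1 mmapC map_mpolyC /= /ev mmapC.
by rewrite /= /P1 mmapX mmap1U map_mpolyX /ev mmapX mmap1U -phi_entry ijP.
Qed.

Lemma im_mu_subring : subring_set (im_mu r Psi).
Proof.
split=> [|x y|x y|x].
- by apply/im_muP; exists 1, 0%N; rewrite expr0 mulr1 rmorph1.
- move=> /im_muP[Q [e E]] /im_muP[Q' [e' E']]; apply/im_muP.
  exists (Q * h ^+ e' + Q' * h ^+ e), (e + e')%N.
  rewrite rmorphD !rmorphM !rmorphXn -E -E' exprD mulrDl !mulrA; congr (_ + _).
  by rewrite -!mulrA [X in _ * X]mulrC.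
- move=> /im_muP[Q [e E]] /im_muP[Q' [e' E']]; apply/im_muP; exists (Q * Q'), (e + e')%N.
  by rewrite rmorphM -E -E' exprD mulrACA.
- by move=> /im_muP[Q [e E]]; apply/im_muP; exists (- Q), e; rewrite mulNr E rmorphN.
Qed.

(** The point c corresponds to the identity matrix. There det G is 1, as the lower bound requires of
    its point. *)
Lemma Galois_dimension : Krull_dim (Galois_group r Psi) n.
Proof.
(* Psi_tilde is the product of Psi^-1 on the left factor and Psi on the right, so det Psi (x) (det
   Psi)^-1 inverts its determinant. *)
have detP : tinl (@kbar_t R p X) (\det Psi) * tinr (@kbar_t R p X) (\det Psi)^-1 * phi h = 1.
  rewrite phi_h /Psi_tilde det_mulmx.
  rewrite -[map_mx (inL1 (X := X)) _]/(map_mx (tinl (@kbar_t R p X)) _).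
  rewrite -[map_mx (inL2 (X := X)) _]/(map_mx (tinr (@kbar_t R p X)) _).
  rewrite !det_map_mx mulrACA -!rmorphM det_inv.
  have : \det Psi \is a GRing.unit by rewrite -unitmxE.
  by move=> u; rewrite divrr // mulVr // !rmorph1 mulr1.
split.
  apply: (Krull_lower phi_inj im_muP (c := c)).
  rewrite /h -[X in X != 0]/(meval c (\det G)) -det_map_mx G_one det1.
  exact: oner_neq0.
move=> m; apply: (Krull_upper im_mu_subring detP).
  by move=> Q; apply/im_muP; exists Q, 0%N; rewrite expr0 mulr1.
by move=> x /im_muP.
Qed.

End GaloisDimension.

(** * Rigid analytic trivialization *)

Section Trivialization.
Variables (R : realType) (p : nat) (X : Cinfty R p).
Local Notation C := (Cfield X).
Local Notation L := (LL X).
Local Notation th := (@theta R p X).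

Let hK := ratfun_subfield (kbar_subfield X).

Lemma in_GL_mul N (A B : 'M[L]_N) : in_GL_kbar_t A -> in_GL_kbar_t B -> in_GL_kbar_t (A *m B).
Proof.
move=> [Ak Au] [Bk Bu]; split; last by rewrite unitmx_mul Au Bu.
move=> i j; rewrite mxE; apply: (subfield_sum hK) => k _.
by apply: (subfieldM hK); [exact: Ak|exact: Bk].
Qed.

Lemma in_GL_twist n N (A : 'M[L]_N) : in_GL_kbar_t A -> in_GL_kbar_t (twist_mx n A).
Proof.
move=> [Ak Au]; split; last by rewrite [_ \in _](map_unitmx (@twist R p X n)).
by move=> i j; rewrite mxE; apply: ratfun_twist (Ak i j) => c; exact: kbar_Croot.
Qed.

Lemma in_GL_1 N : in_GL_kbar_t (1%:M : 'M[L]_N).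
Proof. by split; [move=> i j; rewrite mxE; exact: (subfield_nat hK)|exact: unitmx1]. Qed.

Lemma in_GL_mxdiag n (q : 'I_n -> nat) (A : forall i, 'M[L]_(q i)) :
  (forall i, in_GL_kbar_t (A i)) -> in_GL_kbar_t (\mxdiag_i A i).
Proof.
move=> hA; split; last by apply: mxdiag_unit => i; case: (hA i).
by move=> i j; apply: mxdiag_entry => [|k]; [exact: (subfield0 hK)|case: (hA k)].
Qed.

Lemma twist_mxM n N (A B : 'M[L]_N) : twist_mx n (A *m B) = twist_mx n A *m twist_mx n B.
Proof. by rewrite /twist_mx map_mxM. Qed.

Lemma in_GL_iter r e N (A : 'M[L]_N) : in_GL_kbar_t A -> in_GL_kbar_t (iter_Phi r A e).
Proof.
move=> hA; elim: e => [|e IH]; first exact: in_GL_1.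
by apply: in_GL_mul IH; exact: in_GL_twist.
Qed.

Lemma twist_iter r e N (A B : 'M[L]_N) : twist_mx r B = A *m B ->
  twist_mx (r * e) B = iter_Phi r A e *m B.
Proof.
move=> E; elim: e => [|e IH].
  by rewrite muln0 mul1mx; apply/matrixP => i j; rewrite mxE twist0.
rewrite /= -mulmxA -IH (mulnC e) -twist_mxM -E; apply/matrixP => i j.
by rewrite !mxE -twistD mulnSr.
Qed.

Lemma rigid_derived r e (M : pre_t_motive X) (Psi : 'M[L]_(rank M)) :
  rigid_analytic_trivialization r Psi ->
  @rigid_analytic_trivialization R p X (r * e) (derived r e M) Psi.
Proof.
by move=> [PhiGL Psiu E]; split; [exact: in_GL_iter|exact: Psiu|exact: twist_iter].
Qed.

Lemma rigid_direct_sum r n (M : 'I_n -> pre_t_motive X) (Psi : forall i, 'M[L]_(rank (M i))) :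
  (forall i, rigid_analytic_trivialization r (Psi i)) ->
  @rigid_analytic_trivialization R p X r (direct_sum M) (\mxdiag_i Psi i).
Proof.
move=> h; split.
- by apply: in_GL_mxdiag => i; case: (h i).
- by apply: mxdiag_unit => i; case: (h i).
rewrite /= [LHS](map_mxdiag (@twist R p X r)) mul_mxdiag; apply: eq_mxdiag => i.
by case: (h i).
Qed.

Variables (eta : nat -> C) (m : nat -> nat -> nat) (alpha : nat -> nat -> nat -> C).

Lemma Psi_rnE r n : Psi_rn eta m alpha r n =
  fc_mx (m1 p m r n) (toLL (Omega eta r) ^+ n)
    (fun k => toLL (Omega eta r) ^+ n * toLL (Lseries (alpha r n k) r n)).
Proof.
apply/matrixP => i j; rewrite !mxE; case: ifP => // _; case: ifP => _; rewrite rmorphM rmorphXn //.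
by rewrite rmorph1 mulr1.
Qed.

Lemma rigid_block r n : (0 < r)%N -> eta r ^+ (p ^ r).-1 = - th ->
  (forall j, (j < m1 p m r n)%N -> exists2 i, alpha r n j = th ^+ i & (i * (p ^ r).-1 < n * p ^ r)%N) ->
  @rigid_analytic_trivialization R p X r (PreTMotive (Phi_rn m alpha r n)) (Psi_rn eta m alpha r n).
Proof.
move=> r0 etaP al; pose D : {poly C} := 'X - th%:P.
have Om0 : toLL (Omega eta r) != 0 :> L by rewrite toLL_eq0 (Omega_neq0 r0 etaP).
have D0 : poly_toLL D != 0 :> L by rewrite poly_toLL_eq0 polyXsubC_eq0.
have DX0 := expf_neq0 n D0.
have PhiE : Phi_rn m alpha r n = fc_mx (m1 p m r n) (poly_toLL D ^+ n)
    (fun k => poly_toLL ((Croot r (alpha r n k))%:P * D ^+ n)).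
  apply/matrixP => i j; rewrite !mxE; case: ifP => // _; case: ifP => // _.
  by rewrite mul1r (rmorphXn (@poly_toLL R p X)).
have DK : kbar_t (poly_toLL D : L).
  by apply/(ratfun_poly (kbar_subfield X))/(coefs_in_linear (kbar_subfield X)); exact: kbar_theta.
split; rewrite /= ?PhiE ?Psi_rnE; last first.
- apply/matrixP => i j; rewrite fc_mx_mul !mxE.
  case: ifP => _; last exact: (rmorph_nat (@twist R p X r)).
  case: ifP => [_|i0].
    by rewrite rmorphXn /= (twist_Omega r0 etaP erefl) exprMn.
  have im : (i.-1 < m1 p m r n)%N by rewrite -ltnS prednK ?ltn_ord // lt0n -[i != 0%N :> nat]/(i != ord0) i0.
  have [la -> laP] := al _ im.
  rewrite (@twist_Z R p X r n 1 r0 eta etaP (fun=> la) (fun=> laP) _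
    (fun=> toLL (Lseries (th ^+ la) r n)) erefl (fun=> erefl) ord0).
  exact: addrC.
- exact: (fc_mx_inv _ _ (expf_neq0 n Om0)).1.
split; last exact: (fc_mx_inv _ _ DX0).1.
move=> i j; rewrite mxE; case: ifP => _; last exact: (subfield_nat hK).
case: ifP => [_|i0]; first exact: (subfieldX hK).
have im : (i.-1 < m1 p m r n)%N by rewrite -ltnS prednK ?ltn_ord // lt0n -[i != 0%N :> nat]/(i != ord0) i0.
have [la -> laP] := al _ im.
apply: (ratfun_poly (kbar_subfield X)); apply: (coefs_inM (kbar_subfield X)).
  apply/(coefs_inC (kbar_subfield X))/kbar_Croot/(subfieldX (kbar_subfield X)); exact: kbar_theta.
by apply/(coefs_inXn (kbar_subfield X))/(coefs_in_linear (kbar_subfield X)); exact: kbar_theta.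
Qed.

End Trivialization.

Section PsiTilde.
Variables (R : realType) (p : nat) (X : Cinfty R p).
Local Notation L := (LL X).
Local Notation K := (@kbar_t R p X).

Lemma Psi_tilde_mxdiag n (q : 'I_n -> nat) (A : forall i, 'M[L]_(q i)) :
  (forall i, A i \in unitmx) -> Psi_tilde (\mxdiag_i A i) = \mxdiag_i Psi_tilde (A i).
Proof.
move=> Au; rewrite /Psi_tilde invmx_mxdiag // -mul_mxdiag; congr (_ *m _).
  exact: (map_mxdiag (tinl K)).
exact: (map_mxdiag (tinr K)).
Qed.

Lemma Psi_tilde_fc m (w : L) (x : nat -> L) : w != 0 ->
  Psi_tilde (fc_mx m w (fun k => w * x k)) =
  fc_mx m (tinl K w^-1 * tinr K w) (fun k => tinr K w * (tinr K (x k) - tinl K (x k))).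
Proof.
move=> w0; rewrite /Psi_tilde (fc_mx_inv m _ w0).2.
rewrite [map_mx (inL1 (X := X)) _](map_fc_mx (tinl K)) [map_mx (inL2 (X := X)) _](map_fc_mx (tinr K)).
rewrite fc_mx_mul; apply: eq_fc_mx => [//|k _ /=].
have -> : w * x k / w = x k by rewrite [w * _]mulrC mulfK.
rewrite rmorphN rmorphM mulNr mulrBr addrC; congr (_ - _).
exact: mulrC.
Qed.

End PsiTilde.

(** * The Galois group of the block diagonal matrix *)

Section BlockGalois.
Variables (R : realType) (p : nat) (X : Cinfty R p).
Local Notation L := (LL X).
Local Notation K := (@kbar_t R p X).
Variables (d l : nat) (U : 'I_d -> nat) (N M : forall i, 'I_(U i) -> nat).
Variables (Om : 'I_d -> L) (Xs : forall i, 'I_(U i) -> nat -> L).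
Arguments Xs {i}.
Local Notation blk := {i : 'I_d & {k : 'I_(U i) & 'I_(M k)}}.
Local Notation gens := ('I_d + blk)%type.
Let Xb (t : blk) : L := Xs (tag (tagged t)) (nat_of_ord (tagged (tagged t))).
Hypothesis Om0 : forall i, Om i != 0.
Hypothesis has_one : forall i, exists k : 'I_(U i), N k = 1%N.
Hypothesis free : forall P : {mpoly L[#|{: gens}|]},
  mmap (tinl K) (fun v => tinr K (match enum_val v with inl i => Om i | inr t => Xb t end)) P = 0 -> P = 0.
Let hF := ratfun_subfield (Fq_subfield X l).
Local Notation FT := (subfield_type hF).
Local Notation n := #|{: gens}|.

Let Psi : 'M[L]_(\sum_i \sum_k (M k).+1) :=
  \mxdiag_(i < d) \mxdiag_(k < U i) fc_mx (M k) (Om i ^+ N k) (fun j => Om i ^+ N k * Xs k j).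

Let Psi_block_unit i (k : 'I_(U i)) : fc_mx (M k) (Om i ^+ N k) (fun j => Om i ^+ N k * Xs k j) \in unitmx.
Proof. exact: (fc_mx_inv _ _ (expf_neq0 (N k) (Om0 i))).1. Qed.

Let phi : {rmorphism {mpoly FT[n]} -> LtensL X} :=
  @gen_eval L K (ratfun (Fq l)) hF 'I_d blk Om Xb
    (fun t => tag t) (fun t => N (tag (tagged t))).

Let var_ i : {mpoly FT[n]} := 'X_(enum_rank (inl i : gens)).
Let bvar i (k : 'I_(U i)) (j : 'I_(M k)) : {mpoly FT[n]} :=
  'X_(enum_rank (inr (Tagged (fun i => {k : 'I_(U i) & 'I_(M k)}) (Tagged (fun k : 'I_(U i) => 'I_(M k)) j)) : gens)).
Let G : 'M[{mpoly FT[n]}]_(\sum_i \sum_k (M k).+1) :=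
  \mxdiag_(i < d) \mxdiag_(k < U i)
    fc_mx (M k) (var_ i ^+ N k) (fun j => oapp (@bvar i k) 0 (insub j)).

Let phi_var i : phi (var_ i) = tinl K (Om i)^-1 * tinr K (Om i).
Proof. exact: gen_evalX. Qed.

Let phiG : map_mx phi G = Psi_tilde Psi.
Proof.
rewrite /Psi Psi_tilde_mxdiag; last by move=> i; apply: mxdiag_unit => k; exact: Psi_block_unit.
rewrite /G map_mxdiag; apply: eq_mxdiag => i.
rewrite Psi_tilde_mxdiag; last by move=> k; exact: Psi_block_unit.
rewrite map_mxdiag; apply: eq_mxdiag => k.
rewrite Psi_tilde_fc; last exact: expf_neq0.
rewrite map_fc_mx; apply: eq_fc_mx => [|j jM].
  by rewrite rmorphXn /= phi_var exprMn -!rmorphXn exprVn.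
by rewrite /= insubT /=; apply: (etrans (gen_evalX _ _ _ _ _ _ _)).
Qed.

(** The corner of the block (r, n) is W_r^n, so the block n = 1 shows W_r itself as an entry; every
    Y stands in the first column of its block. *)
Lemma block_Galois_dimension : Krull_dim (Galois_group l Psi) n.
Proof.
(* At W = 1 and Y = 0 all blocks become identity matrices. *)
apply: (@Galois_dimension R p X l _ n Psi phi _ _ G
   (fun v => if enum_val v is inl _ then 1 else 0)).
- by move=> c; exact: gen_evalC.
- exact: gen_eval_inj.
- exact: phiG.
- move=> v; rewrite -(enum_valK v); case: (enum_val v) => [i|[i [k j]]].
    have [k k1] := has_one i.
    exists (tagnat.Rank i (tagnat.Rank k ord0)), (tagnat.Rank i (tagnat.Rank k ord0)).
    by rewrite !mxdiag_Rank mxE /= k1 expr1.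
  exists (tagnat.Rank i (tagnat.Rank k (lift ord0 j))), (tagnat.Rank i (tagnat.Rank k ord0)).
  by rewrite !mxdiag_Rank mxE /= valK.
- rewrite /G map_mxdiag; apply: mxdiag_eq1 => i; rewrite map_mxdiag; apply: mxdiag_eq1 => k.
  rewrite map_fc_mx; apply: fc_mx1 => [|j] /=.
    by rewrite rmorphXn /= mevalXU enum_rankK expr1n.
  by case: insubP => [u _ _|_] /=; rewrite ?rmorph0 // mevalXU enum_rankK.
- by apply: mxdiag_unit => i; apply: mxdiag_unit => k; exact: Psi_block_unit.
Qed.

End BlockGalois.

(** * Index sets and conclusion *)

Lemma ellS d : ell d.+1 = lcmn (ell d) d.+1.
Proof. by rewrite /ell big_nat_recr. Qed.

Lemma ell_gt0 d : (0 < ell d)%N.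
Proof. by elim: d => [|d IH]; [rewrite /ell big_nil|rewrite ellS lcmn_gt0 IH]. Qed.

Lemma dvdn_ell d r : (r < d)%N -> (r.+1 %| ell d)%N.
Proof.
elim: d => // d IH; rewrite ltnS leq_eqVlt ellS => /orP[/eqP ->|/IH h].
  exact: dvdn_lcmr.
exact: dvdn_trans h (dvdn_lcml _ _).
Qed.

Section Uset.
Variables (p r s : nat) (p_prime : prime p) (r0 : (0 < r)%N).

Lemma Uset_uniq : uniq (Uset p r s).
Proof. by rewrite /Uset; case: ifP => // _; rewrite filter_uniq ?iota_uniq. Qed.

Lemma Uset_gt0 n : n \in Uset p r s -> (0 < n)%N.
Proof.
rewrite /Uset; case: ifP => _; first by rewrite inE => /eqP->.
by rewrite mem_filter mem_iota => /andP[_ /andP[]].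
Qed.

Lemma Uset_ndvd n : n \in Uset p r s -> ~~ (p %| n)%N.
Proof.
rewrite /Uset; case: ifP => [/andP[/eqP -> _]|_]; first by rewrite inE => /eqP->.
by rewrite mem_filter => /andP[/andP[]].
Qed.

Lemma Uset_weight n : ~~ ((p == 2%N) && (r == 1%N)) -> n \in Uset p r s -> ~~ ((p ^ r).-1 %| n)%N.
Proof. by rewrite /Uset => /negPf ->; rewrite mem_filter => /andP[/andP[]]. Qed.

(** p^r - 1 divides 1 only if p^r = 2, which is the case treated apart. Having n = 1 in the index
    set makes W_r a matrix entry. *)
Lemma one_Uset : (0 < s)%N -> 1%N \in Uset p r s.
Proof.
move=> s0; rewrite /Uset; case: ifP => // /negbT pr; rewrite mem_filter mem_iota leqnn add1n ltnS s0 andbT.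
have p1 := prime_gt1 p_prime; rewrite !dvdn1 neq_ltn p1 orbT /= andbT; apply: contra pr => /eqP pr.
have {}pr : (p ^ r = 2)%N by rewrite -(prednK (_ : 0 < p ^ r)%N) ?pr // expn_gt0 (ltnW p1).
have p2 : p = 2%N.
  by apply/eqP; rewrite eqn_leq p1 andbT dvdn_leq // -pr dvdn_exp.
by rewrite p2 eqxx -(eqn_exp2l r 1 (ltnSn 1)) -{1}p2 pr.
Qed.

End Uset.
Lemma basis_independent (R : realType) (p : nat) (X : Cinfty R p) (r n m M : nat) (w : X)
    (al : nat -> X) (N : set X) (c0 : X) (c : 'I_M -> X) : M = m.+1 ->
  basis_over (Fq_theta r) N (w :: [seq Plog r n (al j) | j <- iota 0 m.+1]) ->
  Fq_theta r c0 -> (forall j, Fq_theta r (c j)) ->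
  c0 * w + \sum_j c j * Plog r n (al j) = 0 -> c0 = 0 /\ forall j, c j = 0.
Proof.
move=> Mm; subst M; move=> [free _] c0F cF E.
pose e i := if i is j.+1 then oapp c 0 (insub j) else c0.
have eF i : Fq_theta r (e i).
  case: i => //= j; case: insubP => [u _ _|_] //=.
  exact: subfield0 (Fq_theta_subfield X r).
have e0 := free e eF _.
have sum0 : \sum_(i < m.+2) e i * (w :: [seq Plog r n (al j) | j <- iota 0 m.+1])`_i = 0.
  rewrite big_ord_recl -[RHS]E; congr (_ + _); apply: eq_bigr => j _.
  have -> : nat_of_ord (lift ord0 j) = j.+1 by [].
  rewrite -[_`_j.+1]/([seq Plog r n (al i) | i <- iota 0 m.+1]`_j).
  by rewrite (nth_map 0%N) ?size_iota // nth_iota // [e _]/= valK.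
move: e0; rewrite /= size_map size_iota => /(_ sum0) e0; split; first exact: (e0 0%N).
by move=> j; have := e0 j.+1; rewrite /= valK /=; apply; rewrite ltnS; exact: ltn_ord.
Qed.

Lemma card_block_index (d : nat) (U : 'I_d -> nat) (M : forall i, 'I_(U i) -> nat) :
  #|{: 'I_d + {i : 'I_d & {k : 'I_(U i) & 'I_(M i k)}}}| = (d + \sum_i \sum_k M i k)%N.
Proof.
rewrite card_sum card_ord card_tagged sumnE big_map big_enum; congr addn.
apply: eq_bigr => i _; rewrite card_tagged sumnE big_map big_enum.
by apply: eq_bigr => k _; rewrite card_ord.
Qed.

Theorem theorem4p8 (R : realType) (p : nat) (p_prime : prime p) (X : Cinfty R p)
  (* the chosen (p^r - 1)-th roots of -theta *)
  (eta : nat -> X)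
  (eta_root : forall r, (0 < r)%N -> eta r ^+ (p ^ r).-1 = - theta)
  (* the Anderson-Thakur data *)
  (l : nat -> nat -> nat) (h : nat -> nat -> nat -> X)
  (Anderson_Thakur : forall r n, (0 < r)%N -> (0 < n)%N ->
    [/\ (l r n * (p ^ r).-1 < n * p ^ r)%N,
        forall i, (i <= l r n)%N -> Fq_theta r (h r n i)
      & zeta X r n = \sum_(i < (l r n).+1) h r n i * Plog r n (theta ^+ i)])
  (* the chosen bases of N_{rn} *)
  (m : nat -> nat -> nat) (alpha : nat -> nat -> nat -> X)
  (alpha_basis : forall r n, (0 < r)%N -> (0 < n)%N -> ~~ ((p ^ r).-1 %| n)%N ->
    [/\ forall j, (j <= m r n)%N ->
          exists2 i, (i <= l r n)%N & alpha r n j = theta ^+ i,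
        basis_over (Fq_theta r) (Nspan eta r n (l r n))
          (pi_tilde eta r ^+ n ::
             [seq Plog r n (alpha r n j) | j <- iota 0 (m r n).+1])
      & basis_over (Fq_theta r) (Nspan eta r n (l r n))
          [:: pi_tilde eta r ^+ n, zeta X r n &
             [seq Plog r n (alpha r n j) | j <- iota 1 (m r n)]]])
  (s d : nat) (s_gt0 : (0 < s)%N) (d_ge2 : (2 <= d)%N) :
  rigid_analytic_trivialization (ell d) (Psi_sum eta m alpha s d) /\
  Krull_dim (Galois_group (ell d) (Psi_sum eta m alpha s d))
    (d + \sum_(1 <= r < d.+1) \sum_(n <- Uset p r s) m1 p m r n)%N.
Proof.
have s_pos := s_gt0.
pose U (i : 'I_d) := size (Uset p i.+1 s).
pose N (i : 'I_d) (k : 'I_(U i)) := nth 0%N (Uset p i.+1 s) k.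
pose M (i : 'I_d) (k : 'I_(U i)) := m1 p m i.+1 (N i k).
have N_in i k : N i k \in Uset p i.+1 s by exact: mem_nth.
have M_weight i k : (0 < M i k)%N ->
    M i k = (m i.+1 (N i k)).+1 /\ ~~ ((p ^ i.+1).-1 %| N i k)%N.
  rewrite /M /m1; case: ifP => // /negbT special _; split=> //.
  exact: Uset_weight special (N_in i k).
(* Chooses the exponents of all alpha at once, with value 0 outside the range of the basis data. *)
have /choice[la laP] : forall u : nat * nat * nat, exists i, (0 < u.1.1)%N -> (0 < u.1.2)%N ->
    ~~ ((p ^ u.1.1).-1 %| u.1.2)%N -> (u.2 <= m u.1.1 u.1.2)%N ->
    (i <= l u.1.1 u.1.2)%N /\ alpha u.1.1 u.1.2 u.2 = theta ^+ i.
  move=> [[r n] j] /=; have [[r0 [n0 [nr jm]]]|no] :=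
    pselect ((0 < r)%N /\ (0 < n)%N /\ ~~ ((p ^ r).-1 %| n)%N /\ (j <= m r n)%N).
    by have [/(_ j jm)[i il ai] _ _] := alpha_basis r n r0 n0 nr; exists i.
  by exists 0%N => r0 n0 nr jm; case: no.
pose ex (i : 'I_d) (k : 'I_(U i)) j := la (i.+1, N i k, j).
have exP i k j : (j < M i k)%N ->
    alpha i.+1 (N i k) j = theta ^+ ex i k j /\
    (ex i k j * (p ^ i.+1).-1 < N i k * p ^ i.+1)%N.
  move=> jM; have [Mm nd] := M_weight i k (leq_ltn_trans (leq0n j) jM).
  have n0 := Uset_gt0 (N_in i k).
  have jm : (j <= m i.+1 (N i k))%N by rewrite -ltnS -Mm.
  have [il ai] := laP (i.+1, N i k, j) (ltn0Sn i) n0 nd jm.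
  have [lt _ _] := Anderson_Thakur i.+1 (N i k) (ltn0Sn i) n0.
  by split=> //; apply: leq_ltn_trans lt; rewrite leq_mul2r il orbT.
split.
  apply: (@rigid_direct_sum R p X (ell d) d
    (fun i : 'I_d => derived i.+1 (ell d %/ i.+1) (M_r m alpha s i.+1)) (fun i : 'I_d => Psi_r eta m alpha s i.+1)) => i.
  have := @rigid_derived R p X i.+1 (ell d %/ i.+1) (M_r m alpha s i.+1) (Psi_r eta m alpha s i.+1).
  rewrite mulnC divnK; last exact: dvdn_ell.
  apply; apply: rigid_direct_sum => k; apply: rigid_block => //; first exact: eta_root.
  by move=> j jM; have [E lt] := exP i k j jM; exists (ex i k j).
(* The asserted dimension is the number of generators: one Omega_r for each r, one L-series for each
   alpha_j of each block. *)
have -> : (d + \sum_(1 <= r < d.+1) \sum_(n <- Uset p r s) m1 p m r n)%N =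
    #|{: 'I_d + {i : 'I_d & {k : 'I_(U i) & 'I_(M i k)}}}|.
  rewrite card_block_index big_add1 big_mkord; congr addn; apply: eq_bigr => i _.
  by rewrite (big_nth 0%N) big_mkord.
pose Om (i : 'I_d) : LL X := toLL (Omega eta i.+1).
pose Xs (i : 'I_d) (k : 'I_(U i)) j : LL X := toLL (Lseries (alpha i.+1 (N i k) j) i.+1 (N i k)).
have Om0 i : Om i != 0 by rewrite toLL_eq0 (Omega_neq0 (ltn0Sn i) (eta_root _ (ltn0Sn i))).
have PsiE : Psi_sum eta m alpha s d =
    \mxdiag_(i < d) \mxdiag_(k < U i) fc_mx (M i k) (Om i ^+ N i k) (fun j => Om i ^+ N i k * Xs i k j).
  by apply: eq_mxdiag => i; apply: eq_mxdiag => k; exact: Psi_rnE.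
rewrite PsiE.
apply: (block_Galois_dimension (ell d) Om0).
  by move=> i; have /(nthP 0%N)[k ks kE] := one_Uset p_prime (ltn0Sn i) s_pos; exists (Ordinal ks).
have free Q := @gen_val_alg_free R p X d (ell d) (ell_gt0 d) (@dvdn_ell d) eta eta_root U N M
  (fun i k j => ex i k j) _ _ _ _ _ Q.
move=> P; rewrite (_ : (fun v => _) = (fun v => tinr kbar_t
    (gen_val eta N (fun i k (j : 'I_(M i k)) => ex i k j) (enum_val v)))); last first.
  apply/funext => v; case: (enum_val v) => [i|[i [k j]]]; first by [].
  rewrite /gen_val /=.
  rewrite /Xs (exP i k j (ltn_ord j)).1.
  by [].
apply: (tens_alg_free (hK := ratfun_subfield (kbar_subfield X))); apply: free.
- by move=> i k; exact: Uset_gt0 (N_in i k).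
- move=> i k k' kk; apply/val_inj/eqP.
  by rewrite -(nth_uniq 0%N (ltn_ord k) (ltn_ord k') (Uset_uniq p i.+1 s)); apply/eqP.
- by move=> i k; exact: Uset_ndvd (N_in i k).
- by move=> i k j; have [_] := exP i k j (ltn_ord j).
(* [M0] rules out p = 2, r = 1, so p^r - 1 does not divide n and the chosen basis of N_rn is
   available. *)
move=> i k c0 c M0 c0F cF E.
have [Mm nd] := M_weight i k M0.
have [_ basis _] := alpha_basis i.+1 (N i k) (ltn0Sn i) (Uset_gt0 (N_in i k)) nd.
apply: (basis_independent Mm basis c0F cF); rewrite -[RHS]E; congr (_ + _).
by apply: eq_bigr => j _; rewrite (exP i k j (ltn_ord j)).1.
Qed.
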